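(* Let $\Phi:\mathbb{U}\to\mathbb{C}$ be a biholomorphic function onto its image with $\Phi(0)=1$, $\operatorname{Re}\Phi(z)>0$ on $\mathbb{U}$, $\Phi'(0)>0$, $\Phi''(0)\in\mathbb{R}$, and suppose that $$|\Phi''(0)+2(\Phi'(0))^2|\ge 2\Phi'(0).$$ Let $g:\mathbb{U}^n\to\mathbb{C}$ be holomorphic with $g(0)=1$, let $G(z)=z\,g(z)$, and suppose that $(DG(z))^{-1}G(z)\in\mathcal{M}_\Phi$. Then for all $z\in\mathbb{U}^n$, $$\left\|\left(\frac{D^3G(0)(z^3)}{3!}\right)^2-\left(\frac{D^2G(0)(z^2)}{2!}\right)^2\right\|\le\frac{(\Phi'(0))^2\|z\|^6}{4}\left(\frac12\frac{\Phi''(0)}{\Phi'(0)}+\Phi'(0)\right)^2+\left(\Phi'(0)\|z\|^2\right)^2 .$$ The bound is sharp, i.e. for each such $\Phi$ equality holds for some such $g$ and some $z\in\mathbb{U}^n\setminus\{0\}$.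
   Context: $\mathbb{U}$ is the open unit disk in $\mathbb{C}$, $\mathbb{U}^n$ is the open unit polydisc in $\mathbb{C}^n$, and $\|z\|=\max_{1\le j\le n}|z_j|$ for $z=(z_1,\dots,z_n)'\in\mathbb{C}^n$. $D^kG(0)(z^k)=D^kG(0)(z,\dots,z)\in\mathbb{C}^n$, where $D^kG(0)$ is the $k$-th Fréchet derivative at $0$. Squares of vectors in $\mathbb{C}^n$ are taken componentwise. $\mathcal{M}_\Phi$ is the class of holomorphic $p=(p_1,\dots,p_n)':\mathbb{U}^n\to\mathbb{C}^n$ with $p(0)=0$, $Dp(0)=I$ and $z_k/p_k(z)\in\Phi(\mathbb{U})$ for all $z\in\mathbb{U}^n\setminus\{0\}$ and $k$ with $|z_k|=\|z\|$. The condition $(DG(z))^{-1}G(z)\in\mathcal{M}_\Phi$ includes that $DG(z)$ is invertible for every $z\in\mathbb{U}^n$. *)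

(* Defs.v *)
From HB Require Import structures.
From mathcomp Require Import all_boot all_order all_algebra.
From mathcomp Require Import all_classical all_reals all_analysis.
From mathcomp Require Import complex.
Import Order.TTheory GRing.Theory Num.Theory.
Import numFieldNormedType.Exports.

Set Implicit Arguments.
Unset Strict Implicit.
Unset Printing Implicit Defensive.

Local Open Scope classical_set_scope.
Local Open Scope ring_scope.

(* Everything is stated over a numFieldType K; the intended instance is
   K = R[i] with R : realType, for which [differentiable] over K is complex
   (Fréchet) differentiability.  K^n is the type 'rV[K]_n of row vectors, whose
   library norm `|z| is the maximum of the `|z 0 j|, as an element of K. *)

Definition unit_disk (K : numFieldType) : set K := [set z | `|z| < 1].

Definition unit_polydisc (K : numFieldType) (n : nat) : set 'rV[K]_n :=
  [set z | forall j, `|z 0 j| < 1].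

(* To be used on open sets only. *)
Definition holomorphic_on (K : numFieldType) (V W : normedModType K)
    (A : set V) (f : V -> W) : Prop :=
  forall z, A z -> differentiable f z.

Definition biholomorphic_onto_image (K : numFieldType) (A : set K)
    (f : K -> K) : Prop :=
  [/\ holomorphic_on A f,
      open (f @` A) &
      exists2 h : K -> K, holomorphic_on (f @` A) h &
        forall z, A z -> h (f z) = z].

(* The k-th derivative of a function of one variable; stated over K because for
   K = R[i] unification does not find the codomain structure of [derive1n]. *)
Definition deriv_at (K : numFieldType) (k : nat) (f : K -> K) (z : K) : K :=
  derive1n k f z.

(* D^k f(x)(v_1, ..., v_k), through the identification
   D^(k+1) f(x)(v_1, ..., v_(k+1)) = (D (D^k f)(x) v_1)(v_2, ..., v_(k+1)). *)
Fixpoint frechet_deriv (K : numFieldType) (V W : normedModType K)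
    (f : V -> W) (x : V) (vs : seq V) {struct vs} : W :=
  if vs is v :: vs' then 'd (fun y => frechet_deriv f y vs') x v else f x.

(* D^k f(x)(v^k) *)
Definition frechet_deriv_pow (K : numFieldType) (V W : normedModType K)
    (k : nat) (f : V -> W) (x v : V) : W :=
  frechet_deriv f x (nseq k v).

Definition sqr_vec (K : numFieldType) (n : nat) (v : 'rV[K]_n) : 'rV[K]_n :=
  \row_j (v 0 j) ^+ 2.

(* The class M_Phi.  Since x / 0 = 0 in K, the nonvanishing of p_k(z) is stated
   explicitly. *)
Definition class_M (K : numFieldType) (n : nat) (Phi : K -> K)
    (p : 'rV[K]_n -> 'rV[K]_n) : Prop :=
  [/\ holomorphic_on (@unit_polydisc K n) p,
      p 0 = 0,
      (forall v, 'd p 0 v = v) &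
      forall z k, unit_polydisc z -> z != 0 -> `|z 0 k| = `|z| ->
        p z 0 k != 0 /\ (Phi @` @unit_disk K) (z 0 k / p z 0 k)].

(* Jacobian matrices act on row vectors on the right: 'd G z v = v *m 'J G z,
   so that (DG(z))^-1 w is w *m invmx ('J G z). *)
Definition inv_deriv_apply (K : numFieldType) (n : nat)
    (G : 'rV[K]_n -> 'rV[K]_n) (z : 'rV[K]_n) : 'rV[K]_n :=
  G z *m invmx ('J G z).

Definition inv_deriv_in_M (K : numFieldType) (n : nat) (Phi : K -> K)
    (G : 'rV[K]_n -> 'rV[K]_n) : Prop :=
  (forall z, unit_polydisc z -> 'J G z \in unitmx) /\
  class_M Phi (inv_deriv_apply G).

Definition scaled_id (K : numFieldType) (n : nat) (g : 'rV[K]_n -> K)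
    (z : 'rV[K]_n) : 'rV[K]_n := g z *: z.

(* g is holomorphic with g(0) = 1, and G(z) = z g(z) satisfies
   (DG(z))^-1 G(z) \in M_Phi. *)
Definition admissible (K : numFieldType) (n : nat) (Phi : K -> K)
    (g : 'rV[K]_n -> K) : Prop :=
  [/\ holomorphic_on (@unit_polydisc K n) g, g 0 = 1 &
      inv_deriv_in_M Phi (scaled_id g)].

Definition sqr_coef_diff (K : numFieldType) (n : nat)
    (G : 'rV[K]_n -> 'rV[K]_n) (z : 'rV[K]_n) : 'rV[K]_n :=
  sqr_vec ((3`!)%:R^-1 *: frechet_deriv_pow 3 G 0 z)
  - sqr_vec ((2`!)%:R^-1 *: frechet_deriv_pow 2 G 0 z).

(* Main.v *)
(** Along a unit direction [u] whose [j]-th coordinate has modulus [1], the slice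
    [gamma(t) = g(t u)] satisfies [1 + t gamma'/gamma = Phi(omega(t))] with
    [omega] a self-map of the disc fixing [0].  Writing
    [omega(t) = c1 t + c2 t^2 + ...], the Taylor coefficients of [gamma] are
    [a1 = b c1] and [2 a2 = b c2 + (d/2 + b^2) c1^2], where [b = Phi'(0)] and
    [d = Phi''(0)], and Schwarz-Pick gives [|c2| <= 1 - |c1|^2].  As
    [b <= |d/2 + b^2|], this yields [2 |a2| <= |d/2 + b^2|].  Equality holds for
    [g(z) = gamma(z_j)] with [omega(t) = i t], for which [a1^2] and [a2^2] have
    opposite signs; [gamma] is the exponential of a primitive.

    The function theory behind this is obtained without contour integrals:
    midpoint sums over the sides of a square tend to 0 for a holomorphic function
    (Goursat's bisection), which for [f(z) / (z - p)] gives a maximum principle up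
    to a constant factor; applied to the powers [f^k] it gives the sharp one.
    Removable singularities, Cauchy estimates and holomorphy of derivatives follow
    from the maximum principle applied to difference quotients. *)

Require Import Defs.
From mathcomp Require Import all_boot all_order all_algebra.
From mathcomp Require Import all_classical all_reals all_analysis.
From mathcomp Require Import complex.
From mathcomp Require Import ring lra.
Import Order.TTheory GRing.Theory Num.Theory.
Import numFieldNormedType.Exports.
Set Implicit Arguments. Unset Strict Implicit. Unset Printing Implicit Defensive.
Local Open Scope classical_set_scope.
Local Open Scope ring_scope.

(** Holomorphy is given only as complex differentiability at each point, while the theorem speaks of
    second and third derivatives: their existence in several variables is itself part of the proof,
    and it needs one-variable estimates that are uniform in the direction. The reduction to one
    variable works because p(z) = (DG(z))^-1 G(z) is a scalar multiple of z. Hence z_k / p_k(z) is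
    the same for all k with z_k nonzero, namely 1 + Dg(z)z / g(z), which on the slice is 1 + t
    gamma'/gamma. The Taylor terms of G are z times those of g, so for z = m u with m the norm of z,
    coordinate j of the vector to be bounded is z_j^2 (m^4 a2^2 - m^2 a1^2). The triangle inequality
    loses nothing here: if |c1| = 1 then c2 = 0, both moduli are maximal, a1^2 = b^2 c1^2 and a2^2 =
    D^2 c1^4 / 4 with D = d/2 + b^2 real. The choice c1^2 = -1 turns the difference into a sum. *)

Section derive_epsilon.
Variable K : numFieldType.
Implicit Types (f g : K -> K) (z a b : K).

Lemma is_derive_eps f z a : is_derive z 1 f a ->
  forall e : K, 0 < e -> exists2 d : K, 0 < d &
    forall h, `|h| < d -> `|f (z + h) - f z - a * h| <= e * `|h|.
Proof.
move=> [dv av] e e0.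
have /derivable_nbhs/eqaddoP/(_ e e0) := dv.
move=> /nbhs_ballP[d /= d0 H]; exists d => // h hd.
have := H h; rewrite -ball_normE /= sub0r normrN => /(_ hd).
by rewrite /= !fctE /cst /= av opprD addrA [h%:A]mulr1 [h *: a]mulrC addrC [h + z]addrC addrC.
Qed.

Lemma eps_is_derive f z a :
  (forall e : K, 0 < e -> exists2 d : K, 0 < d &
    forall h, `|h| < d -> `|f (z + h) - f z - a * h| <= e * `|h|) ->
  is_derive z 1 f a.
Proof.
move=> H.
have c : (fun h => h^-1 *: ((f \o shift z) (h *: (1:K)) - f z)) @ 0^' --> a.
  apply/cvgrPdist_le => e e0; have [d d0 Hd] := H _ e0.
  rewrite near_withinE; apply/nbhs_ballP; exists d => //= h.
  rewrite -ball_normE /= sub0r normrN => hd h0.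
  rewrite [h%:A]mulr1 addrC.
  have := Hd _ hd.
  rewrite -ler_pdivrMr ?normr_gt0// -normfV -normrM => le1.
  suff -> : - (h^-1 *: (f (h + z) - f z)) + a = - ((f (z + h) - f z - a * h) / h) by rewrite normrN.
  by rewrite [h + z]addrC [_ *: _]mulrC [in RHS]mulrBl [a * h / h]mulfK // opprB [RHS]addrC.
by apply: DeriveDef; [apply/cvg_ex; exists a|apply/cvg_lim].
Qed.

Lemma is_derive1_comp f g z a b : is_derive z 1 f a -> is_derive (f z) 1 g b ->
  is_derive z 1 (g \o f) (b * a).
Proof.
move=> [df <-] [dg <-].
have df' : differentiable f z by apply/derivable1_diffP.
have dg' : differentiable g (f z) by apply/derivable1_diffP.
have dgf : differentiable (g \o f) z by apply: differentiable_comp.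
apply: DeriveDef; first by apply/derivable1_diffP.
rewrite !deriveE // diff_comp //= -[X in 'd g (f z) X]mulr1.
by rewrite [LHS]linearZ mulrC.
Qed.

Lemma is_derive1_prod f g z a b : is_derive z 1 f a -> is_derive z 1 g b ->
  is_derive z 1 (fun x => f x * g x) (a * g z + f z * b).
Proof.
move=> hf hg; apply: is_derive_eq (is_deriveM _ _) _.
by rewrite /GRing.scale /= addrC [g z * a]mulrC.
Qed.

Lemma is_derive1_inv f z a : f z != 0 -> is_derive z 1 f a ->
  is_derive z 1 (fun x => (f x)^-1) (- a / f z ^+ 2).
Proof.
move=> fz [df <-].
apply: DeriveDef; first exact: derivableV.
by rewrite deriveV // /GRing.scale /= mulrC mulNr mulrN.
Qed.

End derive_epsilon.

(** * Real-valued modulus and complex differentiability *)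

Section complex_modulus.
Variable R : realType.
Local Notation C := (R[i]).
Implicit Types (x y z : C) (r : R).

(** The norm of [R[i]] is an element of [R[i]], whose order is partial. Moduli are kept in [R],
    where the order is total and [lra] and [nra] apply. *)
Definition cm z : R := Normc.normc z.

Lemma normr_cm z : `|z| = ((cm z)%:C)%C. Proof. by []. Qed.

Lemma cm_ge0 z : 0 <= cm z.
Proof. by rewrite -ler0c -normr_cm. Qed.

Lemma cm0 : cm 0 = 0. Proof. exact: Normc.normc0. Qed.

Lemma cm1 : cm 1 = 1. Proof. exact: Normc.normc1. Qed.

Lemma cm_eq0 z : (cm z == 0) = (z == 0).
Proof.
apply/idP/idP => [/eqP/Normc.eq0_normc->//|/eqP->]; by rewrite cm0.
Qed.

Lemma cm_gt0 z : (0 < cm z) = (z != 0).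
Proof. by rewrite lt_def cm_ge0 andbT cm_eq0. Qed.

Lemma cmM x y : cm (x * y) = cm x * cm y. Proof. exact: Normc.normcM. Qed.

Lemma cmV x : cm x^-1 = (cm x)^-1. Proof. exact: Normc.normcV. Qed.

Lemma cmX x n : cm (x ^+ n) = cm x ^+ n.
Proof. by elim: n => [|n IH]; rewrite ?expr0 ?cm1// !exprS cmM IH. Qed.

Lemma cmD x y : cm (x + y) <= cm x + cm y.
Proof. exact: (le_normcD (x : Rcomplex R) y). Qed.

Lemma cmN x : cm (- x) = cm x.
Proof. exact: (normcN (x : Rcomplex R)). Qed.

Lemma cmB x y : cm (x - y) <= cm x + cm y.
Proof. by rewrite -[cm y]cmN cmD. Qed.

Lemma cmBC x y : cm (x - y) = cm (y - x).
Proof. by rewrite -cmN opprB. Qed.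

Lemma ler_cmB x y : cm x - cm y <= cm (x - y).
Proof. by rewrite lerBlDr -{1}[x](subrK y) cmD. Qed.

Lemma cm_real r : cm (r%:C)%C = `|r|.
Proof. by rewrite /cm /= expr0n /= addr0 sqrtr_sqr. Qed.

Lemma cmi : cm 'i%C = 1.
Proof. by rewrite /cm /= expr0n /= add0r expr1n sqrtr1. Qed.

Lemma sqr_cm z : cm z ^+ 2 = complex.Re z ^+ 2 + complex.Im z ^+ 2.
Proof. by case: z => a b; rewrite /cm /= sqr_sqrtr// addr_ge0 ?sqr_ge0. Qed.

Lemma ler_Re_cm z : `|complex.Re z| <= cm z.
Proof.
rewrite -(ler_pXn2r (n := 2)) ?nnegrE ?cm_ge0// sqr_cm real_normK ?num_real//.
by rewrite lerDl sqr_ge0.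
Qed.

Lemma ler_Im_cm z : `|complex.Im z| <= cm z.
Proof.
rewrite -(ler_pXn2r (n := 2)) ?nnegrE ?cm_ge0// sqr_cm real_normK ?num_real//.
by rewrite lerDr sqr_ge0.
Qed.

Lemma ler_cm_ReIm z : cm z <= `|complex.Re z| + `|complex.Im z|.
Proof.
rewrite -(ler_pXn2r (n := 2)) ?nnegrE ?cm_ge0 ?addr_ge0// sqr_cm sqrrD.
rewrite !real_normK ?num_real// addrAC lerDl.
by rewrite mulrn_wge0// mulr_ge0.
Qed.

Lemma cm_sum I (s : seq I) (F : I -> C) :
  cm (\sum_(i <- s) F i) <= \sum_(i <- s) cm (F i).
Proof.
elim/big_ind2 : _ => //; first by rewrite cm0.
by move=> x1 x2 y1 y2 h1 h2; apply: le_trans (cmD _ _) (lerD h1 h2).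
Qed.

Lemma cmn (n : nat) : cm n%:R = n%:R.
Proof.
have -> : n%:R = ((n%:R : R)%:C)%C :> C by rewrite rmorph_nat.
by rewrite cm_real ger0_norm.
Qed.

End complex_modulus.

Section cderiv.
Variable R : realType.
Let K : numFieldType := R[i].
Local Notation C := (R[i]).

(** The relational form carries differentiability and value together. The casts to [K] make [R[i]] a
    normed module over itself, so that the derivative is the complex one. *)
Definition cderiv (f : C -> C) (z a : C) : Prop :=
  is_derive (z : K) 1 (f : K -> K) (a : K).

Definition chol (f : C -> C) (z : C) : Prop := exists a, cderiv f z a.

Implicit Types (f g : C -> C) (z a b c : C) (r e d : R).

Lemma cderivP f z a : cderiv f z a <-> forall e, 0 < e ->
  exists2 d, 0 < d & forall h, cm h < d ->
    cm (f (z + h) - f z - a * h) <= e * cm h.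
Proof.
split => [H e e0|H].
  have e0' : 0 < (e%:C)%C :> K by rewrite ltcR.
  have [d d0 Hd] := is_derive_eps H e0'.
  have dE : d = ((complex.Re d)%:C)%C by rewrite RRe_real// gtr0_real.
  exists (complex.Re d); first by rewrite -ltcR -dE.
  move=> h hd; rewrite -lecR rmorphM -!normr_cm; apply: Hd.
  by rewrite dE normr_cm ltcR.
apply: eps_is_derive => e e0.
have eE : e = ((complex.Re e)%:C)%C by rewrite RRe_real// gtr0_real.
have e0' : 0 < complex.Re e by rewrite -ltcR -eE.
have [d d0 Hd] := H _ e0'; exists (d%:C)%C; first by rewrite ltcR.
move=> h; rewrite normr_cm ltcR => /Hd; rewrite -lecR.
by rewrite eE -rmorphM.
Qed.

Lemma cderiv_cst c z : cderiv (fun=> c) z 0.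
Proof. exact: is_derive_cst. Qed.

Lemma cderiv_id z : cderiv (fun x => x) z 1.
Proof. exact: is_derive_id. Qed.

Lemma cderivD f g z a b : cderiv f z a -> cderiv g z b ->
  cderiv (fun x => f x + g x) z (a + b).
Proof. by move=> hf hg; apply: is_deriveD. Qed.

Lemma cderivN f z a : cderiv f z a -> cderiv (fun x => - f x) z (- a).
Proof. by move=> hf; apply: is_deriveN. Qed.

Lemma cderivB f g z a b : cderiv f z a -> cderiv g z b ->
  cderiv (fun x => f x - g x) z (a - b).
Proof. by move=> hf hg; apply: cderivD hf (cderivN hg). Qed.

Lemma cderivM f g z a b : cderiv f z a -> cderiv g z b ->
  cderiv (fun x => f x * g x) z (a * g z + f z * b).
Proof. exact: is_derive1_prod. Qed.

Lemma cderivV f z a : f z != 0 -> cderiv f z a ->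
  cderiv (fun x => (f x)^-1) z (- a / f z ^+ 2).
Proof. exact: is_derive1_inv. Qed.

Lemma cderiv_comp f g z a b : cderiv f z a -> cderiv g (f z) b ->
  cderiv (fun x => g (f x)) z (b * a).
Proof. exact: is_derive1_comp. Qed.

Lemma cderiv_eq f z a b : cderiv f z a -> a = b -> cderiv f z b.
Proof. by move=> + <-. Qed.

Lemma cderiv_unique f z a b : cderiv f z a -> cderiv f z b -> a = b.
Proof. by move=> [_ <-] [_ <-]. Qed.

Lemma cderiv_near f g z a d : 0 < d -> (forall w, cm (w - z) < d -> f w = g w) ->
  cderiv f z a -> cderiv g z a.
Proof.
move=> d0 fg /cderivP H; apply/cderivP => e /H[d' d'0 Hd].
exists (Num.min d d'); first by rewrite lt_min d0.
move=> h; rewrite lt_min => /andP[hd hd'].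
rewrite -!fg ?Hd ?subrr ?cm0//.
by rewrite [z + h]addrC addrK.
Qed.

Lemma chol_cst c z : chol (fun=> c) z.
Proof. by exists 0; exact: cderiv_cst. Qed.

Lemma chol_id z : chol (fun x => x) z.
Proof. by exists 1; exact: cderiv_id. Qed.

Lemma cholD f g z : chol f z -> chol g z -> chol (fun x => f x + g x) z.
Proof. by move=> [a ?] [b ?]; exists (a + b); exact: (cderivD (a:=a) (b:=b)). Qed.

Lemma cholB f g z : chol f z -> chol g z -> chol (fun x => f x - g x) z.
Proof. by move=> [a ?] [b ?]; exists (a - b); exact: (cderivB (a:=a) (b:=b)). Qed.

Lemma cholM f g z : chol f z -> chol g z -> chol (fun x => f x * g x) z.
Proof. by move=> [a Ha] [b Hb]; eexists; exact: (cderivM Ha Hb). Qed.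

Lemma cholV f z : f z != 0 -> chol f z -> chol (fun x => (f x)^-1) z.
Proof. by move=> fz [a Ha]; eexists; exact: (cderivV fz Ha). Qed.

Lemma chol_comp f g z : chol f z -> chol g (f z) -> chol (fun x => g (f x)) z.
Proof. by move=> [a Ha] [b Hb]; eexists; exact: (cderiv_comp Ha Hb). Qed.

Lemma cholX f n z : chol f z -> chol (fun x => f x ^+ n) z.
Proof.
move=> hf; elim: n => [|n IH]; first exact: chol_cst.
have -> : (fun x => f x ^+ n.+1) = (fun x => f x * f x ^+ n).
  by apply/funext => x; rewrite exprS.
exact: cholM.
Qed.

Lemma chol_near f g z d : 0 < d -> (forall w, cm (w - z) < d -> f w = g w) ->
  chol f z -> chol g z.
Proof. by move=> d0 fg [a H]; exists a; exact: cderiv_near fg H. Qed.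

Lemma chol_continuous f z : chol f z -> forall e, 0 < e ->
  exists2 d, 0 < d & forall h, cm h < d -> cm (f (z + h) - f z) <= e.
Proof.
move=> [a /cderivP/(_ 1 ltr01)[d d0 H]] e e0.
have c0 : 0 < cm a + 1 by rewrite ltr_wpDl// cm_ge0.
exists (Num.min d (e / (cm a + 1))); first by rewrite lt_min d0 divr_gt0.
move=> h; rewrite lt_min => /andP[/H hd].
rewrite ltr_pdivlMr// => he.
rewrite -[f (z + h) - f z](subrK (a * h)); apply: le_trans (cmD _ _) _.
by rewrite cmM; have := cm_ge0 h; nra.
Qed.

End cderiv.

(** * Midpoint sums and the maximum principle *)

Section discrete_integrals.
Variable R : realType.
Local Notation C := (R[i]).
Local Notation i := ('i%C : C).
Implicit Types (f g : C -> C) (p s d z a b : C) (N m : nat) (e B : R).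

Lemma rc0 : ((0 : R)%:C)%C = 0 :> C. Proof. by []. Qed.

Lemma rc1 : ((1 : R)%:C)%C = 1 :> C. Proof. by []. Qed.

(** Approximates the integral of [f] along the segment from [p] to [p + d]. Midpoints make the sum
    exact on affine functions for every positive [N], so a linear part can be discarded without a
    limit; moreover [N + N] nodes on a segment are exactly [N] nodes on each half. *)
Definition midpoint_sum f p d N : C :=
  \sum_(k < N) f (p + (k%:R + 2^-1) / N%:R * d) * (d / N%:R).

(** The counterclockwise boundary sum of the square with corners [p], [p + s], [p + s + i * s],
    [p + i * s]. A complex [s] allows rotated squares, so that four of them can surround a common
    corner. *)
Definition square_sum f p s N : C :=
  midpoint_sum f p s N + midpoint_sum f (p + s) (i * s) N
  - midpoint_sum f (p + i * s) s N - midpoint_sum f p (i * s) N.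

Lemma midpoint_sumD f g p d N : midpoint_sum (fun z => f z + g z) p d N =
  midpoint_sum f p d N + midpoint_sum g p d N.
Proof. by rewrite -big_split; apply: eq_bigr => k _; rewrite mulrDl. Qed.

Lemma midpoint_sumZ f a p d N : midpoint_sum (fun z => a * f z) p d N =
  a * midpoint_sum f p d N.
Proof. by rewrite [RHS]mulr_sumr; apply: eq_bigr => k _; rewrite -mulrA. Qed.

Lemma midpoint_sum_split f p d N : (0 < N)%N -> midpoint_sum f p d (N + N) =
  midpoint_sum f p (d / 2) N + midpoint_sum f (p + d / 2) (d / 2) N.
Proof.
move=> N0; have N0' : N%:R != 0 :> C by rewrite pnatr_eq0 -lt0n.
have NN0 : N%:R + N%:R != 0 :> C by rewrite -natrD pnatr_eq0 -lt0n addn_gt0 N0.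
rewrite /midpoint_sum big_split_ord /=; congr (_ + _).
  apply: eq_bigr => k _; rewrite natrD.
  have -> : (k%:R + 2^-1) / (N%:R + N%:R) * d = (k%:R + 2^-1) / N%:R * (d / 2).
    by field; rewrite N0' NN0.
  by congr (_ * _); field; rewrite N0' NN0.
apply: eq_bigr => k _; rewrite !natrD.
have -> : p + (N%:R + k%:R + 2^-1) / (N%:R + N%:R) * d =
    p + d / 2 + (k%:R + 2^-1) / N%:R * (d / 2).
  by field; rewrite N0' NN0.
by congr (_ * _); field; rewrite N0' NN0.
Qed.

(** A side shared by two quarters is traversed once in each direction and cancels. *)
Lemma square_sum_split f p s N : (0 < N)%N -> square_sum f p s (N + N) =
  square_sum f p (s / 2) N + square_sum f (p + s / 2) (s / 2) N +
  square_sum f (p + i * s / 2) (s / 2) N +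
  square_sum f (p + s / 2 + i * s / 2) (s / 2) N.
Proof.
move=> N0; rewrite /square_sum !midpoint_sum_split// mulrA.
have -> : p + s / 2 + s / 2 = p + s by field.
have -> : p + i * s / 2 + i * s / 2 = p + i * s by field.
have -> : p + s / 2 + i * s / 2 + s / 2 = p + s + i * s / 2 by field.
have -> : p + s / 2 + i * s / 2 + i * s / 2 = p + i * s + s / 2 by field.
have -> : p + i * s / 2 + s / 2 = p + s / 2 + i * s / 2 by rewrite addrAC.
ring.
Qed.

Lemma sum_half N : \sum_(k < N) (k%:R + 2^-1 : C) = N%:R ^+ 2 / 2.
Proof.
elim: N => [|N IH]; first by rewrite big_ord0 expr0n /= mul0r.
by rewrite big_ord_recr /= IH -[N.+1]addn1 natrD; field.
Qed.

Lemma midpoint_sum_affine a b p d N : (0 < N)%N ->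
  midpoint_sum (fun z => a + b * z) p d N = a * d + b * (p * d + d ^+ 2 / 2).
Proof.
move=> N0; have N0' : N%:R != 0 :> C by rewrite pnatr_eq0 -lt0n.
rewrite /midpoint_sum.
rewrite (eq_bigr (fun k : 'I_N => (a + b * p) * d / N%:R +
   b * d ^+ 2 / N%:R ^+ 2 * (k%:R + 2^-1))); last by move=> k _; field.
rewrite big_split /= sumr_const card_ord -mulr_sumr sum_half -mulr_natr.
by field.
Qed.

Lemma square_sum_affine a b p s N : (0 < N)%N ->
  square_sum (fun z => a + b * z) p s N = 0.
Proof.
by move=> N0; rewrite /square_sum !midpoint_sum_affine//; field.
Qed.

Lemma square_sumD f g p s N : square_sum (fun z => f z + g z) p s N =
  square_sum f p s N + square_sum g p s N.
Proof. rewrite /square_sum !midpoint_sumD; ring. Qed.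

Lemma cm_midpoint_sum f p d N B : (0 < N)%N ->
  (forall t : R, 0 <= t <= 1 -> cm (f (p + (t%:C)%C * d)) <= B) ->
  cm (midpoint_sum f p d N) <= cm d * B.
Proof.
move=> N0 H; apply: le_trans (cm_sum _ _) _.
have N0' : N%:R != 0 :> R by rewrite pnatr_eq0 -lt0n.
have N0'' : 0 < N%:R :> R by rewrite ltr0n.
have -> : cm d * B = \sum_(k < N) (B * (cm d / N%:R)).
  by rewrite sumr_const card_ord -mulr_natr; field.
apply: ler_sum => k _; rewrite !cmM cmV cmn ler_wpM2r ?divr_ge0 ?cm_ge0//.
have -> : (k%:R + 2^-1) / N%:R = (((k%:R + 2^-1) / N%:R : R)%:C)%C :> C.
  by rewrite rmorphM rmorphD !fmorphV !rmorph_nat.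
apply: H; rewrite divr_ge0 ?addr_ge0//= ler_pdivrMr// mul1r.
have : k.+1%:R <= N%:R :> R by rewrite ler_nat.
by rewrite -addn1 natrD; lra.
Qed.

Definition in_square p s z := exists x y : R,
  [/\ 0 <= x <= 1, 0 <= y <= 1 & z = p + ((x%:C)%C + i * (y%:C)%C) * s].

Lemma cm_square_sum f p s N B : (0 < N)%N ->
  (forall z, in_square p s z -> cm (f z) <= B) ->
  cm (square_sum f p s N) <= 4 * cm s * B.
Proof.
move=> N0 H.
have h : 0 <= (0 : R) <= 1 by rewrite lexx ler01.
have h1 : 0 <= (1 : R) <= 1 by rewrite lexx ler01.
have H1 : cm (midpoint_sum f p s N) <= cm s * B.
  apply: cm_midpoint_sum => // t t01; apply: H; exists t, 0; split => //.
  by rewrite rc0 mulr0 addr0.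
have H2 : cm (midpoint_sum f (p + s) (i * s) N) <= cm (i * s) * B.
  apply: cm_midpoint_sum => // t t01; apply: H; exists 1, t; split => //.
  by rewrite rc1; ring.
have H3 : cm (midpoint_sum f (p + i * s) s N) <= cm s * B.
  apply: cm_midpoint_sum => // t t01; apply: H; exists t, 1; split => //.
  by rewrite rc1; ring.
have H4 : cm (midpoint_sum f p (i * s) N) <= cm (i * s) * B.
  apply: cm_midpoint_sum => // t t01; apply: H; exists 0, t; split => //.
  by rewrite rc0; ring.
move: H2 H4; rewrite cmM cmi mul1r => H2 H4.
rewrite /square_sum; apply: le_trans (cmB _ _) _.
have := cmB (midpoint_sum f p s N + midpoint_sum f (p + s) (i * s) N)
  (midpoint_sum f (p + i * s) s N).
have := cmD (midpoint_sum f p s N) (midpoint_sum f (p + s) (i * s) N).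
lra.
Qed.

(** The intervals from [x k] to [x k + 2^-1 ^+ k] are nested, and the supremum of their left ends
    lies in all of them. *)
Lemma nested_limit (x : nat -> R) : (forall k, x k <= x k.+1) ->
  (forall k, x k.+1 + 2^-1 ^+ k.+1 <= x k + 2^-1 ^+ k) ->
  exists l, forall k, x k <= l <= x k + 2^-1 ^+ k.
Proof.
move=> inc dec.
have incn j k : (j <= k)%N -> x j <= x k.
  by elim: k => [|k IH]; [rewrite leqn0 => /eqP->|
    rewrite leq_eqVlt => /predU1P[->//|/IH/le_trans]; apply].
have decn j k : (j <= k)%N -> x k + 2^-1 ^+ k <= x j + 2^-1 ^+ j.
  elim: k => [|k IH]; first by rewrite leqn0 => /eqP->.
  by rewrite leq_eqVlt => /predU1P[->//|/IH]; apply: le_trans (dec k).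
have half_ge0 k : 0 <= 2^-1 ^+ k :> R by rewrite exprn_ge0// invr_ge0.
have ub j k : x k <= x j + 2^-1 ^+ j.
  have [jk|/ltnW kj] := leqP j k.
    by apply: le_trans (decn _ _ jk); rewrite lerDl.
  by apply: le_trans (incn _ _ kj) _; rewrite lerDl.
exists (sup (range x)) => k; apply/andP; split.
  apply: sup_upper_bound; last by exists k.
  by split; [exists (x 0%N), 0%N|exists (x 0%N + 2^-1 ^+ 0) => _ [n _ <-]].
by apply: ge_sup; [exists (x 0%N), 0%N|move=> _ [n _ <-]].
Qed.

End discrete_integrals.

(** * Goursat's bisection *)

Section goursat.
Variable R : realType.
Local Notation C := (R[i]).
Local Notation i := ('i%C : C).
Implicit Types (f g : C -> C) (p s d z a b : C) (N m : nat) (e B : R).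

Lemma pow2_double m : (2 ^ m.+1 = 2 ^ m + 2 ^ m)%N.
Proof. by rewrite expnS mul2n addnn. Qed.

Lemma pow2_gt0 m : (0 < 2 ^ m)%N. Proof. by rewrite expn_gt0. Qed.

(** If each quarter had sums at most [c * cm (s / 2) ^+ 2] for all large [m], adding the four would
    bound the whole by [c * cm s ^+ 2]. Failure is required for arbitrarily large [m], because
    passing to a quarter lowers the level by one. *)
Lemma square_sum_child f p s c : (forall M, exists2 m, (M <= m)%N &
    c * cm s ^+ 2 < cm (square_sum f p s (2 ^ m))) ->
  exists ab : bool * bool, forall M, exists2 m, (M <= m)%N &
    c * cm (s / 2) ^+ 2 <
    cm (square_sum f (p + (((ab.1%:R : R)%:C)%C + i * ((ab.2%:R : R)%:C)%C) * (s / 2))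
                   (s / 2) (2 ^ m)).
Proof.
move=> bad; apply/not_existsP => H.
have {}H (a b : bool) : exists M, forall m, (M <= m)%N ->
  cm (square_sum f (p + (((a%:R : R)%:C)%C + i * ((b%:R : R)%:C)%C) * (s / 2))
                 (s / 2) (2 ^ m)) <= c * cm (s / 2) ^+ 2.
  have /existsNP[M HM] := H (a, b); exists M => m Mm.
  by rewrite leNgt; apply/negP => lt; apply: HM; exists m.
have [M1 H1] := H false false.
have [M2 H2] := H true false.
have [M3 H3] := H false true.
have [M4 H4] := H true true.
(* The successor excludes level 0, so the number of nodes is even and the square can be split. *)
have [[//|m] Mm] := bad (M1 + M2 + M3 + M4).+1.
rewrite ltnS in Mm.
have /H1 {}H1 : (M1 <= m)%N by apply: leq_trans Mm; rewrite -!addnA leq_addr.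
have /H2 {}H2 : (M2 <= m)%N.
  by apply: leq_trans Mm; rewrite [(M1 + M2)%N]addnC -!addnA leq_addr.
have /H3 {}H3 : (M3 <= m)%N.
  by apply: leq_trans Mm; rewrite [(_ + M3)%N]addnC -!addnA leq_addr.
have /H4 {}H4 : (M4 <= m)%N by apply: leq_trans Mm; rewrite leq_addl.
rewrite pow2_double square_sum_split ?pow2_gt0// ltNge => /negP; apply.
have e1 : ((((false%:R : R)%:C)%C + i * ((false%:R : R)%:C)%C) * (s / 2)) = 0.
  by rewrite rc0 mulr0 addr0 mul0r.
have e2 : ((((true%:R : R)%:C)%C + i * ((false%:R : R)%:C)%C) * (s / 2)) = s / 2.
  by rewrite rc0 mulr0 addr0 rc1 mul1r.
have e3 : ((((false%:R : R)%:C)%C + i * ((true%:R : R)%:C)%C) * (s / 2)) = i * s / 2.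
  by rewrite rc0 add0r rc1 mulr1 mulrA.
have e4 : ((((true%:R : R)%:C)%C + i * ((true%:R : R)%:C)%C) * (s / 2)) = s / 2 + i * s / 2.
  by rewrite rc1 mulr1 mulrDl mul1r mulrA.
move: H1 H2 H3 H4; rewrite e1 e2 e3 e4 addr0 addrA => H1 H2 H3 H4.
apply: le_trans (cmD _ _) _; apply: le_trans (lerD (cmD _ _) H4) _.
apply: le_trans (lerD (lerD (cmD _ _) H3) (lexx _)) _.
apply: le_trans (lerD (lerD (lerD H1 H2) (lexx _)) (lexx _)) _.
have -> : cm (s / 2) = cm s / 2 by rewrite cmM cmV cmn.
by rewrite le_eqVlt; apply/orP; left; apply/eqP; field.
Qed.

(** Near the common point of the nested bad squares, [f] is affine up to [c / 8] times the distance.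
    The affine part has sum exactly 0; the rest is at most the perimeter, 4 sides, times [c / 8]
    times a distance of at most 2 sides. This is [c] times the squared side, which contradicts
    badness. *)
Lemma goursat f p s : (forall z, in_square p s z -> chol f z) ->
  forall e, 0 < e -> exists M, forall m, (M <= m)%N ->
    cm (square_sum f p s (2 ^ m)) <= e.
Proof.
move=> hol e e0; apply: contrapT => /forallNP H0.
(* The [+ 1] covers the degenerate square [s = 0]. *)
pose c := e / (cm s ^+ 2 + 1).
have s2 : 0 < cm s ^+ 2 + 1 by rewrite ltr_wpDl// exprn_ge0// cm_ge0.
have c0 : 0 < c by rewrite divr_gt0.
pose P x y := p + ((x%:C)%C + i * (y%:C)%C) * s.
pose sk (k : nat) : C := s * (((2^-1 : R) ^+ k)%:C)%C.
pose bad k q := forall M, exists2 m, (M <= m)%N &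
    c * cm (sk k) ^+ 2 < cm (square_sum f q (sk k) (2 ^ m)).
have skS k : sk k.+1 = sk k / 2.
  by rewrite /sk exprSr rmorphM fmorphV rmorph_nat mulrA.
have bad0 : bad 0%N (P 0 0).
  have s0 : sk 0%N = s by rewrite /sk expr0 rc1 mulr1.
  have -> : P 0 0 = p by rewrite /P rc0 mulr0 addr0 mul0r addr0.
  move=> M; have /existsNP[m /not_implyP[Mm lt]] := H0 M.
  exists m => //; rewrite s0 ltNge; apply/negP => le1; apply: lt.
  apply: le_trans le1 _; rewrite /c mulrAC ler_pdivrMr// ler_wpM2l ?(ltW e0)//.
  by rewrite lerDl.
have badS k x y : exists ab : bool * bool, bad k (P x y) ->
    bad k.+1 (P (x + ab.1%:R * 2^-1 ^+ k.+1) (y + ab.2%:R * 2^-1 ^+ k.+1)).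
  have [bk|nbk] := pselect (bad k (P x y)); last by exists (false, false).
  have [ab Hab] := square_sum_child bk; exists ab => _ M.
  have [m Mm lt] := Hab M; exists m => //; rewrite skS.
  move: lt; congr (_ < cm (square_sum f _ _ _)).
  rewrite /P !rmorphD /= -skS /sk !rmorphM; ring.
(* Corners are recorded by real coordinates relative to [s]; [choice] turns the existence of a bad
   quarter into a function that can be iterated. *)
have /choice[F HF] : forall kxy : nat * (R * R), exists ab : bool * bool,
    bad kxy.1 (P kxy.2.1 kxy.2.2) -> bad kxy.1.+1
    (P (kxy.2.1 + ab.1%:R * 2^-1 ^+ kxy.1.+1) (kxy.2.2 + ab.2%:R * 2^-1 ^+ kxy.1.+1)).
  by move=> [k [x y]]; exact: badS.
pose u := fix u (k : nat) : R * R := if k is k'.+1 then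
  ((u k').1 + (F (k', u k')).1%:R * 2^-1 ^+ k'.+1,
   (u k').2 + (F (k', u k')).2%:R * 2^-1 ^+ k'.+1) else (0, 0).
have badu k : bad k (P (u k).1 (u k).2).
  by elim: k => [|k IH]; [exact: bad0|exact: (HF (k, u k) IH)].
have h0 k : 0 < (2^-1 : R) ^+ k by rewrite exprn_gt0// invr_gt0.
have hS k : (2^-1 : R) ^+ k = 2 * 2^-1 ^+ k.+1 by rewrite exprS; field.
have inc (b : bool) k : 0 <= b%:R * (2^-1 : R) ^+ k by rewrite mulr_ge0// ltW.
have dec (b : bool) k : b%:R * (2^-1 : R) ^+ k.+1 + 2^-1 ^+ k.+1 <= 2^-1 ^+ k.
  by rewrite (hS k); have := h0 k.+1; case: b => /=; rewrite ?mulr1n ?mulr0n ?mul1r ?mul0r; lra.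
have [lx Hx] : exists l, forall k, (u k).1 <= l <= (u k).1 + 2^-1 ^+ k.
  apply: (nested_limit (x := fun k => (u k).1)) => k /=; first by rewrite lerDl.
  by rewrite -addrA lerD2l.
have [ly Hy] : exists l, forall k, (u k).2 <= l <= (u k).2 + 2^-1 ^+ k.
  apply: (nested_limit (x := fun k => (u k).2)) => k /=; first by rewrite lerDl.
  by rewrite -addrA lerD2l.
pose zs := P lx ly.
have [a /cderivP/(_ (c / 8))[]] : chol f zs.
  apply: hol; exists lx, ly; split => //.
    by have := Hx 0%N; rewrite /= add0r expr0.
  by have := Hy 0%N; rewrite /= add0r expr0.
  by rewrite divr_gt0.
move=> d d0 Hd.
have [k Hk] : exists k, 2 * cm s * 2^-1 ^+ k < d.
  have : (fun k => 2 * cm s * 2^-1 ^+ k : R) @ \oo --> (2 * cm s * 0 : R).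
    apply: cvgMr; apply: cvg_expr.
    by rewrite ger0_norm ?invr_ge0// invf_lt1// ltr1n.
  rewrite mulr0 => /cvgr0_norm_lt/(_ _ d0)[k _ /(_ k (leqnn k))] /= hk.
  by exists k; apply: le_lt_trans hk; exact: ler_norm.
have [m Mm] := badu k 0%N; rewrite ltNge => /negP; apply.
pose g z := f z + (- (f zs - a * zs) + (- a) * z).
have -> : f = (fun z => g z + ((f zs - a * zs) + a * z)).
  by apply/funext => z; rewrite /g; ring.
rewrite square_sumD square_sum_affine ?pow2_gt0// addr0.
have -> : c * cm (sk k) ^+ 2 = 4 * cm (sk k) * (c / 8 * (2 * cm (sk k))) by field.
apply: cm_square_sum; first exact: pow2_gt0.
move=> z [x [y [/andP[x0 x1] /andP[y0 y1] ->]]].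
set z1 := _ + _ * _.
have -> : g z1 = f (zs + (z1 - zs)) - f zs - a * (z1 - zs).
  by rewrite /g [zs + _]addrC subrK; ring.
have cms : cm (sk k) = cm s * 2^-1 ^+ k by rewrite cmM cm_real gtr0_norm.
have le1 : cm (z1 - zs) <= 2 * cm (sk k).
  have -> : z1 - zs = ((((u k).1 + x * 2^-1 ^+ k - lx)%:C)%C +
      i * (((u k).2 + y * 2^-1 ^+ k - ly)%:C)%C) * s.
    by rewrite /z1 /zs /P /sk !(rmorphD, rmorphM, rmorphN); ring.
  rewrite cmM cms mulrC mulrCA ler_wpM2l ?cm_ge0//.
  apply: le_trans (cmD _ _) _; rewrite cmM cmi mul1r !cm_real.
  have b1 (v l t : R) : v <= l <= v + 2^-1 ^+ k -> 0 <= t -> t <= 1 ->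
      `|v + t * 2^-1 ^+ k - l| <= 2^-1 ^+ k.
    by move=> /andP[vl lv] t0 t1; rewrite ler_norml; have := h0 k; nra.
  by have := b1 _ _ _ (Hx k) x0 x1; have := b1 _ _ _ (Hy k) y0 y1; lra.
apply: le_trans (Hd _ _) _.
  apply: le_lt_trans le1 _; apply: le_lt_trans Hk.
  by rewrite cms mulrA.
by rewrite ler_wpM2l// divr_ge0// ltW.
Qed.

End goursat.

Section crude_maximum.
Variable R : realType.
Local Notation C := (R[i]).
Local Notation i := ('i%C : C).
Implicit Types (f g : C -> C) (p s d z a b u v : C) (N m : nat) (e B r : R).

Lemma ii : i * i = -1. Proof. by rewrite -expr2 sqr_i. Qed.

Lemma complex_decomp (x y : R) : ((x%:C)%C + i * (y%:C)%C) = (x +i* y)%C.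
Proof. by apply/eqP; rewrite eq_complex /=; apply/andP; split; apply/eqP; ring. Qed.

Lemma in_square_cm p s z : in_square p s z -> cm (z - p) <= 2 * cm s.
Proof.
move=> [x [y [/andP[x0 x1] /andP[y0 y1] ->]]].
rewrite [p + _]addrC addrK cmM ler_wpM2r ?cm_ge0//.
apply: le_trans (cmD _ _) _.
by rewrite cmM cmi mul1r !cm_real !ger0_norm//; lra.
Qed.

(** A quarter that does not touch [p] has a relative coordinate of at least 1/2, hence avoids [p],
    and [goursat] applies to it. *)
Lemma in_square_child p s z (a b : bool) :
  in_square (p + (((a%:R : R)%:C)%C + i * ((b%:R : R)%:C)%C) * (s / 2)) (s / 2) z ->
  in_square p s z /\ (s != 0 -> a || b -> z != p).
Proof.
move=> [x [y [/andP[x0 x1] /andP[y0 y1] ->]]].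
set z1 := _ + _ * _.
have E : z1 = p + ((((a%:R + x) / 2)%:C)%C + i * (((b%:R + y) / 2)%:C)%C) * s.
  rewrite /z1 !rmorphM !rmorphD fmorphV !rmorph_nat; ring.
have ha : 0 <= (a%:R : R) <= 1 by rewrite ler0n lern1 leq_b1.
have hb : 0 <= (b%:R : R) <= 1 by rewrite ler0n lern1 leq_b1.
move: ha hb => /andP[a0 a1] /andP[b0 b1].
split.
  exists ((a%:R + x) / 2), ((b%:R + y) / 2); split => //.
    by apply/andP; split; lra.
  by apply/andP; split; lra.
move=> s0 ab; rewrite E -subr_eq0 [p + _]addrC addrK mulf_neq0//.
rewrite complex_decomp eq_complex /= negb_and.
case/orP: ab => h; [apply/orP; left|apply/orP; right].
  have : 1 <= (a%:R : R) by rewrite h.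
  by move=> ?; apply: lt0r_neq0; lra.
have : 1 <= (b%:R : R) by rewrite h.
by move=> ?; apply: lt0r_neq0; lra.
Qed.

(* The integral over the square at the exceptional corner is O(side length). *)
Lemma goursat_corner q p s e0 B : s != 0 -> 0 < e0 ->
  (forall z, cm (z - p) < e0 -> cm (q z) <= B) ->
  (forall z, in_square p s z -> z != p -> chol q z) ->
  forall e, 0 < e -> exists M, forall m, (M <= m)%N ->
    cm (square_sum q p s (2 ^ m)) <= e.
Proof.
move=> s0 e00 qB hol.
have B0 : 0 <= B.
  by apply: le_trans (cm_ge0 (q p)) _; apply: qB; rewrite subrr cm0.
(* Each halving disposes of three quarters by [goursat]. The one left at [p] has perimeter
   [4 * cm s' * 2^-1 ^+ k] after [k] halvings, and there the bound [B] suffices. *)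
have key k s' : s' != 0 -> (forall z, in_square p s' z -> z != p -> chol q z) ->
    2 * cm s' * 2^-1 ^+ k < e0 ->
    forall e, 0 < e -> exists M, forall m, (M <= m)%N ->
      cm (square_sum q p s' (2 ^ m)) <= e + 4 * cm s' * 2^-1 ^+ k * B.
  elim: k s' => [|k IH] s' s'0 hol' small e e_gt0.
    exists 0%N => m _; apply: le_trans (cm_square_sum (B := B) _ _) _.
    - exact: pow2_gt0.
    - move=> z /in_square_cm zp; apply: qB; apply: le_lt_trans zp _.
      by move: small; rewrite expr0 mulr1.
    - by rewrite expr0 mulr1 lerDr ltW.
  have s20 : s' / 2 != 0 by rewrite mulf_neq0// invr_eq0 pnatr_eq0.
  have cms2 : cm (s' / 2) = cm s' / 2 by rewrite cmM cmV cmn.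
  have e40 : 0 < e / 4 by lra.
  have E1 : p + (((((false : nat)%:R : R)%:C)%C + i * (((false : nat)%:R : R)%:C)%C) * (s' / 2)) = p.
    by rewrite rc0 mulr0 addr0 mul0r addr0.
  have E2 : p + (((((true : nat)%:R : R)%:C)%C + i * (((false : nat)%:R : R)%:C)%C) * (s' / 2)) = p + s' / 2.
    by rewrite rc0 mulr0 addr0 rc1 mul1r.
  have E3 : p + (((((false : nat)%:R : R)%:C)%C + i * (((true : nat)%:R : R)%:C)%C) * (s' / 2)) = p + i * s' / 2.
    by rewrite rc0 add0r rc1 mulr1 mulrA.
  have E4 : p + (((((true : nat)%:R : R)%:C)%C + i * (((true : nat)%:R : R)%:C)%C) * (s' / 2)) = p + s' / 2 + i * s' / 2.
    by rewrite rc1 mulr1 mulrDl mul1r mulrA addrA.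
  have [||M1 H1] := IH (s' / 2) s20 _ _ _ e40.
  - move=> z zin; apply: hol'.
    by have := @in_square_child p s' z false false; rewrite E1 => /(_ zin)[].
  - by move: small; rewrite cms2 exprS; congr (_ < _); field.
  have [|M2 H2] := @goursat R q (p + s' / 2) (s' / 2) _ _ e40.
    move=> z zin; have := @in_square_child p s' z true false.
    by rewrite E2 => /(_ zin)[zin' zp]; apply: hol' => //; exact: zp.
  have [|M3 H3] := @goursat R q (p + i * s' / 2) (s' / 2) _ _ e40.
    move=> z zin; have := @in_square_child p s' z false true.
    by rewrite E3 => /(_ zin)[zin' zp]; apply: hol' => //; exact: zp.
  have [|M4 H4] := @goursat R q (p + s' / 2 + i * s' / 2) (s' / 2) _ _ e40.
    move=> z zin; have := @in_square_child p s' z true true.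
    by rewrite E4 => /(_ zin)[zin' zp]; apply: hol' => //; exact: zp.
  exists (M1 + M2 + M3 + M4).+1 => -[//|m]; rewrite ltnS => Mm.
  have /H1 {}H1 : (M1 <= m)%N by apply: leq_trans Mm; rewrite -!addnA leq_addr.
  have /H2 {}H2 : (M2 <= m)%N.
    by apply: leq_trans Mm; rewrite [(M1 + M2)%N]addnC -!addnA leq_addr.
  have /H3 {}H3 : (M3 <= m)%N.
    by apply: leq_trans Mm; rewrite [(_ + M3)%N]addnC -!addnA leq_addr.
  have /H4 {}H4 : (M4 <= m)%N by apply: leq_trans Mm; rewrite leq_addl.
  rewrite pow2_double square_sum_split ?pow2_gt0//.
  apply: le_trans (cmD _ _) _; apply: le_trans (lerD (cmD _ _) H4) _.
  apply: le_trans (lerD (lerD (cmD _ _) H3) (lexx _)) _.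
  apply: le_trans (lerD (lerD (lerD H1 H2) (lexx _)) (lexx _)) _.
  by rewrite cms2 exprS le_eqVlt; apply/orP; left; apply/eqP; field.
move=> e e_gt0.
have cs0 : 0 < cm s by rewrite cm_gt0.
(* The regular quarters receive [e / (B + 1)] and the corner costs at most [B] times as much, which
   adds up to [e]. *)
pose eta := Num.min e0 (e / (B + 1)).
have eta0 : 0 < eta by rewrite lt_min e00 divr_gt0// ltr_wpDl.
have [k Hk] : exists k, 4 * cm s * 2^-1 ^+ k < eta.
  have : (fun k => 4 * cm s * 2^-1 ^+ k : R) @ \oo --> (4 * cm s * 0 : R).
    apply: cvgMr; apply: cvg_expr.
    by rewrite ger0_norm ?invr_ge0// invf_lt1// ltr1n.
  rewrite mulr0 => /cvgr0_norm_lt/(_ _ eta0)[k _ /(_ k (leqnn k))] /= hk.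
  by exists k; apply: le_lt_trans hk; exact: ler_norm.
have h0 : 0 < (2^-1 : R) ^+ k by rewrite exprn_gt0// invr_gt0.
move: Hk; rewrite lt_min => /andP[Hk1 Hk2].
have e20 : 0 < e / (B + 1) by rewrite divr_gt0// ltr_wpDl.
have [|M HM] := key k s s0 hol _ (e / (B + 1)) e20.
  by apply: le_lt_trans Hk1; rewrite ler_wpM2r ?(ltW h0)//; lra.
exists M => m /HM Hm; apply: le_trans Hm _.
have eE : e = e / (B + 1) + e / (B + 1) * B.
  by field; rewrite gt_eqF// ltr_wpDl.
by rewrite [leRHS]eE lerD2l ler_wpM2r// ltW.
Qed.

Lemma sqr_real_bound (t : R) : 0 <= t <= 1 -> 1 <= 2 / (1 + t ^+ 2).
Proof.
move=> /andP[t0 t1]; rewrite ler_pdivlMr; nra.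
Qed.

(** Nodes are paired symmetrically about the midpoint [p + u] of a side: the values at
    [u * (1 + i * T)] and [u * (1 - i * T)] combine to the real number [2 / (1 + T ^+ 2)], at least
    1. The exact side integral is i pi / 2; a lower bound replaces the winding number. *)
Lemma inverse_side_sum p u N : (0 < N)%N -> u != 0 ->
  exists2 W : R, 1 <= W &
    midpoint_sum (fun z => (z - p)^-1) (p + u) (i * u) N
    - midpoint_sum (fun z => (z - p)^-1) (p + u) (- (i * u)) N = i * (W%:C)%C.
Proof.
move=> N0 u0.
have N0' : N%:R != 0 :> R by rewrite pnatr_eq0 -lt0n.
have N0C : N%:R != 0 :> C by rewrite pnatr_eq0 -lt0n.
pose t (k : nat) : R := (k%:R + 2^-1) / N%:R.
exists (\sum_(k < N) (2 / (1 + t k ^+ 2) / N%:R)).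
  have oneE : 1 = \sum_(k < N) (1 / N%:R : R).
    by rewrite sumr_const card_ord -mulr_natr; field.
  rewrite [leLHS]oneE.
  apply: ler_sum => k _; rewrite ler_wpM2r ?invr_ge0 ?ler0n//.
  apply: sqr_real_bound; rewrite divr_ge0 ?addr_ge0//= ler_pdivrMr ?ltr0n// mul1r.
  have : k.+1%:R <= N%:R :> R by rewrite ler_nat.
  by rewrite -addn1 natrD; lra.
rewrite rmorph_sum /= mulr_sumr /midpoint_sum -sumrB; apply: eq_bigr => k _.
have -> : (k%:R + 2^-1) / N%:R = ((t k)%:C)%C :> C.
  by rewrite /t rmorphM rmorphD !fmorphV !rmorph_nat.
move: (t k) => tk.
rewrite !rmorphM !fmorphV !rmorphD rmorphXn !rmorph_nat ?rc1 ?rmorph1 /=.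
set T := (tk%:C)%C.
have T1 : 1 + i * T != 0.
  by rewrite -rc1 complex_decomp eq_complex /= oner_eq0.
have T2 : 1 - i * T != 0.
  rewrite -mulrN -rmorphN -rc1 complex_decomp eq_complex /= oner_eq0 //.
have E : 1 + T ^+ 2 = (1 + i * T) * (1 - i * T).
  transitivity (1 - i * i * T ^+ 2); last by ring.
  by rewrite ii; ring.
rewrite E.
have -> : p + u + T * (i * u) - p = u * (1 + i * T) by ring.
have -> : p + u + T * (- (i * u)) - p = u * (1 - i * T) by ring.
field.
by rewrite T1 T2 u0 N0C.
Qed.

(** The four squares tile the larger square centred at [p], and the segments issuing from [p]
    cancel. The centre is made a common corner because [goursat_corner] treats the exceptional point
    there. *)
Lemma square_sum4 g p s N :
  square_sum g p s N + square_sum g p (i * s) N + square_sum g p (- s) N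
    + square_sum g p (- (i * s)) N =
  (midpoint_sum g (p + s) (i * s) N - midpoint_sum g (p + s) (- (i * s)) N) +
  (midpoint_sum g (p + i * s) (- s) N - midpoint_sum g (p + i * s) s N) +
  (midpoint_sum g (p - s) (- (i * s)) N - midpoint_sum g (p - s) (i * s) N) +
  (midpoint_sum g (p - i * s) s N - midpoint_sum g (p - i * s) (- s) N).
Proof.
rewrite /square_sum.
have -> : i * (i * s) = - s by rewrite mulrA ii mulN1r.
have -> : i * (- s) = - (i * s) by rewrite mulrN.
have -> : i * (- (i * s)) = s by rewrite mulrN mulrA ii mulN1r opprK.
ring.
Qed.

Lemma cm_side g p u v N B : (0 < N)%N -> cm u = cm v ->
  (forall t : R, 0 <= t <= 1 -> cm (g (p + u + (t%:C)%C * v)) <= B) ->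
  cm (midpoint_sum g (p + u) v N) <= cm u * B.
Proof. by move=> N0 -> H; apply: cm_midpoint_sum. Qed.

(** Cauchy's formula on the square of half-side [r], with an inequality for the constant. The sums
    of [(f z - f p) / (z - p)] tend to 0, those of [f z / (z - p)] are at most [8 * M] (eight
    half-sides of length [r], integrand at most [M / r]), and those of [(z - p)^-1] have modulus at
    least 4. The square's boundary lies between the radii [r] and [2 * r], whence the annulus. *)
Lemma crude_maximum f p r M : 0 < r ->
  (forall z, cm (z - p) <= 2 * r -> chol f z) ->
  (forall z, r <= cm (z - p) <= 2 * r -> cm (f z) <= M) ->
  cm (f p) <= 2 * M.
Proof.
move=> r0 hol HM.
pose s : C := (r%:C)%C.
have cms : cm s = r by rewrite cm_real gtr0_norm.
have s0 : s != 0 by rewrite -cm_eq0 cms gt_eqF.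
pose q z := (f z - f p) / (z - p).
have [e0 e00 [B qB]] : exists2 e0, 0 < e0 &
    exists B, forall z, cm (z - p) < e0 -> cm (q z) <= B.
  have [|a /cderivP/(_ 1 ltr01)[d d0 Hd]] := hol p.
    by rewrite subrr cm0 mulr_ge0// ltW.
  exists d => //; exists (cm a + 1) => z zd.
  have [->|zp] := eqVneq z p.
    by rewrite /q !subrr mul0r cm0 addr_ge0 ?cm_ge0.
  have zp0 : 0 < cm (z - p) by rewrite cm_gt0 subr_eq0.
  rewrite /q cmM cmV ler_pdivrMr//.
  rewrite -[f z - f p](subrK (a * (z - p))); apply: le_trans (cmD _ _) _.
  rewrite cmM mulrDl addrC lerD2l -{1}[z](subrK p) [z - p + p]addrC.
  exact: Hd.
have qhol z : cm (z - p) <= 2 * r -> z != p -> chol q z.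
  move=> zr zp; apply: cholM; first by apply: cholB (chol_cst _ _); apply: hol.
  apply: cholV; first by rewrite subr_eq0.
  by apply: cholB (chol_cst _ _); exact: chol_id.
have corner u : cm u = r -> forall e, 0 < e -> exists M, forall m, (M <= m)%N ->
    cm (square_sum q p u (2 ^ m)) <= e.
  move=> cmu; apply: (goursat_corner _ e00 qB).
    by rewrite -cm_eq0 cmu gt_eqF.
  by move=> z /in_square_cm; rewrite cmu; exact: qhol.
apply/ler_addgt0Pr => e e_gt0.
have [M1 H1] := corner s cms _ e_gt0.
have [|M2 H2] := corner (i * s) _ _ e_gt0; first by rewrite cmM cmi mul1r.
have [|M3 H3] := corner (- s) _ _ e_gt0; first by rewrite cmN.
have [|M4 H4] := corner (- (i * s)) _ _ e_gt0; first by rewrite cmN cmM cmi mul1r.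
pose m := (M1 + M2 + M3 + M4)%N.
have /H1 {}H1 : (M1 <= m)%N by rewrite /m -!addnA leq_addr.
have /H2 {}H2 : (M2 <= m)%N by rewrite /m [(M1 + M2)%N]addnC -!addnA leq_addr.
have /H3 {}H3 : (M3 <= m)%N by rewrite /m [(_ + M3)%N]addnC -!addnA leq_addr.
have /H4 {}H4 : (M4 <= m)%N by rewrite /m leq_addl.
have N0 := pow2_gt0 m; set N := (2 ^ m)%N in H1 H2 H3 H4 N0.
pose D g := square_sum g p s N + square_sum g p (i * s) N + square_sum g p (- s) N
    + square_sum g p (- (i * s)) N.
pose g1 z := f z * (z - p)^-1.
have g1E : g1 = (fun z => f p * (z - p)^-1 + q z).
  by apply/funext => z; rewrite /g1 /q -mulrDl [f p + _]addrC subrK.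
have cmis : cm (i * s) = r by rewrite cmM cmi mul1r.
have side u v : cm u = r -> v = i * u \/ v = - (i * u) ->
    cm (midpoint_sum g1 (p + u) v N) <= M.
  move=> cmu hv.
  have cmv : cm v = r by case: hv => ->; rewrite ?cmN cmM cmi mul1r.
  have -> : M = cm u * (M / r) by rewrite cmu; field; rewrite gt_eqF.
  apply: cm_side => //; first by rewrite cmu cmv.
  move=> t /andP[t0 t1].
  have E : p + u + (t%:C)%C * v - p = u + (t%:C)%C * v by ring.
  have up : cm (u + (t%:C)%C * v) <= 2 * r.
    by apply: le_trans (cmD _ _) _; rewrite cmM cm_real ger0_norm// cmu cmv; nra.
  have low : r <= cm (u + (t%:C)%C * v).
    have [w Ew cw] : exists2 w, u + (t%:C)%C * v = u * w & 1 <= cm w.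
      case: hv => ->; [exists (1 +i* t)%C|exists (1 -i* t)%C].
      - by rewrite -(complex_decomp 1 t) rc1; ring.
      - by apply: le_trans (ler_Re_cm _); rewrite /= normr1.
      - by rewrite -(complex_decomp 1 (- t)) rmorphN rc1; ring.
      - by apply: le_trans (ler_Re_cm _); rewrite /= normr1.
    by rewrite Ew cmM cmu ler_peMr// ltW.
  rewrite /g1 E cmM cmV; apply: ler_pM; rewrite ?invr_ge0 ?cm_ge0//.
    by apply: HM; rewrite E low up.
  by rewrite lef_pV2// posrE// (lt_le_trans r0).
have DM : cm (D g1) <= 8 * M.
  rewrite /D square_sum4.
  have A1 := side s (i * s) cms (or_introl erefl).
  have A2 := side s (- (i * s)) cms (or_intror erefl).
  have ex1 : - s = i * (i * s) by rewrite mulrA ii mulN1r.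
  have ex2 : s = - (i * (i * s)) by rewrite mulrA ii mulN1r opprK.
  have A3 := side (i * s) (- s) cmis (or_introl ex1).
  have A4 := side (i * s) s cmis (or_intror ex2).
  have cmns : cm (- s) = r by rewrite cmN.
  have ex3 : - (i * s) = i * (- s) by rewrite mulrN.
  have ex4 : i * s = - (i * (- s)) by rewrite mulrN opprK.
  have A5 := side (- s) (- (i * s)) cmns (or_introl ex3).
  have A6 := side (- s) (i * s) cmns (or_intror ex4).
  have cmnis : cm (- (i * s)) = r by rewrite cmN.
  have ex5 : s = i * (- (i * s)) by rewrite mulrN mulrA ii mulN1r opprK.
  have ex6 : - s = - (i * (- (i * s))) by rewrite mulrN mulrA ii mulN1r opprK.
  have A7 := side (- (i * s)) s cmnis (or_introl ex5).
  have A8 := side (- (i * s)) (- s) cmnis (or_intror ex6).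
  apply: le_trans (cmD _ _) _; apply: le_trans (lerD (cmD _ _) (lexx _)) _.
  apply: le_trans (lerD (lerD (cmD _ _) (lexx _)) (lexx _)) _.
  apply: le_trans (lerD (lerD (lerD (cmB _ _) (cmB _ _)) (cmB _ _)) (cmB _ _)) _.
  lra.
have Dq : cm (D q) <= 4 * e.
  apply: le_trans (cmD _ _) _; apply: le_trans (lerD (cmD _ _) (lexx _)) _.
  apply: le_trans (lerD (lerD (cmD _ _) (lexx _)) (lexx _)) _.
  lra.
have [W W1 DW] : exists2 W : R, 4 <= W & D (fun z => (z - p)^-1) = i * (W%:C)%C.
  have is0 : i * s != 0 by rewrite -cm_eq0 cmis gt_eqF.
  have ns0 : - s != 0 by rewrite oppr_eq0.
  have nis0 : - (i * s) != 0 by rewrite oppr_eq0.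
  have [W1 W11 E1] := inverse_side_sum p N0 s0.
  have [W2 W21 E2] := inverse_side_sum p N0 is0.
  have [W3 W31 E3] := inverse_side_sum p N0 ns0.
  have [W4 W41 E4] := inverse_side_sum p N0 nis0.
  exists (W1 + W2 + W3 + W4); first by lra.
  rewrite /D square_sum4 !rmorphD !mulrDr -E1 -E2 -E3 -E4.
  have -> : i * (i * s) = - s by rewrite mulrA ii mulN1r.
  have -> : i * (- s) = - (i * s) by rewrite mulrN.
  have -> : i * (- (i * s)) = s by rewrite mulrN mulrA ii mulN1r opprK.
  by rewrite !opprK.
have DD : D g1 = f p * D (fun z => (z - p)^-1) + D q.
  have sqE u : square_sum g1 p u N = f p * square_sum (fun z => (z - p)^-1) p u N
      + square_sum q p u N.
    rewrite g1E square_sumD; congr (_ + _).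
    by rewrite /square_sum !midpoint_sumZ; ring.
  by rewrite /D !sqE; ring.
have : cm (f p) * W <= 8 * M + 4 * e.
  have -> : cm (f p) * W = cm (f p * D (fun z => (z - p)^-1)).
    by rewrite DW !cmM cmi mul1r cm_real ger0_norm//; lra.
  have -> : f p * D (fun z => (z - p)^-1) = D g1 - D q by rewrite DD addrK.
  by apply: le_trans (cmB _ _) _; lra.
have := cm_ge0 (f p); nra.
Qed.

End crude_maximum.

(** * Sharp maximum principle on discs *)

Section maximum_principle.
Variable R : realType.
Local Notation C := (R[i]).
Local Notation i := ('i%C : C).
Implicit Types (f g : C -> C) (p s d z a b u v w : C) (N m n : nat) (e B r M : R).

Lemma bernoulli (x : R) n : 0 <= x -> 1 + n%:R * x <= (1 + x) ^+ n.
Proof.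
move=> x0; elim: n => [|n IH]; first by rewrite mul0r addr0 expr0.
rewrite exprS -addn1 natrD; have : 0 <= n%:R :> R by rewrite ler0n.
nra.
Qed.

(** If [c > M], Bernoulli's inequality makes [(c / M) ^+ n] exceed any [k]. This removes a constant
    factor from any estimate stable under powers. *)
Lemma ler_of_powers (c M k : R) : 0 <= c -> 0 <= M ->
  (forall n, c ^+ n <= k * M ^+ n) -> c <= M.
Proof.
move=> c0 M0 H; rewrite leNgt; apply/negP => Mc.
have cgt0 : 0 < c by apply: le_lt_trans Mc.
have [M00|Mn0] := eqVneq M 0.
  by have := H 1%N; rewrite M00 !expr1 mulr0; lra.
have Mgt0 : 0 < M by rewrite lt_def Mn0.
pose x := c / M - 1.
have x0 : 0 < x by rewrite subr_gt0 ltr_pdivlMr// mul1r.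
have Hk n : 1 + n%:R * x <= k.
  apply: le_trans (bernoulli n (ltW x0)) _.
  by rewrite /x addrC subrK expr_div_n ler_pdivrMr ?exprn_gt0.
have : k < (Num.bound (k / x))%:R * x.
  rewrite -ltr_pdivrMr//; apply: archi_boundP; rewrite divr_ge0 ?(ltW x0)//.
  by have := Hk 0%N; rewrite mul0r addr0; lra.
by have := Hk (Num.bound (k / x)); lra.
Qed.

Lemma annulus_maximum f p r M : 0 < r ->
  (forall z, cm (z - p) <= 2 * r -> chol f z) ->
  (forall z, r <= cm (z - p) <= 2 * r -> cm (f z) <= M) ->
  cm (f p) <= M.
Proof.
move=> r0 hol HM.
have M0 : 0 <= M.
  apply: le_trans (cm_ge0 (f (p + (r%:C)%C))) _; apply: HM.
  by rewrite [p + _]addrC addrK cm_real gtr0_norm//; lra.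
apply: (@ler_of_powers _ _ 2); rewrite ?cm_ge0// => n; rewrite -cmX.
apply: (crude_maximum (f := fun z => f z ^+ n) r0).
  by move=> z zr; apply: cholX; apply: hol.
by move=> z zr; rewrite cmX lerXn2r ?nnegrE ?cm_ge0//; apply: HM.
Qed.

(** For a large real [k], the modulus of [f + k] is nearly [Re f + k]: on the annulus its square is
    at most [(x + k) ^+ 2 + B ^+ 2]. If [y = Re (f p)] exceeded [x], then [(y + k) ^+ 2] would be
    larger by [(y - x) * (x + y + 2 * k)], which beats [B ^+ 2]; the summands of [k] secure this and
    the signs. *)
Lemma annulus_maximum_Re f p r x B : 0 < r ->
  (forall z, cm (z - p) <= 2 * r -> chol f z) ->
  (forall z, r <= cm (z - p) <= 2 * r -> cm (f z) <= B) ->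
  (forall z, r <= cm (z - p) <= 2 * r -> complex.Re (f z) <= x) ->
  complex.Re (f p) <= x.
Proof.
move=> r0 hol HB Hx; rewrite leNgt; apply/negP; set y := complex.Re (f p) => xy.
have B0 : 0 <= B.
  apply: le_trans (cm_ge0 (f (p + (r%:C)%C))) _; apply: HB.
  by rewrite [p + _]addrC addrK cm_real gtr0_norm//; lra.
have yx0 : 0 < y - x by rewrite subr_gt0.
pose k := B + `|x| + `|y| + B ^+ 2 / (y - x) + 1.
have B20 : 0 <= B ^+ 2 / (y - x) by rewrite divr_ge0 ?sqr_ge0// ltW.
have xk : 0 <= x + k by have := ler_norm (- x); have := normr_ge0 y; rewrite normrN /k; lra.
have yk : 0 <= y + k by have := ler_norm (- y); have := normr_ge0 x; rewrite normrN /k; lra.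
pose g z := f z + (k%:C)%C.
have : cm (g p) <= Num.sqrt ((x + k) ^+ 2 + B ^+ 2).
  apply: (annulus_maximum r0).
    by move=> z zr; apply: cholD (chol_cst _ _); apply: hol.
  move=> z zr; rewrite -(ler_pXn2r (n := 2)) ?nnegrE ?cm_ge0 ?sqrtr_ge0//.
  rewrite sqr_sqrtr ?addr_ge0 ?sqr_ge0// sqr_cm.
  have fB := HB _ zr; have fx := Hx _ zr.
  have := le_trans (ler_Re_cm _) fB; have := le_trans (ler_Im_cm _) fB.
  rewrite /g; case: (f z) fx => a b /= fx.
  rewrite !ler_norml addr0 => /andP[b1 b2] /andP[a1 a2].
  have : 0 <= a + k by have := normr_ge0 y; have := normr_ge0 x; rewrite /k; lra.
  move=> ak; apply: lerD; last by nra.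
  by rewrite lerXn2r ?nnegrE// lerD2r.
move=> le1.
have : (y + k) ^+ 2 <= (x + k) ^+ 2 + B ^+ 2.
  have -> : (x + k) ^+ 2 + B ^+ 2 = Num.sqrt ((x + k) ^+ 2 + B ^+ 2) ^+ 2.
    by rewrite sqr_sqrtr// addr_ge0 ?sqr_ge0.
  apply: (@le_trans _ _ (cm (g p) ^+ 2)).
    rewrite sqr_cm; have -> : y + k = complex.Re (g p).
      by rewrite /g /y; case: (f p).
    by rewrite lerDl sqr_ge0.
  by rewrite lerXn2r ?nnegrE ?cm_ge0 ?sqrtr_ge0.
apply/negP; rewrite -ltNge.
have -> : (y + k) ^+ 2 = (x + k) ^+ 2 + (y - x) * (x + y + 2 * k) by ring.
rewrite ltrD2l -ltr_pdivrMl// mulrC.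
have := ler_norm (- x); have := ler_norm (- y); rewrite !normrN.
rewrite /k; have := normr_ge0 x; have := normr_ge0 y.
lra.
Qed.

Lemma continuous_complex_plane (u : C -> R) (x y : R) :
  (forall e, 0 < e -> exists2 d : R, 0 < d & forall h, cm h < d ->
    `|u ((x +i* y)%C + h) - u (x +i* y)%C| <= e) ->
  {for (x, y), continuous (fun xy : R * R => u (xy.1 +i* xy.2)%C)}.
Proof.
move=> H; apply/cvgrPdist_le => e e0; have [d d0 Hd] := H _ e0.
exists (ball x (d / 2), ball y (d / 2)) => /=.
  by split; apply: nbhsx_ballx; rewrite divr_gt0.
move=> [x' y'] [/= bx by']; rewrite distrC.
have -> : (x' +i* y')%C = (x +i* y)%C + ((x' - x) +i* (y' - y))%C :> C.
  by apply/eqP; rewrite eq_complex /=; apply/andP; split; apply/eqP; ring.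
apply: Hd; apply: le_lt_trans (ler_cm_ReIm _) _ => /=.
move: bx by'; rewrite -!ball_normE /= ![`|_ - x'|]distrC ![`|_ - y'|]distrC; lra.
Qed.

(** The disc is compact as a closed part of a rectangle in [R * R], so continuity is transported to
    real coordinates. *)
Lemma disc_EVT (u : C -> R) p r : 0 <= r ->
  (forall z, cm (z - p) <= r -> forall e, 0 < e -> exists2 d : R, 0 < d &
    forall h, cm h < d -> `|u (z + h) - u z| <= e) ->
  exists2 c, cm (c - p) <= r & forall z, cm (z - p) <= r -> u z <= u c.
Proof.
move=> r0 cu.
pose a := complex.Re p; pose b := complex.Im p.
pose A : set (R * R) := [set xy | cm ((xy.1 +i* xy.2)%C - p) <= r].
have AE x y : A (x, y) = (cm ((x +i* y)%C - p) <= r) by [].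
have cA : compact A.
  apply: (@subclosed_compact _ _ (`[a - r, a + r] `*` `[b - r, b + r])).
  - have -> : A = (fun xy : R * R => cm ((xy.1 +i* xy.2)%C - p)) @^-1` [set x | x <= r] by [].
    apply: preimage_closed; last exact: closed_le.
    move=> [x y] _; apply: (continuous_complex_plane (u := fun z => cm (z - p))).
    move=> e e0; exists e => // h he.
    rewrite addrAC ler_norml; apply/andP; split.
      have := ler_cmB ((x +i* y)%C - p) (- h).
      by rewrite opprK cmN; lra.
    by have := cmD ((x +i* y)%C - p) h; lra.
  - by apply: compact_setX; exact: segment_compact.
  - move=> [x y] /= Axy.
    have := le_trans (ler_Re_cm _) Axy; have := le_trans (ler_Im_cm _) Axy.
    rewrite /a /b; case: (p) => a' b' /=.
    by rewrite !in_itv /= !ler_norml; lra.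
have A0 : A !=set0.
  exists (a, b); rewrite AE /a /b; case: (p) => a' b'.
  by rewrite subrr cm0.
have [|[x y] /set_mem xyA Hmax] := compact_EVT_max A0 cA
    (f := fun xy : R * R => u (xy.1 +i* xy.2)%C).
  apply: continuous_in_subspaceT => -[x y] /set_mem xyA.
  by apply: continuous_complex_plane; exact: cu.
exists (x +i* y)%C => //; case=> x' y' zr.
by apply: (Hmax (x', y')); apply: mem_set.
Qed.

(** The annulus version says nothing directly at a maximum point, where equality may hold. Adding
    [e * cm (z - p) ^+ 2] to the squared modulus makes the function strictly subharmonic, and its
    maximum at an interior point [q] is then refuted on an annulus about [q]. *)
Lemma disc_maximum f p r M : 0 <= r ->
  (forall z, cm (z - p) <= r -> chol f z) ->
  (forall z, cm (z - p) = r -> cm (f z) <= M) ->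
  forall w, cm (w - p) <= r -> cm (f w) <= M.
Proof.
move=> r0 hol HM w wr; rewrite leNgt; apply/negP => Mw.
have M0 : 0 <= M.
  apply: le_trans (cm_ge0 (f (p + (r%:C)%C))) _; apply: HM.
  by rewrite [p + _]addrC addrK cm_real ger0_norm.
(* Small enough that on the circle the perturbed function stays below its value at [w], so its
   maximum is interior. *)
pose e := (cm (f w) ^+ 2 - M ^+ 2) / (r ^+ 2 + 1).
have r21 : 0 < r ^+ 2 + 1 by rewrite ltr_wpDl// sqr_ge0.
have e0 : 0 < e by rewrite divr_gt0// subr_gt0; nra.
have er : e * r ^+ 2 < cm (f w) ^+ 2 - M ^+ 2.
  rewrite -[ltRHS](divfK (x := r ^+ 2 + 1)) ?gt_eqF// -/e.
  by rewrite ltr_pM2l// ltrDl.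
pose u z := cm (f z) ^+ 2 + e * cm (z - p) ^+ 2.
have [|q qr Hq] := disc_EVT (u := u) (p := p) r0.
  move=> z zr d d0.
  pose B := 2 * cm (f z) + 1 + e * (2 * cm (z - p) + 1).
  have B0 : 0 < B.
    have := cm_ge0 (f z); have := cm_ge0 (z - p); rewrite /B; nra.
  pose t := Num.min 1 (d / B).
  have t0 : 0 < t by rewrite lt_min ltr01 divr_gt0.
  have [d' d'0 Hd'] := chol_continuous (hol _ zr) t0.
  exists (Num.min d' t); first by rewrite lt_min d'0.
  move=> h; rewrite lt_min => /andP[/Hd' h1 h2].
  have t1 : t <= 1 by rewrite ge_min lexx.
  have tB : t * B <= d by rewrite -ler_pdivlMr// ge_min lexx orbT.
  have sq (x y : R) : 0 <= x -> `|y - x| <= t -> `|y ^+ 2 - x ^+ 2| <= t * (2 * x + 1).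
    by rewrite !ler_norml => x0 /andP[l1 l2]; apply/andP; split; nra.
  have l1 : `|cm (f (z + h)) ^+ 2 - cm (f z) ^+ 2| <= t * (2 * cm (f z) + 1).
    apply: sq; rewrite ?cm_ge0// ler_norml.
    have := ler_cmB (f (z + h)) (f z); have := ler_cmB (f z) (f (z + h)).
    by rewrite [cm (f z - _)]cmBC; lra.
  have l2 : `|cm (z + h - p) ^+ 2 - cm (z - p) ^+ 2| <= t * (2 * cm (z - p) + 1).
    apply: sq; rewrite ?cm_ge0// ler_norml addrAC.
    have := cmD (z - p) h; have := ler_cmB (z - p) (- h); rewrite opprK cmN; lra.
  rewrite /u; move: l1 l2; rewrite !ler_norml /B in tB *; nra.
have uw : u q > M ^+ 2 + e * r ^+ 2.
  apply: lt_le_trans (Hq _ wr).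
  have : 0 <= e * cm (w - p) ^+ 2 by rewrite mulr_ge0 ?sqr_ge0// ltW.
  by rewrite /u; lra.
have qr' : cm (q - p) < r.
  rewrite lt_neqAle qr andbT; apply/eqP => qE; move: uw.
  have := HM _ qE; rewrite /u qE; have := cm_ge0 (f q); nra.
pose t := (r - cm (q - p)) / 2.
have t0 : 0 < t by rewrite divr_gt0// subr_gt0.
have inD z : cm (z - q) <= 2 * t -> cm (z - p) <= r.
  move=> h; have -> : z - p = (z - q) + (q - p) by ring.
  by apply: le_trans (cmD _ _) _; rewrite /t in h; lra.
(* The polarisation of [u] at [q]: holomorphic in [z], with real part [u q] at [q]. By [phiE], away
   from [q] this real part falls short of the mean of [u z] and [u q] by at least
   [e * cm (z - q) ^+ 2 / 2]. *)
pose phi z := f z * (f q)^*%C + (e%:C)%C * ((z - p) * (q - p)^*%C).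
have phiE z : complex.Re (phi z) = (cm (f z) ^+ 2 + cm (f q) ^+ 2 - cm (f z - f q) ^+ 2
    + e * (cm (z - p) ^+ 2 + cm (q - p) ^+ 2 - cm (z - q) ^+ 2)) / 2.
  rewrite /phi; have -> : z - q = (z - p) - (q - p) by ring.
  move: (f z) (f q) (z - p) (q - p) => [a1 a2] [b1 b2] [c1 c2] [d1 d2].
  by rewrite !sqr_cm /=; field.
have phiq : complex.Re (phi q) = u q.
  by rewrite phiE !subrr cm0 /u; field.
have : complex.Re (phi q) <= u q - e * t ^+ 2 / 2.
  have cmJ z : cm z^*%C = cm z.
    by case: z => a1 a2; rewrite /cm /= sqrrN.
  have bd z : cm (z - q) <= 2 * t -> cm (f z) <= u q + 1 /\ u z <= u q.
    move=> /inD/Hq h; split => //.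
    have : 0 <= e * cm (z - p) ^+ 2 by rewrite mulr_ge0 ?sqr_ge0// ltW.
    by rewrite /u in h *; nra.
  apply: (annulus_maximum_Re (B := (u q + 1) * (u q + 1) + e * (r * r)) t0).
  - move=> z /inD zr; apply: cholD; apply: cholM; try exact: chol_cst.
      exact: hol.
    apply: cholM; last exact: chol_cst.
    by apply: cholB (chol_cst _ _); exact: chol_id.
  - move=> z /andP[_ zq]; have [b1 _] := bd _ zq.
    apply: le_trans (cmD _ _) _; rewrite !cmM !cmJ cm_real gtr0_norm//.
    apply: lerD; last first.
      by rewrite ler_wpM2l ?(ltW e0)//; apply: ler_pM; rewrite ?cm_ge0//; exact: inD.
    apply: ler_pM; rewrite ?cm_ge0//.
    by have [] := bd q _; rewrite // subrr cm0 mulr_ge0// ltW.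
  - move=> z /andP[zt zq]; have [_ b1] := bd _ zq.
    rewrite phiE.
    have : 0 <= cm (f z - f q) ^+ 2 by rewrite sqr_ge0.
    have : e * t ^+ 2 <= e * cm (z - q) ^+ 2.
      by rewrite ler_pM2l// lerXn2r ?nnegrE ?cm_ge0// ltW.
    by rewrite /u in b1 *; lra.
rewrite phiq; have : 0 < e * t ^+ 2 by rewrite mulr_gt0 ?exprn_gt0.
lra.
Qed.

End maximum_principle.

(** * Removable singularities *)

Section removable.
Variable R : realType.
Local Notation C := (R[i]).
Local Notation i := ('i%C : C).
Implicit Types (f g : C -> C) (p s d z a b u v w l : C) (N m n : nat) (e B r M : R).

Lemma disc_bounded f p r : 0 <= r -> (forall z, cm (z - p) <= r -> chol f z) ->
  exists2 B, 0 < B & forall z, cm (z - p) <= r -> cm (f z) <= B.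
Proof.
move=> r0 hol.
have [|q qr Hq] := disc_EVT (u := fun z => cm (f z)) (p := p) r0.
  move=> z /hol fz e e0; have [d d0 Hd] := chol_continuous fz e0.
  exists d => // h /Hd fh; rewrite ler_norml.
  have := ler_cmB (f (z + h)) (f z); have := ler_cmB (f z) (f (z + h)).
  by rewrite [cm (f z - _)]cmBC; lra.
exists (cm (f q) + 1); first by rewrite ltr_wpDl ?cm_ge0.
by move=> z /Hq h; apply: le_trans h _; rewrite lerDl.
Qed.

Lemma cderiv0_quadratic f p B (d : R) : 0 < d -> f p = 0 ->
  (forall z, cm (z - p) < d -> cm (f z) <= B * cm (z - p) ^+ 2) -> cderiv f p 0.
Proof.
move=> d0 fp H; apply/cderivP => e e0.
have B1 : 0 < `|B| + 1 by rewrite ltr_wpDl.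
exists (Num.min d (e / (`|B| + 1))); first by rewrite lt_min d0 divr_gt0.
move=> h; rewrite lt_min => /andP[hd]; rewrite ltr_pdivlMr// => he.
rewrite fp subr0 mul0r subr0; apply: le_trans (H _ _) _.
  by rewrite [p + h]addrC addrK.
rewrite [p + h]addrC addrK; have := cm_ge0 h; have := ler_norm B; nra.
Qed.

(** Multiplying by [P], which vanishes doubly at [p1] and [p2], makes a bounded function
    differentiable there. With [f ^+ n] in place of [f], the factor [P] contributes a constant
    independent of [n], which [ler_of_powers] removes. *)
Lemma disc_maximum_except f r M B p1 p2 : 0 < r -> 0 <= M ->
  cm p1 < r -> cm p2 < r ->
  (forall z, cm z <= r -> cm (f z) <= B) ->
  (forall z, cm z <= r -> z != p1 -> z != p2 -> chol f z) ->
  (forall z, cm z = r -> cm (f z) <= M) ->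
  forall w, cm w <= r -> w != p1 -> w != p2 -> cm (f w) <= M.
Proof.
move=> r0 M0 p1r p2r fB hol HM w wr wp1 wp2.
have B0 : 0 <= B by apply: le_trans (cm_ge0 (f w)) (fB _ wr).
pose P z := (z - p1) ^+ 2 * (z - p2) ^+ 2.
have far z p : cm z <= r -> cm p < r -> cm (z - p) <= 2 * r.
  by move=> zr pr; apply: le_trans (cmB _ _) _; lra.
have PwC : 0 < cm (P w).
  by rewrite cm_gt0 mulf_neq0// expf_neq0// subr_eq0.
have PB z : cm z <= r -> cm (P z) <= (2 * r) ^+ 2 * (2 * r) ^+ 2.
  move=> zr; rewrite /P cmM !cmX; apply: ler_pM; rewrite ?exprn_ge0 ?cm_ge0//.
    by rewrite lerXn2r ?nnegrE ?cm_ge0 ?mulr_ge0 ?(ltW r0)//; exact: far.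
  by rewrite lerXn2r ?nnegrE ?cm_ge0 ?mulr_ge0 ?(ltW r0)//; exact: far.
apply: (@ler_of_powers _ _ _ ((2 * r) ^+ 2 * (2 * r) ^+ 2 / cm (P w))) => //.
  exact: cm_ge0.
move=> n; rewrite mulrAC ler_pdivlMr// -cmX -cmM.
have Bn z : cm z <= r -> cm (f z ^+ n) <= B ^+ n.
  by move=> zr; rewrite cmX lerXn2r ?nnegrE ?cm_ge0//; exact: fB.
have quad (p q : C) : cm p < r -> cm q < r ->
    cderiv (fun z => f z ^+ n * ((z - p) ^+ 2 * (z - q) ^+ 2)) p 0.
  move=> pr qr; have d0 : 0 < r - cm p by rewrite subr_gt0.
  apply: (cderiv0_quadratic (B := B ^+ n * (2 * r) ^+ 2) d0).
    by rewrite subrr expr0n mul0r mulr0.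
  move=> z zp; have zr : cm z <= r.
    by rewrite -[z](subrK p); apply: le_trans (cmD _ _) _; lra.
  have h2 : cm ((z - q) ^+ 2) <= (2 * r) ^+ 2.
    by rewrite cmX lerXn2r ?nnegrE ?cm_ge0 ?mulr_ge0 ?(ltW r0)//; exact: far.
  rewrite [(z - p) ^+ 2 * _]mulrC mulrA cmM [cm ((z - p) ^+ 2)]cmX.
  by rewrite ler_wpM2r ?sqr_ge0// cmM ler_pM ?cm_ge0//; exact: Bn.
apply: (disc_maximum (f := fun z => f z ^+ n * P z) (p := 0) (ltW r0)); rewrite ?subr0//.
- move=> z; rewrite subr0 => zr; rewrite /P.
  have [->|zp1] := eqVneq z p1; first by exists 0; exact: quad.
  have [->|zp2] := eqVneq z p2.
    exists 0; have := quad _ _ p2r p1r.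
    by congr cderiv; apply/funext => x; rewrite [in RHS]mulrC [in LHS]mulrC; congr (_ * _); rewrite mulrC.
  apply: cholM; first by apply: cholX; apply: hol.
  have chs q : chol (fun z => z - q) z by apply: cholB (chol_id _) (chol_cst _ _).
  by apply: cholM; apply: cholX; exact: chs.
- move=> z; rewrite subr0 => zr; rewrite cmM cmX mulrC.
  apply: ler_pM; rewrite ?exprn_ge0 ?cm_ge0//.
    by apply: PB; rewrite zr.
  by rewrite lerXn2r ?nnegrE ?cm_ge0//; exact: HM.
Qed.

(** The difference quotient at [w] has the exceptional points 0 and [w]. On the circle its numerator
    is at most [2 * B] and its denominator at least [r / 2], which gives a constant independent of
    [w]. *)
Lemma bounded_lipschitz f r B : 0 < r -> (forall z, cm z <= r -> cm (f z) <= B) ->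
  (forall z, cm z <= r -> z != 0 -> chol f z) ->
  forall z w, z != 0 -> w != 0 -> cm z <= r / 2 -> cm w <= r / 2 ->
    cm (f z - f w) <= 4 * B / r * cm (z - w).
Proof.
move=> r0 fB hol z w z0 w0 zr wr.
have [->|zw] := eqVneq z w; first by rewrite !subrr cm0 mulr0.
have B0 : 0 <= B.
  by apply: le_trans (cm_ge0 (f w)) (fB _ _); lra.
pose k x := (f x - f w) / (x - w).
have far x : cm x <= r -> cm (f x - f w) <= 2 * B.
  move=> xr; apply: le_trans (cmB _ _) _; have := fB _ xr.
  by have := fB w; lra.
have wr' : cm w <= r by lra.
have [a /cderivP/(_ 1 ltr01)[d d0 Hd]] := hol _ wr' w0.
(* This bound depends on [w], but [disc_maximum_except] requires mere boundedness inside; its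
   conclusion comes from the circle. *)
have kB x : cm x <= r -> cm (k x) <= cm a + 1 + 2 * B / d.
  move=> xr; have Bd0 : 0 <= 2 * B / d by rewrite divr_ge0 ?mulr_ge0// ltW.
  have [->|xw] := eqVneq x w.
    rewrite /k !subrr mul0r cm0; have := cm_ge0 a; lra.
  have xw0 : 0 < cm (x - w) by rewrite cm_gt0 subr_eq0.
  rewrite /k cmM cmV ler_pdivrMr//.
  have [xd|dx] := ltP (cm (x - w)) d.
    rewrite -[f x - f w](subrK (a * (x - w))); apply: le_trans (cmD _ _) _.
    rewrite cmM; have := Hd _ xd; rewrite [w + _]addrC subrK.
    by have := mulr_ge0 Bd0 (ltW xw0); lra.
  apply: le_trans (far _ xr) _.
  apply: (@le_trans _ _ (2 * B / d * cm (x - w))).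
    by rewrite mulrAC ler_pdivlMr// ler_wpM2l ?mulr_ge0.
  rewrite ler_wpM2r ?(ltW xw0)//; have := cm_ge0 a; lra.
have : cm (k z) <= 4 * B / r.
  apply: (@disc_maximum_except k r _ _ 0 w r0 _ _ _ kB) => //.
  - by rewrite divr_ge0 ?mulr_ge0// ltW.
  - by rewrite cm0.
  - by lra.
  - move=> x xr x0 xw; apply: cholM.
      by apply: cholB (chol_cst _ _); exact: hol.
    apply: cholV; first by rewrite subr_eq0.
    exact: cholB (chol_id _) (chol_cst _ _).
  - move=> x xr; have lowx : r / 2 <= cm (x - w) by have := ler_cmB x w; lra.
    rewrite /k cmM cmV ler_pdivrMr; last by lra.
    apply: le_trans (far _ _) _; first by rewrite xr.
    have -> : 2 * B = 4 * B / r * (r / 2) by field; rewrite gt_eqF.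
    by rewrite ler_wpM2l// divr_ge0 ?mulr_ge0// ltW.
  - by lra.
rewrite /k cmM cmV ler_pdivrMr// cm_gt0 subr_eq0//.
Qed.

Lemma complex_cauchy_cvg (u : nat -> C) :
  (forall e, 0 < e -> exists N, forall n, (N <= n)%N -> cm (u n - u N) <= e) ->
  exists l, forall e, 0 < e -> exists N, forall n, (N <= n)%N -> cm (u n - l) <= e.
Proof.
move=> cu.
have cvgR (v : nat -> R) :
    (forall e, 0 < e -> exists N, forall n, (N <= n)%N -> `|v n - v N| <= e) ->
    exists l : R, forall e, 0 < e -> exists N, forall n, (N <= n)%N -> `|v n - l| <= e.
  move=> cv; have : cvg (v @ \oo).
    apply/cauchy_cvgP; apply: cauchy_exP => e e0.
    have [|N HN] := cv (e / 2); first by rewrite divr_gt0.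
    exists (v N); exists N => // n /= /HN; rewrite -ball_normE /= distrC => h.
    by apply: le_lt_trans h _; lra.
  move=> cvgv; exists (lim (v @ \oo)) => e e0.
  have /cvgrPdist_le/(_ e e0)[N _ HN] := cvgv; exists N => n /HN /=.
  by rewrite distrC.
have [|x Hx] := cvgR (fun n => complex.Re (u n)).
  move=> e /cu[N HN]; exists N => n /HN; apply: le_trans.
  by apply: le_trans (ler_Re_cm _); case: (u n) (u N) => ? ? [? ?] /=.
have [|y Hy] := cvgR (fun n => complex.Im (u n)).
  move=> e /cu[N HN]; exists N => n /HN; apply: le_trans.
  by apply: le_trans (ler_Im_cm _); case: (u n) (u N) => ? ? [? ?] /=.
exists (x +i* y)%C => e e0.
have e20 : 0 < e / 2 by rewrite divr_gt0.
have [N1 H1] := Hx _ e20; have [N2 H2] := Hy _ e20.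
exists (N1 + N2)%N => n Nn.
have /H1 {}H1 : (N1 <= n)%N by apply: leq_trans Nn; rewrite leq_addr.
have /H2 {}H2 : (N2 <= n)%N by apply: leq_trans Nn; rewrite leq_addl.
apply: le_trans (ler_cm_ReIm _) _; move: H1 H2; case: (u n) => a b /=; lra.
Qed.

(** The Lipschitz bound makes [f] Cauchy along real points [x n] tending to 0; letting [w = x n]
    tend to 0 in it gives the rate. *)
Lemma bounded_limit f r B : 0 < r -> (forall z, cm z <= r -> cm (f z) <= B) ->
  (forall z, cm z <= r -> z != 0 -> chol f z) ->
  exists l, forall z, z != 0 -> cm z <= r / 2 -> cm (f z - l) <= 4 * B / r * cm z.
Proof.
move=> r0 fB hol; have lip := bounded_lipschitz r0 fB hol.
have B0 : 0 <= B by apply: le_trans (cm_ge0 (f 0)) (fB _ _); rewrite cm0 ltW.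
pose k := 4 * B / r.
have k0 : 0 <= k by rewrite divr_ge0 ?mulr_ge0// ltW.
pose x n : C := ((r / 2 / n.+1%:R)%:C)%C.
have cx n : cm (x n) = r / 2 / n.+1%:R by rewrite cm_real ger0_norm// !divr_ge0// ltW.
have x0 n : x n != 0 by rewrite -cm_eq0 cx gt_eqF// !divr_gt0.
have xr n : cm (x n) <= r / 2.
  by rewrite cx ler_pdivrMr// ler_peMr ?divr_ge0 ?(ltW r0)// ler1n.
have small e : 0 < e -> exists N, forall n, (N <= n)%N -> cm (x n) <= e.
  move=> e0; pose N := Num.bound (r / 2 / e).
  have hN : r / 2 / e < N%:R by apply: archi_boundP; rewrite !divr_ge0// ltW.
  exists N => n Nn; rewrite cx ler_pdivrMr// [e * _]mulrC -ler_pdivrMr//.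
  by apply: le_trans (ltW hN) _; rewrite ler_nat; apply: leq_trans Nn _.
have [|l Hl] := complex_cauchy_cvg (u := fun n => f (x n)).
  move=> e e0; have e0' : 0 < e / (k + 1) / 2 by rewrite !divr_gt0// ltr_wpDl.
  have [N HN] := small _ e0'; exists N => n Nn.
  apply: le_trans (lip _ _ (x0 _) (x0 _) (xr _) (xr _)) _; rewrite -/k.
  apply: (@le_trans _ _ (k * (e / (k + 1)))).
    rewrite ler_wpM2l//; apply: le_trans (cmB _ _) _.
    by have := HN _ Nn; have := HN _ (leqnn N); lra.
  by rewrite mulrCA ler_piMr ?(ltW e0)// ler_pdivrMr ?mul1r ?lerDl ?ltr_wpDl.
exists l => z z0 zr; apply/ler_addgt0Pr => e e0.
have e20 : 0 < e / 2 by rewrite divr_gt0.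
have e0' : 0 < e / (k + 1) / 2 by rewrite !divr_gt0// ltr_wpDl.
have [N1 H1] := Hl _ e20; have [N2 H2] := small _ e0'.
have h1 := H1 (N1 + N2)%N (leq_addr _ _); have h2 := H2 (N1 + N2)%N (leq_addl _ _).
have -> : f z - l = (f z - f (x (N1 + N2)%N)) + (f (x (N1 + N2)%N) - l) by rewrite addrA subrK.
apply: le_trans (cmD _ _) _.
have := lip _ _ z0 (x0 (N1 + N2)%N) zr (xr _); rewrite -/k.
have h3 : k * cm (z - x (N1 + N2)%N) <= k * cm z + k * cm (x (N1 + N2)%N).
  by rewrite -mulrDr ler_wpM2l// cmB.
have h4 : k * cm (x (N1 + N2)%N) <= e / 2.
  apply: le_trans (ler_wpM2l k0 h2) _.
  have -> : k * (e / (k + 1) / 2) = e / 2 * (k / (k + 1)) by field; rewrite gt_eqF// ltr_wpDl.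
  by rewrite ler_piMr ?(ltW e20)// ler_pdivrMr ?mul1r ?lerDl ?ltr_wpDl.
lra.
Qed.

End removable.

(** * Cauchy estimates and the Schwarz-Pick inequality *)

Section taylor.
Variable R : realType.
Let K : numFieldType := R[i].
Local Notation C := (R[i]).
Implicit Types (f g : C -> C) (p s z a b u v w l : C) (N m n : nat) (e B r M d : R).

(** [dquotE] holds for any [a]; taking for [a] the derivative of [f] at 0 makes the quotient
    holomorphic. *)
Definition dquot f a z := if z == 0 then a else (f z - f 0) / z.

Definition cD f (z : C) : C := 'D_(1 : K) (f : K -> K) (z : K).

Lemma cDP f z : chol f z -> cderiv f z (cD f z).
Proof. by case=> a [fz _]; apply: DeriveDef. Qed.

Lemma cD_eq f z a : cderiv f z a -> cD f z = a.
Proof. by case. Qed.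

Lemma dquotE f a z : f z = f 0 + z * dquot f a z.
Proof.
rewrite /dquot; have [->|z0] := eqVneq z 0; first by rewrite mul0r addr0.
by rewrite mulrCA divff// mulr1 addrC subrK.
Qed.

Lemma cderiv_from_bound f a B d : 0 < d ->
  (forall z, z != 0 -> cm z < d -> cm (f z - f 0 - a * z) <= B * cm z ^+ 2) ->
  cderiv f 0 a.
Proof.
move=> d0 H.
have : cderiv (fun z => f z - f 0 - a * z) 0 0.
  apply: (cderiv0_quadratic (B := B) d0); first by rewrite subrr mulr0 subr0.
  move=> z; rewrite subr0; have [->|z0] := eqVneq z 0; last exact: H.
  by rewrite subrr mulr0 subr0 cm0 expr0n mulr0.
move=> /cderivP h; apply/cderivP => e /h[d' d'0 Hd]; exists d' => // x /Hd.
by rewrite !add0r !subrr mulr0 !subr0 mul0r subr0.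
Qed.

(** At 0, [bounded_limit] is applied twice. First it shows that the quotient tends to a limit, which
    is [a] by uniqueness of derivatives, at a linear rate. Hence [s], the quotient of second order,
    is bounded, and its own limit [l2] is the derivative sought. *)
Lemma dquot_holomorphic f a r : 0 < r -> (forall z, cm z <= r -> chol f z) ->
  cderiv f 0 a -> forall z, cm z <= r -> chol (dquot f a) z.
Proof.
move=> r0 hol fa.
have off z : z != 0 -> cm z <= r -> chol (dquot f a) z.
  move=> z0 zr.
  apply: (@chol_near _ (fun x => (f x - f 0) / x) _ _ (cm z)); first by rewrite cm_gt0.
    move=> w wz; rewrite /dquot ifF//; apply/negbTE/negP => /eqP w0.
    by move: wz; rewrite w0 sub0r cmN ltxx.
  apply: cholM; first by apply: cholB (chol_cst _ _); exact: hol.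
  by apply: cholV z0 _; exact: chol_id.
move=> z zr; have [z0|] := eqVneq z 0; last by move=> z0; exact: off.
rewrite z0 {z zr z0}.
have [B B0 fB] : exists2 B, 0 < B & forall z, cm z <= r -> cm (f z) <= B.
  have [|B B0 HB] := @disc_bounded _ f 0 r (ltW r0).
    by move=> z; rewrite subr0; exact: hol.
  by exists B => // z zr; apply: HB; rewrite subr0.
move: (fa) => /cderivP/(_ 1 ltr01)[d d0 Hd].
pose Bq := cm a + 1 + 2 * B / d.
have Bd0 : 0 <= 2 * B / d by rewrite divr_ge0 ?mulr_ge0// ltW.
have qB z : cm z <= r -> cm (dquot f a z) <= Bq.
  move=> zr; rewrite /dquot; have [z0|z0] := eqVneq z 0; first by rewrite /Bq; lra.
  have z0' : 0 < cm z by rewrite cm_gt0.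
  rewrite cmM cmV ler_pdivrMr//.
  have [xd|dx] := ltP (cm z) d.
    rewrite -[f z - f 0](subrK (a * z)); apply: le_trans (cmD _ _) _.
    rewrite cmM; have := Hd _ xd; rewrite add0r /Bq.
    by have := mulr_ge0 Bd0 (ltW z0'); lra.
  apply: le_trans (cmB _ _) _.
  apply: (@le_trans _ _ (2 * B)).
    by have := fB _ zr; have := fB 0; rewrite cm0; lra.
  apply: (@le_trans _ _ (2 * B / d * cm z)).
    by rewrite mulrAC ler_pdivlMr// ler_wpM2l ?mulr_ge0// ltW.
  rewrite ler_wpM2r ?(ltW z0')// /Bq; have := cm_ge0 a; lra.
have off' z : cm z <= r -> z != 0 -> chol (dquot f a) z by move=> zr z0; exact: off.
have [l Hl] := bounded_limit r0 qB off'.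
have r20 : 0 < r / 2 by rewrite divr_gt0.
have la : l = a.
  apply: cderiv_unique fa.
  apply: (cderiv_from_bound (B := 4 * Bq / r) r20) => z z0 zr.
  have := Hl _ z0 (ltW zr); rewrite (dquotE f a z).
  have -> : f 0 + z * dquot f a z - f 0 - l * z = (dquot f a z - l) * z by ring.
  by move=> h; rewrite cmM [cm z ^+ 2]expr2 [leRHS]mulrA ler_wpM2r ?cm_ge0.
rewrite la in Hl.
pose s z := (dquot f a z - a) / z.
have [||l2 Hl2] := @bounded_limit _ s (r / 2) (4 * Bq / r) r20.
- move=> z zr; rewrite /s; have [->|z0] := eqVneq z 0.
    rewrite invr0 mulr0 cm0 divr_ge0 ?mulr_ge0 ?(ltW r0)//.
    by rewrite /Bq; have := cm_ge0 a; lra.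
  by rewrite cmM cmV ler_pdivrMr ?cm_gt0//; exact: Hl.
- move=> z zr z0; apply: cholM; last by apply: cholV z0 _; exact: chol_id.
  by apply: cholB (chol_cst _ _); apply: off => //; lra.
exists l2; apply: (cderiv_from_bound (B := 4 * (4 * Bq / r) / (r / 2)) (d := r / 2 / 2)).
  by rewrite !divr_gt0.
move=> z z0 zr; have := Hl2 _ z0 (ltW zr).
have -> : dquot f a 0 = a by rewrite /dquot eqxx.
have -> : dquot f a z - a - l2 * z = (s z - l2) * z.
  by rewrite /s mulrBl divfK.
by move=> h; rewrite cmM [cm z ^+ 2]expr2 [leRHS]mulrA ler_wpM2r ?cm_ge0.
Qed.

Lemma dquot_bound f a r B : 0 < r -> (forall z, cm z <= r -> chol f z) ->
  cderiv f 0 a -> (forall z, cm z <= r -> cm (f z) <= B) ->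
  forall z, cm z <= r -> cm (dquot f a z) <= 2 * B / r.
Proof.
move=> r0 hol fa fB z zr.
have qhol := dquot_holomorphic r0 hol fa.
apply: (disc_maximum (f := dquot f a) (p := 0) (ltW r0)); rewrite ?subr0//.
  by move=> w; rewrite subr0; exact: qhol.
move=> w; rewrite subr0 => wr; rewrite /dquot.
have w0 : w != 0 by rewrite -cm_eq0 wr gt_eqF.
rewrite (negbTE w0) cmM cmV wr ler_wpM2r ?invr_ge0 ?(ltW r0)//.
apply: le_trans (cmB _ _) _; have := fB w; have := fB 0; rewrite cm0 wr; lra.
Qed.

Lemma cauchy_estimate f a r B : 0 < r -> (forall z, cm z <= r -> chol f z) ->
  cderiv f 0 a -> (forall z, cm z <= r -> cm (f z) <= B) -> cm a <= 2 * B / r.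
Proof.
move=> r0 hol fa fB; have -> : a = dquot f a 0 by rewrite /dquot eqxx.
by apply: dquot_bound; rewrite ?cm0 ?(ltW r0).
Qed.

Lemma cderiv_translate f p z a : cderiv f (p + z) a ->
  cderiv (fun x => f (p + x)) z a.
Proof.
move=> H; rewrite -[a]mulr1; apply: (cderiv_comp (f := fun x => p + x)) => //.
by apply: cderiv_eq (cderivD (cderiv_cst p z) (cderiv_id z)) _; rewrite add0r.
Qed.

Lemma chol_translate f p z : chol f (p + z) -> chol (fun x => f (p + x)) z.
Proof. by move=> [a H]; exists a; exact: cderiv_translate. Qed.

(** Writing [f z = f 0 + z * (a + z * t z)] with [t] holomorphic gives the derivative
    [a + 2 * z * t z + z ^+ 2 * cD t z]. Nothing is known yet about continuity of [cD t], but Cauchy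
    estimates bound it near 0, so the last term is quadratically small and [2 * t 0] remains. *)
Lemma cderiv_cD0 f a l r : 0 < r -> (forall z, cm z <= r -> chol f z) ->
  cderiv f 0 a -> cderiv (dquot f a) 0 l -> cderiv (cD f) 0 (2 * l).
Proof.
move=> r0 hol fa ql.
have qhol := dquot_holomorphic r0 hol fa.
have thol := dquot_holomorphic r0 qhol ql.
set t := dquot (dquot f a) l in thol.
have fE z : f z = f 0 + z * (a + z * t z).
  rewrite {1}(dquotE f a) (dquotE (dquot f a) l); congr (_ + _ * (_ + _)).
  by rewrite /dquot eqxx.
have fD z : cm z <= r -> cD f z = a + 2 * z * t z + z ^+ 2 * cD t z.
  move=> zr; apply: cD_eq.
  have -> : f = (fun z => f 0 + z * (a + z * t z)) by apply/funext.
  apply: cderiv_eq (cderivD (cderiv_cst _ _) (cderivM (cderiv_id _)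
    (cderivD (cderiv_cst _ _) (cderivM (cderiv_id _) (cDP (thol _ zr)))))) _.
  ring.
have [B B0 tB] : exists2 B, 0 < B & forall z, cm z <= r -> cm (t z) <= B.
  have [|B B0 HB] := @disc_bounded _ t 0 r (ltW r0).
    by move=> z; rewrite subr0; exact: thol.
  by exists B => // z zr; apply: HB; rewrite subr0.
have r20 : 0 < r / 2 by rewrite divr_gt0.
have tD z : cm z <= r / 2 -> cm (cD t z) <= 2 * B / (r / 2).
  move=> zr; have inr w : cm w <= r / 2 -> cm (z + w) <= r.
    by move=> wr; apply: le_trans (cmD _ _) _; lra.
  apply: (@cauchy_estimate (fun x => t (z + x)) (cD t z) (r / 2) B r20).
  - by move=> w wr; apply: chol_translate; apply: thol; exact: inr.
  - by apply: cderiv_translate; rewrite addr0; apply: cDP; apply: thol; lra.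
  - by move=> w wr; apply: tB; exact: inr.
have h1 : cderiv (fun z => a + 2 * z * t z + z ^+ 2 * cD t z) 0 (2 * l).
  have t0 : t 0 = l by rewrite /t /dquot eqxx.
  have hz : cderiv (fun z => z ^+ 2 * cD t z) 0 0.
    apply: (cderiv0_quadratic (B := 2 * B / (r / 2)) r20).
      by rewrite expr0n mul0r.
    move=> z; rewrite subr0 => zr; rewrite cmM cmX mulrC ler_wpM2r ?sqr_ge0//.
    by apply: tD; exact: ltW.
  have ht : chol t 0 by apply: thol; rewrite cm0 ltW.
  have h2 := cderivM (cderivM (cderiv_cst 2 0) (cderiv_id 0)) (cDP ht).
  by apply: cderiv_eq (cderivD (cderivD (cderiv_cst _ _) h2) hz) _; rewrite t0; ring.
apply: cderiv_near r0 _ h1 => w; rewrite subr0 => wr; rewrite fD//; exact: ltW.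
Qed.

Lemma cD_translate f p z : chol f (p + z) -> cD (fun x => f (p + x)) z = cD f (p + z).
Proof. by move=> h; apply: cD_eq; apply: cderiv_translate; exact: cDP. Qed.

Lemma chol_cD f p r : 0 < r -> (forall z, cm (z - p) < r -> chol f z) ->
  forall z, cm (z - p) < r -> chol (cD f) z.
Proof.
move=> r0 hol z zr.
pose t := (r - cm (z - p)) / 2.
have t0 : 0 < t by rewrite divr_gt0// subr_gt0.
have inD w : cm w <= t -> chol f (z + w).
  move=> wt; apply: hol; have -> : z + w - p = (z - p) + w by ring.
  by apply: le_lt_trans (cmD _ _) _; rewrite /t in wt; lra.
pose g x := f (z + x).
have ghol w : cm w <= t -> chol g w by move=> wt; apply: chol_translate; exact: inD.
have g0 : cderiv g 0 (cD g 0) by apply: cDP; apply: ghol; rewrite cm0 ltW.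
have [|l ql] := dquot_holomorphic t0 ghol g0 (z := 0); first by rewrite cm0 ltW.
have Hg : cderiv (cD g) (- z + z) (2 * l).
  by rewrite addNr; exact: cderiv_cD0 t0 ghol g0 ql.
have h : cderiv (fun x => cD g (- z + x)) z (2 * l) := cderiv_translate Hg.
exists (2 * l); apply: (cderiv_near t0 _ h) => w wz.
have wt : cm (- z + w) <= t by rewrite addrC ltW.
have E : z + (- z + w) = w by rewrite addrA subrr add0r.
by rewrite -[in RHS]E; exact: (cD_translate (inD _ wt)).
Qed.

End taylor.

Section schwarz.
Variable R : realType.
Local Notation C := (R[i]).
Implicit Types (f g : C -> C) (p s z a b u v w l : C) (N m n : nat) (e B r M d : R).

Lemma schwarz f : (forall z, cm z < 1 -> chol f z) ->
  (forall z, cm z < 1 -> cm (f z) <= 1) -> f 0 = 0 ->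
  let q := dquot f (cD f 0) in
  [/\ forall z, cm z < 1 -> chol q z, forall z, cm z < 1 -> cm (q z) <= 1 &
      forall z, f z = z * q z].
Proof.
move=> hol f1 f0 q.
have fa : cderiv f 0 (cD f 0) by apply: cDP; apply: hol; rewrite cm0.
have holr r : r < 1 -> forall z, cm z <= r -> chol f z.
  by move=> r1 z zr; apply: hol; apply: le_lt_trans zr r1.
have mid z : cm z < 1 -> exists r, [/\ 0 < r, r < 1 & cm z <= r].
  by move=> z1; exists ((1 + cm z) / 2); split; have := cm_ge0 z; lra.
split.
- move=> z /mid[r [r0 r1 zr]].
  exact: dquot_holomorphic r0 (holr _ r1) fa _ zr.
- move=> z z1; rewrite leNgt; apply/negP => q1.
  have cq0 : 0 < cm (q z) by lra.
  have iq1 : (cm (q z))^-1 < 1 by rewrite invf_lt1.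
  (* The disc of radius [r] contains [z], and [r^-1], which bounds [q] on it, is less than
     [cm (q z)]. *)
  pose r := (1 + Num.max (cm z) (cm (q z))^-1) / 2.
  have m1 : Num.max (cm z) (cm (q z))^-1 < 1 by rewrite gt_max z1.
  have zm : cm z <= Num.max (cm z) (cm (q z))^-1 by rewrite le_max lexx.
  have qm : (cm (q z))^-1 <= Num.max (cm z) (cm (q z))^-1 by rewrite le_max lexx orbT.
  have r1 : r < 1 by rewrite /r; lra.
  have zr : cm z <= r by rewrite /r; lra.
  have r0 : 0 < r by rewrite /r; have := cm_ge0 z; lra.
  have qr : (cm (q z))^-1 < r by rewrite /r; lra.
  have : cm (q z) <= r^-1.
    apply: (disc_maximum (f := q) (p := 0) (ltW r0)); rewrite ?subr0//.
      move=> w; rewrite subr0 => wr.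
      exact: dquot_holomorphic r0 (holr _ r1) fa _ wr.
    move=> w; rewrite subr0 => wr.
    have w0 : w != 0 by rewrite -cm_eq0 wr gt_eqF.
    rewrite /q /dquot (negbTE w0) f0 subr0 cmM cmV wr ler_piMl ?invr_ge0 ?(ltW r0)//.
    by apply: f1; rewrite wr.
  by rewrite leNgt => /negP; apply; rewrite invf_plt ?posrE.
- by move=> z; rewrite (dquotE f (cD f 0)) f0 add0r.
Qed.

(** The limit [t -> 1] of the hypothesis. Passing from 1 to [1 - e] shifts the inequality by at most
    [e * (x + 2 * y)], which dictates [k]. *)
Lemma ler_shrink (x y : R) : 0 <= x -> 0 <= y ->
  (forall t, 0 < t -> t < 1 -> t * x <= 1 - t ^+ 2 * y) -> x <= 1 - y.
Proof.
move=> x0 y0 H; rewrite leNgt; apply/negP => lt.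
pose k := 2 * (x + 2 * y) + 1.
have k0 : 0 < k by rewrite /k; lra.
pose e := Num.min (1 / 2) ((x - (1 - y)) / k).
have e0 : 0 < e by rewrite lt_min; apply/andP; split; [lra|rewrite divr_gt0// subr_gt0].
have e1 : e <= 1 / 2 by rewrite ge_min lexx.
have ek : e * k <= x - (1 - y) by rewrite -ler_pdivlMr// ge_min lexx orbT.
have := H (1 - e); rewrite /k in ek; nra.
Qed.

Lemma cmB_disc_automorphism (a z : C) : cm (1 - a^*%C * z) ^+ 2 - cm (z - a) ^+ 2 =
  (1 - cm a ^+ 2) * (1 - cm z ^+ 2).
Proof. by case: a z => [a1 a2] [z1 z2]; rewrite !sqr_cm /=; ring. Qed.

Lemma cmJ (z : C) : cm z^*%C = cm z.
Proof. by case: z => a1 a2; rewrite /cm /= sqrrN. Qed.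

Lemma mulrJ_cm z : z^*%C * z = ((cm z ^+ 2)%:C)%C.
Proof.
case: z => a b; rewrite sqr_cm /=.
by apply/eqP; rewrite eq_complex /=; apply/andP; split; apply/eqP; ring.
Qed.

(** Schwarz's lemma for [k], the composite of [g = t * f] with the disc automorphism sending [g 0]
    to 0. The factor [t < 1] keeps [1 - a^*%C * g z] away from 0 even if [f] takes values on the
    unit circle. *)
Lemma schwarz_pick0 f : (forall z, cm z < 1 -> chol f z) ->
  (forall z, cm z < 1 -> cm (f z) <= 1) -> cm (cD f 0) <= 1 - cm (f 0) ^+ 2.
Proof.
move=> hol f1; apply: ler_shrink; rewrite ?cm_ge0 ?sqr_ge0// => t t0 t1.
pose g z := (t%:C)%C * f z.
pose a := g 0.
have gt z : cm z < 1 -> cm (g z) <= t.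
  by move=> z1; rewrite cmM cm_real gtr0_norm// ler_piMr ?(ltW t0)//; exact: f1.
have ghol z : cm z < 1 -> chol g z by move=> z1; apply: cholM (chol_cst _ _) _; exact: hol.
have z01 : cm (0 : C) < 1 by rewrite cm0.
have at1 : cm a <= t by exact: gt.
have a21 : 0 < 1 - cm a ^+ 2.
  by rewrite subr_gt0; have := cm_ge0 a; nra.
have den z : cm z < 1 -> 1 - a^*%C * g z != 0.
  move=> /gt gz; rewrite subr_eq0; apply/eqP => E.
  have := cmM a^*%C (g z); rewrite -E cm1 cmJ; have := cm_ge0 a; have := cm_ge0 (g z).
  nra.
pose k z := (g z - a) / (1 - a^*%C * g z).
have khol z : cm z < 1 -> chol k z.
  move=> z1; apply: cholM; first by apply: cholB (chol_cst _ _); exact: ghol.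
  apply: cholV; first exact: den.
  by apply: cholB (chol_cst _ _) _; apply: cholM (chol_cst _ _) _; exact: ghol.
have k1 z : cm z < 1 -> cm (k z) <= 1.
  move=> z1; rewrite cmM cmV ler_pdivrMr ?cm_gt0 ?den// mul1r.
  rewrite -(ler_pXn2r (n := 2)) ?nnegrE ?cm_ge0// -subr_ge0.
  rewrite cmB_disc_automorphism; apply: mulr_ge0; first exact: ltW.
  have := gt _ z1; have := cm_ge0 (g z); nra.
have k0 : k 0 = 0 by rewrite /k subrr mul0r.
have [_ q1 _] := schwarz khol k1 k0.
have := q1 0 z01; rewrite /dquot eqxx.
have Dg : cderiv g 0 ((t%:C)%C * cD f 0).
  by apply: cderiv_eq (cderivM (cderiv_cst _ _) (cDP (hol _ z01))) _; rewrite mul0r add0r.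
have -> : cD k 0 = (t%:C)%C * cD f 0 / (((1 - cm a ^+ 2)%:C)%C).
  have D1 := cderivB (cderiv_cst 1 0) (cderivM (cderiv_cst (a^*%C) 0) Dg).
  have D2 := cderivV (f := fun z => 1 - a^*%C * g z) (den _ z01) D1.
  apply: cD_eq; apply: cderiv_eq (cderivM (cderivB Dg (cderiv_cst a 0)) D2) _.
  by rewrite -/a subrr mul0r addr0 subr0 rmorphB /= mulrJ_cm.
have -> : t ^+ 2 * cm (f 0) ^+ 2 = cm a ^+ 2.
  by rewrite /a /g cmM cm_real (gtr0_norm t0) exprMn.
move: (1 - cm a ^+ 2) a21 => A A0.
by rewrite !cmM cmV !cm_real (gtr0_norm t0) (gtr0_norm A0) ler_pdivrMr// mul1r.
Qed.

(** Carries identities obtained by dividing by [z] over to the origin. *)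
Lemma chol_eq0 f g d : 0 < d -> (forall z, z != 0 -> cm z < d -> f z = g z) ->
  chol f 0 -> chol g 0 -> f 0 = g 0.
Proof.
move=> d0 fg hf hg; apply/eqP; rewrite -subr_eq0 -cm_eq0 eq_le cm_ge0 andbT.
apply/ler_addgt0Pr => e e0; rewrite add0r.
have [d1 d10 H] := chol_continuous (cholB hf hg) e0.
pose x : C := ((Num.min d d1 / 2)%:C)%C.
have m0 : 0 < Num.min d d1 by rewrite lt_min d0.
have cx : cm x = Num.min d d1 / 2 by rewrite cm_real ger0_norm// divr_ge0// ltW.
have md : Num.min d d1 <= d by rewrite ge_min lexx.
have md1 : Num.min d d1 <= d1 by rewrite ge_min lexx orbT.
have := H x; rewrite add0r fg.
- by rewrite subrr sub0r cmN; apply; rewrite cx; lra.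
- by rewrite -cm_eq0 cx gt_eqF// divr_gt0.
- by rewrite cx; lra.
Qed.

(* Factoring omega = z psi and Phi = 1 + w Phi1(w) turns Phi (omega z) = 1 + z gamma'/gamma
   into psi(z) Phi1(z psi(z)) gamma(z) = gamma'(z), so one differentiation suffices. *)
Lemma subordination_coefficients (Phi h gam : C -> C) :
  (forall z, cm z < 1 -> chol Phi z) -> Phi 0 = 1 ->
  (forall z, cm z < 1 -> chol h (Phi z)) -> (forall z, cm z < 1 -> h (Phi z) = z) ->
  (forall z, cm z < 1 -> chol gam z) -> gam 0 = 1 ->
  (forall z, cm z < 1 -> gam z != 0) ->
  (forall z, cm z < 1 -> exists2 w, cm w < 1 & 1 + z * cD gam z / gam z = Phi w) ->
  exists c1 c2, [/\ cm c1 <= 1, cm c2 <= 1 - cm c1 ^+ 2,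
    cD gam 0 = cD Phi 0 * c1 &
    cD (cD gam) 0 = cD Phi 0 * c2 + (cD (cD Phi) 0 / 2 + cD Phi 0 ^+ 2) * c1 ^+ 2].
Proof.
move=> Phol Phi0 hhol hP ghol gam0 gamN0 sub.
have z01 : cm (0 : C) < 1 by rewrite cm0.
have ghol' z : cm (z - 0) < 1 -> chol gam z by rewrite subr0; exact: ghol.
have gDhol z : cm z < 1 -> chol (cD gam) z.
  by move=> z1; apply: (chol_cD (p := 0) ltr01 ghol'); rewrite subr0.
(* The points [w] from [sub] come without regularity in [z]; expressing them through the inverse [h]
   of [Phi] makes them holomorphic. *)
pose om z := h (1 + z * cD gam z / gam z).
have omhol z : cm z < 1 -> chol om z.
  move=> z1; apply: (chol_comp (g := h)); last first.
    by have [w w1 ->] := sub _ z1; exact: hhol.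
  apply: cholD (chol_cst _ _) _; apply: cholM; last by apply: cholV; [exact: gamN0|exact: ghol].
  by apply: cholM (chol_id _) _; exact: gDhol.
have om1 z : cm z < 1 -> cm (om z) <= 1.
  by move=> z1; rewrite /om; have [w w1 ->] := sub _ z1; rewrite hP// ltW.
have om0 : om 0 = 0 by rewrite /om !mul0r addr0 -Phi0 hP.
have [psihol psi1 omE] := schwarz omhol om1 om0.
set psi := dquot om (cD om 0) in psihol psi1 omE.
have psipick := schwarz_pick0 psihol psi1.
clearbody psi.
have om_lt1 z : cm z < 1 -> cm (z * psi z) < 1.
  by move=> z1; rewrite -omE /om; have [w w1 ->] := sub _ z1; rewrite hP.
have half0 : 0 < 1 / 2 :> R by lra.
have Phol2 z : cm z <= 1 / 2 -> chol Phi z by move=> z1; apply: Phol; lra.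
have PhiD : cderiv Phi 0 (cD Phi 0) by apply: cDP; exact: Phol.
have P1hol z : cm z < 1 -> chol (dquot Phi (cD Phi 0)) z.
  move=> z1; have r0 : 0 < (1 + cm z) / 2 by have := cm_ge0 z; lra.
  by apply: (dquot_holomorphic r0 _ PhiD); [move=> w wz; apply: Phol; lra|lra].
pose P1 := dquot Phi (cD Phi 0).
have P10 : P1 0 = cD Phi 0 by rewrite /P1 /dquot eqxx.
have [l Hl] := P1hol 0 z01.
have lE : cD (cD Phi) 0 = 2 * l by apply: cD_eq; exact: cderiv_cD0 half0 Phol2 PhiD Hl.
have P1E w : Phi w = 1 + w * P1 w by rewrite -Phi0 -(dquotE Phi).
rewrite -/P1 in P1hol Hl; clearbody P1.
pose H z := psi z * P1 (z * psi z) * gam z.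
have Hhol z : cm z < 1 -> chol H z.
  move=> z1; apply: cholM; last exact: ghol.
  apply: cholM; first exact: psihol.
  apply: (chol_comp (g := P1)); first by apply: cholM (chol_id _) _; exact: psihol.
  by apply: P1hol; exact: om_lt1.
have HE z : z != 0 -> cm z < 1 -> cD gam z = H z.
  move=> z0 z1.
  have E : Phi (z * psi z) = 1 + z * cD gam z / gam z.
    by rewrite -omE /om; have [w w1 ->] := sub _ z1; rewrite hP.
  have E' : psi z * P1 (z * psi z) = cD gam z / gam z.
    by apply: (mulfI z0); apply: (addrI 1); rewrite mulrA -P1E E mulrA.
  have gz0 := gamN0 _ z1.
  by rewrite /H E' divfK; [reflexivity|exact: gz0].
have H0 : cD gam 0 = H 0 by apply: (chol_eq0 ltr01 HE); [exact: gDhol|exact: Hhol].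
have HE' z : cm z < 1 -> cD gam z = H z.
  by have [->//|z0] := eqVneq z 0; exact: HE.
have gam1 : cD gam 0 = cD Phi 0 * psi 0.
  by rewrite H0 /H mul0r P10 gam0 mulr1 mulrC.
exists (psi 0), (cD psi 0); split; [exact: psi1|exact: psipick|exact: gam1|].
have DH : cderiv H 0 ((cD psi 0 * P1 (0 * psi 0) +
    psi 0 * (l * (1 * psi 0 + 0 * cD psi 0))) * gam 0 +
    psi 0 * P1 (0 * psi 0) * cD gam 0).
  apply: cderivM; last by apply: cDP; exact: ghol.
  apply: cderivM; first by apply: cDP; exact: psihol.
  apply: (cderiv_comp (g := P1)); last by rewrite mul0r.
  by apply: cderivM (cderiv_id _) _; apply: cDP; exact: psihol.
apply: cD_eq; apply: cderiv_near ltr01 _ (cderiv_eq DH _).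
  by move=> w; rewrite subr0 => w1; rewrite HE'.
rewrite mul0r P10 gam0 gam1 lE.
move: (cD psi 0) (psi 0) (cD Phi 0) => x y b.
by field.
Qed.

End schwarz.

(** * Fréchet differentials and the map z g(z) *)

Lemma ler_mx_norm (K : numDomainType) m n (v : 'M[K]_(m, n)) i j :
  `|v i j| <= mx_norm v.
Proof.
rewrite mx_normE -[leLHS]nngE num_le.
exact: (le_bigmax _ (fun k : 'I_m * 'I_n => `|v k.1 k.2|%:nng) (i, j)).
Qed.

Section differential_lemmas.
Variables (K : numFieldType) (V W : normedModType K).
Implicit Types (f g : V -> W) (x u h : V).

Lemma is_diff_from_eps f x (df : {linear V -> W}) : continuous df ->
  (forall e : K, 0 < e -> exists2 d : K, 0 < d & forall h, `|h| < d ->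
    `|f (x + h) - f x - df h| <= e * `|h|) -> is_diff x f df.
Proof.
move=> dfc H.
have E : f \o shift x = cst (f x) + df +o_ 0 id.
  apply/eqaddoP => e e0; have [d d0 Hd] := H e e0.
  apply/nbhs_ballP; exists d => //= h.
  rewrite -ball_normE /= sub0r normrN => /Hd.
  by rewrite !fctE /cst /= opprD addrA [x + h]addrC.
have dE := diff_unique dfc E.
apply: DiffDef => //; apply/diff_locallyP; split; first by rewrite dE.
by rewrite dE.
Qed.

Lemma is_diff_eps f x : differentiable f x ->
  forall e : K, 0 < e -> exists2 d : K, 0 < d & forall h, `|h| < d ->
    `|f (x + h) - f x - 'd f x h| <= e * `|h|.
Proof.
move=> /diff_locally/eqaddoP H e e0.
have /nbhs_ballP[d /= d0 Hd] := H e e0; exists d => // h hd.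
have := Hd h; rewrite -ball_normE /= sub0r normrN => /(_ hd).
by rewrite !fctE /cst /= opprD addrA [x + h]addrC.
Qed.

Lemma is_diff_near f g x (df : V -> W) (d : K) : 0 < d ->
  (forall h, `|h| < d -> f (x + h) = g (x + h)) -> is_diff x f df -> is_diff x g df.
Proof.
move=> d0 fg [dfx <-]; apply: is_diff_from_eps; first exact: diff_continuous.
move=> e e0.
have [d' d'0 Hd'] := is_diff_eps dfx e0.
(* The order of [K] is partial: the minimum behaves as expected because positive elements are real,
   hence comparable. *)
have r1 : d \is Num.real by exact: gtr0_real.
have r2 : d' \is Num.real by exact: gtr0_real.
exists (Num.min d d').
  by rewrite comparable_lt_min ?d0 ?d'0//; exact: real_comparable.
move=> h; rewrite comparable_lt_min; last exact: real_comparable.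
move=> /andP[h1 h2].
have := fg 0; rewrite normr0 addr0 => <-//.
by rewrite -fg//; exact: Hd'.
Qed.

Lemma is_diff0_quadratic f x (c d : K) : 0 < d -> 0 < c ->
  (forall h, `|h| < d -> `|f (x + h) - f x| <= c * `|h| ^+ 2) -> is_diff x f 0.
Proof.
move=> d0 c0 H; apply: (is_diff_from_eps (df := \0)); first exact: cst_continuous.
move=> e e0.
have r1 : d \is Num.real by exact: gtr0_real.
have r2 : e / c \is Num.real by apply: gtr0_real; rewrite divr_gt0.
exists (Num.min d (e / c)).
  by rewrite comparable_lt_min ?d0 ?divr_gt0//; exact: real_comparable.
move=> h; rewrite comparable_lt_min; last exact: real_comparable.
move=> /andP[h1]; rewrite ltr_pdivlMr// => h2.
rewrite subr0; apply: le_trans (H _ h1) _.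
by rewrite expr2 mulrA ler_wpM2r// mulrC ltW.
Qed.

Lemma is_derive_line f x u (t : K) : differentiable f (x + t *: u) ->
  is_derive t 1 (fun s : K => f (x + s *: u)) ('d f (x + t *: u) u).
Proof.
move=> df.
have dl : is_diff t (fun s : K => x + s *: u) ( *:%R^~ u).
  by rewrite -[X in is_diff _ _ X]add0r; apply: is_diffD.
have dfl : is_diff t (f \o (fun s : K => x + s *: u)) ('d f (x + t *: u) \o ( *:%R^~ u)).
  by apply: is_diff_comp; apply: DiffDef.
have ex : differentiable (f \o (fun s : K => x + s *: u)) t by case: dfl.
apply: DeriveDef; first by apply/derivable1_diffP.
by rewrite deriveE// (diff_val (is_diff_def := dfl)) /= scale1r.
Qed.

End differential_lemmas.

Lemma diff_scale (K : numFieldType) (V : normedModType K) (g : V -> K) y (a : K) (u : V) :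
  'd g y (a *: u) = a * 'd g y u.
Proof. by rewrite linearZ. Qed.

Lemma diff_coordE (K : numFieldType) n (g : 'rV[K]_n -> K) y (u : 'rV[K]_n) :
  'd g y u = \sum_j u 0 j * 'd g y (delta_mx 0 j : 'rV[K]_n).
Proof.
rewrite {1}(row_sum_delta u) linear_sum; apply: eq_bigr => j _.
exact: diff_scale.
Qed.

Section scaled_identity.
Variables (K : numFieldType) (V : normedModType K).
Implicit Types (g : V -> K) (z v : V).

(** The product is split as [(g x - g z) *: (x - z)] plus two terms with one constant factor. The
    first is [o(x - z)] by continuity of [g], so its differential is 0. *)
Lemma is_diff_scaled_id g z : differentiable g z ->
  is_diff z (fun x => g x *: x) (fun v => 'd g z v *: z + g z *: v).
Proof.
move=> dg.
have d0 : is_diff z (fun x => (g x - g z) *: (x - z)) 0.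
  apply: (is_diff_from_eps (df := \0)); first exact: cst_continuous.
  move=> e e0; have := differentiable_continuous dg.
  move=> /cvgrPdist_le/(_ e e0); rewrite near_simpl => /nbhs_ballP[d /= d0 Hd].
  exists d => // h hd; rewrite subrr scale0r !subr0 [z + h]addrC addrK normrZ.
  apply: ler_wpM2r => //; rewrite distrC; apply: Hd.
  by rewrite -ball_normE /= opprD addrCA subrr addr0 normrN.
have d1 : is_diff z (fun x => g x *: z) (fun v => 'd g z v *: z).
  by apply: DiffDef; [exact: differentiableZl|rewrite diffZl].
have d2 : is_diff z (fun x => g z *: (x - z)) (fun v => g z *: v).
  have -> : (fun v => g z *: v) = g z *: (id - 0 : V -> V).
    by apply/funext => v; change (g z *: v = g z *: (v - 0)); rewrite subr0.
  exact: is_diffZ.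
have -> : (fun x => g x *: x) = (fun x => (g x - g z) *: (x - z)) +
    ((fun x => g x *: z) + (fun x => g z *: (x - z))).
  apply/funext => x; rewrite !fctE !scalerBl !scalerBr opprB.
  move: (g x *: x) (g x *: z) (g z *: x) (g z *: z) => a b c d.
  by rewrite -(addrA (a - b)) (addrCA (d - c)) -(opprB d c) subrr addr0 subrK.
apply: is_diff_eq (is_diffD _ _) _.
by rewrite add0r.
Qed.

End scaled_identity.

Section rows.
Variables (K : numFieldType) (n : nat).
Local Notation V := 'rV[K]_n.
Implicit Types (g : V -> K) (z v : V).

Lemma mul_jacobian (G : V -> V) z v : v *m 'J G z = 'd G z v.
Proof. by rewrite /jacobian mul_rV_lin1. Qed.

Lemma is_diff_coord_comp (f : K -> K) (j : 'I_n) z (a : K) :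
  is_derive (z 0 j) 1 f a -> is_diff z (fun y : V => f (y 0 j)) (fun v => a * v 0 j).
Proof.
move=> [df av].
have df' : differentiable f (z 0 j) by apply/derivable1_diffP.
have dc : is_diff z (fun y : V => y 0 j : K) (fun v => v 0 j).
  have @L : {linear V -> K}.
    by exists (fun N : V => N 0 j); do 2![eexists]; do ?[constructor];
       rewrite ?mxE// => ? *; rewrite ?mxE//; move=> ?; rewrite !mxE.
  rewrite (_ : (fun y : V => y 0 j : K) = L)//.
  apply: DiffDef; first exact/linear_differentiable/coord_continuous.
  by rewrite diff_lin//; exact: coord_continuous.
have -> : (fun v : V => a * v 0 j) = 'd f (z 0 j) \o (fun v : V => v 0 j).
  apply/funext => v /=; rewrite -[X in 'd f _ X]mulr1.
  by rewrite [RHS]linearZ -deriveE// av mulrC.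
exact: (is_diff_comp (f := fun y : V => y 0 j : K)).
Qed.

End rows.

Section scaled_identity_higher.
Variables (K : numFieldType) (V : normedModType K) (g : V -> K) (z : V).
Let A (y : V) : K := 'd g y z.
Let A2 (y : V) : K := 'd A y z.
Hypothesis holg : forall y : V, `|y| < 1 -> differentiable g y.
Hypothesis holA : forall y : V, `|y| < 1 -> differentiable A y.
Hypothesis holA2 : forall y : V, `|y| < 1 -> differentiable A2 y.

Lemma near_unit_ball (y h : V) : `|h| < 1 - `|y| -> `|y + h| < 1.
Proof. by rewrite ltrBrDl; apply: le_lt_trans; exact: ler_normD. Qed.

Lemma diff_scaled_id y v : `|y| < 1 ->
  'd (fun x => g x *: x) y v = 'd g y v *: y + g y *: v.
Proof.
move=> /holg/is_diff_scaled_id H.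
exact: (congr1 (fun f => f v) (diff_val (is_diff_def := H))).
Qed.

Lemma diff2_scaled_id y : `|y| < 1 ->
  'd (fun x => 'd (fun x => g x *: x) x z) y z = A2 y *: y + (A y *: z + A y *: z).
Proof.
move=> y1.
have H : is_diff y (fun x => 'd (fun x => g x *: x) x z)
    (fun v => 'd A y v *: y + A y *: v + 'd g y v *: z).
  apply: (is_diff_near (f := (fun x => A x *: x) + (fun x => g x *: z)) (d := 1 - `|y|)).
  - by rewrite subr_gt0.
  - by move=> h /near_unit_ball/diff_scaled_id ->.
  - apply: is_diffD; first by apply: is_diff_scaled_id; exact: holA.
    apply: DiffDef; first by apply: differentiableZl; exact: holg.
    by rewrite diffZl//; exact: holg.
rewrite addrA.
exact: (congr1 (fun f => f z) (diff_val (is_diff_def := H))).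
Qed.

(** The second differential is [A2 y *: y] plus twice [A y *: z]. At the origin the term carrying
    the differential of [A2] is multiplied by [y = 0]; three copies of [A2 0 *: z] remain, and
    division by 3! leaves half of [A2 0]. *)
Lemma diff3_scaled_id :
  'd (fun y => 'd (fun x => 'd (fun x => g x *: x) x z) y z) 0 z =
  A2 0 *: z + (A2 0 *: z + A2 0 *: z).
Proof.
have z1 : `|0 : V| < 1 by rewrite normr0.
pose F (x : V) : V := A2 x *: x + (A x *: z + A x *: z).
pose G (y : V) : V := 'd (fun x => 'd (fun x => g x *: x) x z) y z.
pose dF (v : V) : V := ('d A2 0 v *: 0 + A2 0 *: v) + ('d A 0 v *: z + 'd A 0 v *: z).
have dA : is_diff (0 : V) (fun x => A x *: z) (fun v => 'd A 0 v *: z).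
  apply: DiffDef; first by apply: differentiableZl; exact: holA.
  by rewrite diffZl//; exact: holA.
have HF : is_diff (0 : V) F dF.
  apply: (@is_diffD K V V (fun x => A2 x *: x) ((fun x => A x *: z) + (fun x => A x *: z))).
  by apply: is_diff_scaled_id; exact: holA2.
have d0 : 0 < 1 - `|0 : V| by rewrite subr_gt0.
have FG (h : V) : `|h| < 1 - `|0 : V| -> F (0 + h) = G (0 + h).
  by move=> /near_unit_ball hh; rewrite /G diff2_scaled_id.
have H : is_diff (0 : V) G dF := @is_diff_near K V V F G 0 dF _ d0 FG HF.
have aux (s a b : K) : (s *: 0 + a *: z) + (b *: z + b *: z) = a *: z + (b *: z + b *: z) :> V.
  by rewrite scaler0 add0r.
exact: etrans (congr1 (fun f => f z) (diff_val (is_diff_def := H))) (aux _ _ _).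
Qed.

End scaled_identity_higher.

Lemma sqr_coef_diffE (K : numFieldType) n (g : 'rV[K]_n -> K) (z : 'rV[K]_n) j :
  (forall y : 'rV[K]_n, `|y| < 1 -> differentiable g y) ->
  (forall y : 'rV[K]_n, `|y| < 1 -> differentiable (fun y => 'd g y z : K) y) ->
  (forall y : 'rV[K]_n, `|y| < 1 -> differentiable (fun y => 'd (fun y => 'd g y z : K) y z : K) y) ->
  sqr_coef_diff (scaled_id g) z 0 j =
  z 0 j ^+ 2 * (('d (fun y => 'd g y z : K) 0 z / 2) ^+ 2 - ('d g 0 z) ^+ 2).
Proof.
move=> holg holA holA2.
have z1 : `|0 : 'rV[K]_n| < 1 by rewrite normr0.
have aux (v3 v2 : 'rV[K]_n) (a b : K) : v3 = b *: z + (b *: z + b *: z) ->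
    v2 = b *: 0 + (a *: z + a *: z) ->
    (sqr_vec ((3`!)%:R^-1 *: v3) - sqr_vec ((2`!)%:R^-1 *: v2)) 0 j =
    z 0 j ^+ 2 * ((b / 2) ^+ 2 - a ^+ 2).
  move=> -> ->; rewrite !mxE mulr0 add0r; move: (z 0 j) => c.
  have -> : (3`!)%:R = 6 :> K by [].
  have -> : (2`!)%:R = 2 :> K by [].
  by field.
(* [frechet_deriv_pow] unfolds by computation to the nested differentials in the two lemmas supplied
   here. *)
exact: (aux (frechet_deriv_pow 3 (scaled_id g) 0 z) (frechet_deriv_pow 2 (scaled_id g) 0 z)
  ('d g 0 z) ('d (fun y => 'd g y z : K) 0 z)
  (diff3_scaled_id holg holA holA2) (diff2_scaled_id holg holA z1)).
Qed.

Lemma diff2_scale (K : numFieldType) (V : normedModType K) (g : V -> K) y (a : K) (u : V) :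
  differentiable (fun y => 'd g y u : K) y ->
  'd (fun y => 'd g y (a *: u) : K) y (a *: u) = a ^+ 2 * 'd (fun y => 'd g y u : K) y u.
Proof.
move=> dg.
have -> : (fun y => 'd g y (a *: u) : K) = a *: (fun y => 'd g y u : K).
  by apply/funext => x; rewrite diff_scale.
rewrite diffZ//; change (a * 'd (fun y => 'd g y u : K) y (a *: u) = a ^+ 2 * 'd (fun y => 'd g y u : K) y u).
by rewrite diff_scale mulrA -expr2.
Qed.

(** * Directional derivatives in several variables *)

Section locally_uniform_limits.
Variable R : realType.
Local Notation C := (R[i]).
Implicit Types (f g : C -> C) (s : nat -> C) (p z a b u v w l : C) (N m n : nat) (e B r M d : R).

(** The remainder is a second divided difference times [z ^+ 2]; each of the two divisions costs
    [2 / r] by [dquot_bound]. *)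
Lemma taylor2 f r B : 0 < r -> (forall z, cm z <= r -> chol f z) ->
  (forall z, cm z <= r -> cm (f z) <= B) ->
  forall z, cm z <= r -> cm (f z - f 0 - cD f 0 * z) <= 4 * B / r ^+ 2 * cm z ^+ 2.
Proof.
move=> r0 hol fB z zr.
have f0 : cderiv f 0 (cD f 0) by apply: cDP; apply: hol; rewrite cm0 ltW.
have qhol := dquot_holomorphic r0 hol f0.
have qB := dquot_bound r0 hol f0 fB.
have z0r : cm (0 : C) <= r by rewrite cm0 ltW.
have q0 := cDP (qhol 0 z0r).
have tB := dquot_bound r0 qhol q0 qB zr.
have E : f z - f 0 - cD f 0 * z = dquot (dquot f (cD f 0)) (cD (dquot f (cD f 0)) 0) z * z ^+ 2.
  rewrite {1}(dquotE f (cD f 0) z) (dquotE (dquot f (cD f 0)) (cD (dquot f (cD f 0)) 0) z).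
  rewrite {1}/dquot eqxx; ring.
rewrite E cmM cmX ler_wpM2r ?sqr_ge0//; apply: le_trans tB _.
by rewrite le_eqVlt; apply/orP; left; apply/eqP; field; rewrite gt_eqF.
Qed.

Definition ccvg s l := forall e, 0 < e -> exists N, forall n, (N <= n)%N -> cm (s n - l) <= e.

Lemma ccvg_unique s a b : ccvg s a -> ccvg s b -> a = b.
Proof.
move=> sa sb; apply/eqP; rewrite -subr_eq0 -cm_eq0 eq_le cm_ge0 andbT.
apply/ler_addgt0Pr => e e0; rewrite add0r.
have e20 : 0 < e / 2 by rewrite divr_gt0.
have [N1 H1] := sa _ e20; have [N2 H2] := sb _ e20.
have h1 := H1 (N1 + N2)%N (leq_addr _ _); have h2 := H2 (N1 + N2)%N (leq_addl _ _).
have -> : a - b = (s (N1 + N2)%N - b) - (s (N1 + N2)%N - a) by ring.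
by apply: le_trans (cmB _ _) _; lra.
Qed.

Lemma ccvgD s t a b : ccvg s a -> ccvg t b -> ccvg (fun n => s n + t n) (a + b).
Proof.
move=> sa tb e e0.
have e20 : 0 < e / 2 by rewrite divr_gt0.
have [N1 H1] := sa _ e20; have [N2 H2] := tb _ e20.
exists (N1 + N2)%N => n Nn.
have h1 := H1 n (leq_trans (leq_addr _ _) Nn); have h2 := H2 n (leq_trans (leq_addl _ _) Nn).
have -> : s n + t n - (a + b) = (s n - a) + (t n - b) by ring.
by apply: le_trans (cmD _ _) _; lra.
Qed.

Lemma ccvgZ s a b : ccvg s a -> ccvg (fun n => b * s n) (b * a).
Proof.
move=> sa e e0.
have b1 : 0 < cm b + 1 by rewrite ltr_wpDl ?cm_ge0.
have [N H] := sa (e / (cm b + 1)) (divr_gt0 e0 b1); exists N => n /H.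
rewrite ler_pdivlMr// -mulrBr cmM; have := cm_ge0 (s n - a); nra.
Qed.

Lemma ccvg_cst a : ccvg (fun=> a) a.
Proof. by move=> e e0; exists 0%N => n _; rewrite subrr cm0 ltW. Qed.

Lemma ccvg_sum I (q : seq I) (s : I -> nat -> C) (l : I -> C) :
  (forall j, ccvg (s j) (l j)) ->
  ccvg (fun n => \sum_(j <- q) s j n) (\sum_(j <- q) l j).
Proof.
move=> sl; elim: q => [|j q IH].
  by rewrite big_nil; have := ccvg_cst 0; congr ccvg; apply/funext => n; rewrite big_nil.
rewrite big_cons; have := ccvgD (sl j) IH.
by congr ccvg; apply/funext => n; rewrite big_cons.
Qed.

Lemma ccvg_le s a B : ccvg s a -> (forall n, cm (s n) <= B) -> cm a <= B.
Proof.
move=> sa sB; apply/ler_addgt0Pr => e e0; have [N H] := sa _ e0.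
have -> : a = s N - (s N - a) by ring.
apply: le_trans (cmB _ _) _; have := sB N; have := H N (leqnn N); lra.
Qed.

(* Cauchy estimates make the derivatives at 0 a Cauchy sequence, and the
   quadratic Taylor bound survives the limit. *)
Lemma uniform_limit_cderiv (F : nat -> C -> C) f r B : 0 < r ->
  (forall n z, cm z <= r -> chol (F n) z) ->
  (forall n z, cm z <= r -> cm (F n z) <= B) ->
  (forall e, 0 < e -> exists N, forall n, (N <= n)%N ->
    forall z, cm z <= r -> cm (F n z - f z) <= e) ->
  exists2 a, ccvg (fun n => cD (F n) 0) a &
    forall z, cm z <= r -> cm (f z - f 0 - a * z) <= 4 * B / r ^+ 2 * cm z ^+ 2.
Proof.
move=> r0 hol FB unif.
have z0r : cm (0 : C) <= r by rewrite cm0 ltW.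
have [|a Ha] := @complex_cauchy_cvg R (fun n => cD (F n) 0).
  move=> e e0; have e40 : 0 < e * r / 4 by rewrite divr_gt0 ?mulr_gt0.
  have [N HN] := unif _ e40; exists N => n Nn.
  have -> : e = 2 * (e * r / 4 + e * r / 4) / r by field; rewrite gt_eqF.
  apply: (cauchy_estimate (f := fun z => F n z - F N z) r0).
  - by move=> z zr; apply: cholB; exact: hol.
  - by apply: cderivB; apply: cDP; exact: hol.
  - move=> z zr; have -> : F n z - F N z = (F n z - f z) - (F N z - f z) by ring.
    by apply: le_trans (cmB _ _) _; apply: lerD; apply: HN.
exists a => // z zr.
apply: (ccvg_le (s := fun n => F n z - F n 0 - cD (F n) 0 * z)).
  have ev w : cm w <= r -> ccvg (fun n => F n w) (f w).
    by move=> wr e e0; have [N HN] := unif _ e0; exists N => n /HN; exact.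
  have h := ccvgD (ccvgD (ev z zr) (ccvgZ (-1) (ev 0 z0r))) (ccvgZ (- z) Ha).
  have -> : f z - f 0 - a * z = f z + -1 * f 0 + - z * a by ring.
  by move: h; congr ccvg; apply/funext => n; ring.
by move=> n; apply: taylor2 zr; [exact: r0|exact: hol|exact: FB].
Qed.

End locally_uniform_limits.

Section several_variables.
Variables (R : realType) (n : nat).
Local Notation C := (R[i]).
Local Notation K := (R[i] : numFieldType).
Local Notation V := ('rV[K]_n).
Implicit Types (g : V -> K) (v w x u h : V) (e B r M d : R).

Definition nv v : R := complex.Re `|v|.

Lemma normr_nv v : `|v| = ((nv v)%:C)%C.
Proof. by rewrite /nv RRe_real// normr_real. Qed.

Lemma nv_ge0 v : 0 <= nv v.
Proof. by rewrite -ler0c -normr_nv. Qed.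

Lemma nvZ (a : C) v : nv (a *: v) = cm a * nv v.
Proof.
apply: complexI; rewrite rmorphM /= -!normr_nv.
exact: normrZ.
Qed.

Lemma nvD v w : nv (v + w) <= nv v + nv w.
Proof. by rewrite -lecR rmorphD /= -!normr_nv; exact: ler_normD. Qed.

Lemma nv0 : nv 0 = 0.
Proof. by rewrite /nv normr0. Qed.

Lemma nv_eq0 v : (nv v == 0) = (v == 0).
Proof. by rewrite -(normr_eq0 v) normr_nv; apply/eqP/eqP => [->//|/complexI]. Qed.

Lemma cm_coord v j : cm (v 0 j) <= nv v.
Proof.
by rewrite -lecR -normr_nv -normr_cm; exact: (@ler_mx_norm K 1 n v 0 j).
Qed.

Lemma nv_le v B : 0 <= B -> (forall j, cm (v 0 j) <= B) -> nv v <= B.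
Proof.
move=> B0 vB; have [->|v0] := eqVneq (nv v) 0; first exact: B0.
have v0' : mx_norm v != 0.
  by have := v0; rewrite nv_eq0; apply: contra => /eqP/mx_norm_eq0->.
have [[i j] /= E] := mx_norm_neq0 v0'.
have -> : nv v = cm (v 0 j) by apply: complexI => /=; rewrite -normr_nv -(ord1 i) -normr_cm; exact: E.
exact: vB.
Qed.

Lemma unit_polydiscP v : unit_polydisc v <-> nv v < 1.
Proof.
split=> [vp|v1 j]; last by rewrite normr_cm ltcR; apply: le_lt_trans (cm_coord _ _) v1.
have [->|v0] := eqVneq (nv v) 0; first exact: ltr01.
have v0' : mx_norm v != 0.
  by have := v0; rewrite nv_eq0; apply: contra => /eqP/mx_norm_eq0->.
have [[i j] /= E] := mx_norm_neq0 v0'.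
have -> : nv v = cm (v 0 j) by apply: complexI => /=; rewrite -normr_nv -(ord1 i) -normr_cm; exact: E.
by rewrite -ltcR -normr_cm; exact: vp.
Qed.

Lemma nv_delta j : nv (delta_mx 0 j) <= 1.
Proof.
apply: nv_le => // k; rewrite mxE eqxx /=.
by rewrite cmn lern1 leq_b1.
Qed.

Lemma cderiv_line g x u (t : C) : differentiable g (x + t *: u) ->
  cderiv (fun s : C => g (x + s *: u)) t ('d g (x + t *: u) u).
Proof. exact: is_derive_line. Qed.

Lemma locally_bounded g w : differentiable g w ->
  exists2 r : R, 0 < r & exists2 B : R, 0 < B & forall h, nv h <= r -> cm (g (w + h)) <= B.
Proof.
move=> /differentiable_continuous/cvgrPdist_le/(_ 1 ltr01).
rewrite near_simpl => /nbhs_ballP[d /= d0 Hd].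
have dE : d = ((complex.Re d)%:C)%C by rewrite RRe_real// gtr0_real.
have d0' : 0 < complex.Re d by rewrite -ltcR -dE.
exists (complex.Re d / 2); first by rewrite divr_gt0.
exists (cm (g w) + 1); first by rewrite ltr_wpDl ?cm_ge0.
move=> h hd; have : `|g w - g (w + h)| <= 1.
  apply: Hd; rewrite -ball_normE /= opprD addrA subrr sub0r normrN.
  by rewrite normr_nv dE ltcR; lra.
have -> : (1 : K) = ((1 : R)%:C)%C by [].
rewrite normr_cm lecR => le1.
have -> : g (w + h) = g w - (g w - g (w + h)) by rewrite opprB [RHS]addrC subrK.
by apply: le_trans (cmB _ _) _; rewrite lerD2l.
Qed.

End several_variables.

Section directional_derivative.
Variables (R : realType) (n : nat).
Local Notation C := (R[i]).
Local Notation K := (R[i] : numFieldType).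
Local Notation V := ('rV[K]_n).
Implicit Types (g : V -> K) (v w x u h : V) (e B r M d : R).

Lemma differentiable_linear_form (c : 'I_n -> K) w :
  differentiable (fun x : V => \sum_j x 0 j * c j : K) w.
Proof.
have -> : (fun x : V => \sum_j x 0 j * c j : K) =
    \sum_(j < n) (fun x : V => x 0 j * c j : K).
  by apply/funext => x; rewrite fct_sumE.
apply: differentiable_sum => j.
have -> : (fun x : V => x 0 j * c j : K) = (fun x : V => x 0 j : K) * cst (c j).
  by apply/funext.
by apply: differentiableM; [exact: differentiable_coord|exact: differentiable_cst].
Qed.

(* The difference quotients (g (x + t v) - g x) / t are holomorphic and converge
   locally uniformly to x |-> 'd g x v. *)
Theorem differentiable_directional g v w r : 0 < r ->
  (forall h, nv h < r -> differentiable g (w + h)) ->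
  differentiable (fun x => 'd g x v : K) w.
Proof.
move=> r0 hol.
have gw : differentiable g w by rewrite -[w]addr0; apply: hol; rewrite nv0.
have [r1 r10 [B B0 gB]] := locally_bounded gw.
(* Estimates are made within [2 * rho] of [w], and the increments [t k *: v] add up to [rho]; the
   quarter keeps [3 * rho] strictly inside. *)
pose rho : R := Num.min r1 r / 4.
have rm0 : 0 < Num.min r1 r by rewrite lt_min r10.
have rho0 : 0 < rho by rewrite divr_gt0.
have rhor : 4 * rho <= r1.
  have : Num.min r1 r <= r1 by rewrite ge_min lexx.
  by rewrite /rho; lra.
have rhor' : 4 * rho <= r.
  have : Num.min r1 r <= r by rewrite ge_min lexx orbT.
  by rewrite /rho; lra.
have hol' h : nv h <= 3 * rho -> differentiable g (w + h) by move=> hh; apply: hol; lra.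
have gB' h : nv h <= 3 * rho -> cm (g (w + h)) <= B by move=> hh; apply: gB; lra.
clearbody rho.
pose m := nv v + 1.
have m0 : 0 < m by rewrite ltr_wpDl ?nv_ge0.
(* Parameters up to [sg] move a point by at most [rho] in direction [v]; the [+ 1] in [m] covers
   [v = 0]. *)
pose sg : R := rho / m.
have sg0 : 0 < sg by rewrite divr_gt0.
have smallv (z : C) : cm z <= sg -> nv (z *: v) <= rho.
  move=> zs; rewrite nvZ; have := nv_ge0 v; have := cm_ge0 z.
  by rewrite ler_pdivlMr// /m in zs; nra.
pose t (k : nat) : C := ((sg / k.+1%:R)%:C)%C.
have ct k : cm (t k) = sg / k.+1%:R by rewrite cm_real ger0_norm// divr_ge0// ltW.
have tsg k : cm (t k) <= sg.
  by rewrite ct ler_pdivrMr// ler_peMr ?(ltW sg0)// ler1n.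
have t0 k : t k != 0 by rewrite -cm_eq0 ct gt_eqF// divr_gt0.
pose Q k x : C := (g (x + t k *: v) - g x) / t k.
pose F x : C := 'd g x v.
have sum_small h1 h2 : nv h1 <= 2 * rho -> nv h2 <= rho -> nv (h1 + h2) <= 3 * rho.
  by move=> h1r h2r; apply: le_trans (nvD _ _) _; lra.
have lineh h : nv h <= 2 * rho ->
    (forall z : C, cm z <= sg -> chol (fun s : C => g (w + h + s *: v)) z) /\
    cderiv (fun s : C => g (w + h + s *: v)) 0 (F (w + h)).
  move=> hh; split=> [z zs|].
    exists ('d g (w + h + z *: v) v); apply: cderiv_line.
    by rewrite -addrA; apply: hol'; apply: sum_small => //; exact: smallv.
  have -> : F (w + h) = 'd g (w + h + 0 *: v) v by rewrite scale0r addr0.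
  by apply: cderiv_line; rewrite scale0r addr0; apply: hol'; lra.
have lineB h : nv h <= 2 * rho ->
    forall z : C, cm z <= sg -> cm (g (w + h + z *: v)) <= B.
  by move=> hh z zs; rewrite -addrA; apply: gB'; apply: sum_small => //; exact: smallv.
have QF k h : nv h <= 2 * rho -> cm (Q k (w + h) - F (w + h)) <= 4 * B / sg / k.+1%:R.
  move=> hh; have [l1 l2] := lineh _ hh.
  have := taylor2 sg0 l1 (lineB _ hh) (tsg k).
  rewrite (cD_eq l2) scale0r addr0 => H.
  have -> : Q k (w + h) - F (w + h) =
      (g (w + h + t k *: v) - g (w + h) - F (w + h) * t k) / t k.
    by rewrite /Q [RHS]mulrBl mulfK ?t0.
  rewrite cmM cmV ler_pdivrMr ?cm_gt0 ?t0//; apply: le_trans H _.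
  have k0 : k.+1%:R != 0 :> R by rewrite pnatr_eq0.
  rewrite ct; move: (k.+1%:R) k0 => N N0.
  rewrite le_eqVlt; apply/orP; left; apply/eqP; field.
  by rewrite N0 gt_eqF.
have FB h : nv h <= 2 * rho -> cm (F (w + h)) <= 2 * B / sg.
  move=> hh; have [l1 l2] := lineh _ hh.
  exact: cauchy_estimate sg0 l1 l2 (lineB _ hh).
have QB k h : nv h <= 2 * rho -> cm (Q k (w + h)) <= 6 * B / sg.
  move=> hh; have -> : Q k (w + h) = (Q k (w + h) - F (w + h)) + F (w + h) by rewrite subrK.
  apply: le_trans (cmD _ _) _.
  have le1 : 4 * B / sg / k.+1%:R <= 4 * B / sg.
    have P0 : 0 <= 4 * B / sg by apply: divr_ge0; lra.
    rewrite ler_pdivrMr ?ltr0Sn//; apply: ler_peMr P0 _.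
    by rewrite ler1n.
  have := le_trans (QF k _ hh) le1; have := FB _ hh.
  by rewrite -!mulrA; move: (B / sg) => P; lra.
have usmall u (z : C) : nv u <= 1 -> cm z <= rho -> nv (z *: u) <= 2 * rho.
  by move=> u1 zr; rewrite nvZ; have := nv_ge0 u; have := cm_ge0 z; nra.
pose a k u : C := ('d g (w + t k *: v) u - 'd g w u) / t k.
have lineQ k u : nv u <= 1 ->
    (forall z : C, cm z <= rho -> chol (fun s : C => Q k (w + s *: u)) z) /\
    cderiv (fun s : C => Q k (w + s *: u)) 0 (a k u).
  move=> u1.
  have D (z : C) : cm z <= rho -> cderiv (fun s : C => Q k (w + s *: u)) z
      (('d g (w + t k *: v + z *: u) u - 'd g (w + z *: u) u) / t k).
    move=> zr.
    have d1 : cderiv (fun s : C => g (w + s *: u + t k *: v)) z ('d g (w + t k *: v + z *: u) u).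
      have -> : (fun s : C => g (w + s *: u + t k *: v)) =
          (fun s : C => g (w + t k *: v + s *: u)).
        by apply/funext => s; rewrite addrAC.
      apply: cderiv_line; rewrite -addrA; apply: hol'; rewrite addrC.
      by apply: sum_small; [exact: usmall|apply: smallv; exact: tsg].
    have d2 : cderiv (fun s : C => g (w + s *: u)) z ('d g (w + z *: u) u).
      by apply: cderiv_line; apply: hol'; have := usmall _ _ u1 zr; lra.
    apply: cderiv_eq (cderivM (cderivB d1 d2) (cderiv_cst (t k)^-1 z)) _.
    by rewrite mulr0 addr0.
  split=> [z zr|]; first by eexists; exact: D.
  have := D 0; rewrite cm0 !scale0r !addr0; apply; exact: ltW.
have lim u : nv u <= 1 -> exists2 c : C, ccvg (fun k => a k u) c &
    forall z : C, cm z <= rho -> cm (F (w + z *: u) - F w - c * z) <=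
      4 * (6 * B / sg) / rho ^+ 2 * cm z ^+ 2.
  move=> u1.
  have [|||c Hc Hc'] := @uniform_limit_cderiv R (fun k (s : C) => Q k (w + s *: u))
      (fun s : C => F (w + s *: u)) rho (6 * B / sg) rho0.
  - by move=> k z zr; have [+ _] := lineQ k _ u1; apply.
  - by move=> k z zr; apply: QB; exact: usmall.
  - move=> e e0; pose N := Num.bound (4 * B / sg / e).
    have hN : 4 * B / sg / e < N%:R.
      by apply: archi_boundP; apply: divr_ge0; [apply: divr_ge0; lra|lra].
    exists N => k Nk z zr; apply: le_trans (QF _ _ _) _; first exact: usmall.
    rewrite ler_pdivrMr// [e * _]mulrC -ler_pdivrMr//; apply: le_trans (ltW hN) _.
    by rewrite ler_nat; apply: leq_trans Nk _.
  exists c.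
    move: Hc; congr ccvg; apply/funext => k.
    by apply: cD_eq; have [_] := lineQ k _ u1.
  by move=> z zr; have := Hc' z zr; rewrite scale0r addr0.
have /choice[c Hc] : forall j : 'I_n, exists c : C, ccvg (fun k => a k (delta_mx 0 j)) c.
  by move=> j; have [c Hc _] := lim _ (nv_delta R j); exists c.
pose L (x : V) : C := \sum_j x 0 j * c j.
(* Each [a k] is linear in [u], so the limits along the basis vectors determine all others, and the
   candidate differential [L] is linear by construction. *)
have aL u : ccvg (fun k => a k u) (L u).
  have E k : a k u = \sum_j u 0 j * a k (delta_mx 0 j).
    pose d1 j : C := 'd g (w + t k *: v) (delta_mx 0 j : V).
    pose d2 j : C := 'd g w (delta_mx 0 j : V).
    have E1 : 'd g (w + t k *: v) u = \sum_j u 0 j * d1 j :> C.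
      exact: diff_coordE.
    have E2 : 'd g w u = \sum_j u 0 j * d2 j :> C.
      exact: diff_coordE.
    transitivity ((\sum_j u 0 j * d1 j - \sum_j u 0 j * d2 j) / t k).
      have E3 (x1 x2 : C) : 'd g (w + t k *: v) u = x1 -> 'd g w u = x2 ->
          a k u = (x1 - x2) / t k by move=> <- <-.
      exact: E3 E1 E2.
    rewrite -sumrB mulr_suml.
    apply: eq_bigr => j _; rewrite -mulrBr -mulrA.
    reflexivity.
  have := ccvg_sum (index_enum 'I_n) (fun j => ccvgZ (u 0 j) (Hc j)).
  by congr ccvg; apply/funext => k; rewrite E.
pose c2 := 4 * (6 * B / sg) / rho ^+ 2.
have c20 : 0 < c2 by rewrite !(divr_gt0, mulr_gt0, exprn_gt0).
(* The constant in [lim] is the same for all [u] of norm at most 1, so normalising [h] turns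
   directional expansions into a Fréchet expansion. *)
have quad h : nv h <= rho -> cm (F (w + h) - F w - L h) <= c2 * nv h ^+ 2.
  move=> hr; have [->|h0] := eqVneq h 0.
    have L0 : L 0 = 0 by rewrite /L big1// => j _; rewrite mxE mul0r.
    by rewrite addr0 subrr sub0r cmN L0 cm0; apply: mulr_ge0; [exact: ltW|exact: sqr_ge0].
  have nh0 : nv h != 0 by rewrite nv_eq0.
  have nhC : ((nv h)%:C)%C != 0 :> C by rewrite -cm_eq0 cm_real ger0_norm ?nv_ge0.
  pose u := ((nv h)%:C)%C^-1 *: h.
  have hE : h = ((nv h)%:C)%C *: u by rewrite /u scalerA mulfV// scale1r.
  have u1 : nv u <= 1 by rewrite /u nvZ cmV cm_real ger0_norm ?nv_ge0// mulVf.
  have [c' Hc' Hq] := lim _ u1.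
  have c'E : c' = L u := ccvg_unique Hc' (aL u).
  have := Hq ((nv h)%:C)%C; rewrite cm_real ger0_norm ?nv_ge0// -hE => /(_ hr).
  have -> : c' * ((nv h)%:C)%C = L h; last by [].
  rewrite c'E {2}hE /L mulr_suml; apply: eq_bigr => j _; rewrite !mxE.
  by rewrite [LHS]mulrC !mulrA.
have dG := differentiable_linear_form c w.
have d0 : is_diff w (fun x => F x - L x : K) 0.
  apply: (@is_diff0_quadratic _ _ _ _ _ ((c2%:C)%C) ((rho%:C)%C)); rewrite ?ltcR//.
  move=> h; rewrite normr_nv ltcR => /ltW/quad.
  have -> : F (w + h) - L (w + h) - (F w - L w) = F (w + h) - F w - L h.
    have -> : L (w + h) = L w + L h.
      by rewrite /L -big_split; apply: eq_bigr => j _; rewrite mxE mulrDl.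
    have rg (x1 x2 x3 x4 : C) : x1 - (x3 + x4) - (x2 - x3) = x1 - x2 - x4 by ring.
    exact: rg.
  by rewrite -lecR rmorphM rmorphXn.
have -> : (fun x => 'd g x v : K) = (fun x => F x - L x : K) + L.
  apply/funext => x.
  have sk (x1 x2 : C) : x1 = x1 - x2 + x2 by rewrite subrK.
  exact: sk.
by apply: differentiableD; [case: d0|exact: dG].
Qed.

End directional_derivative.

(** * Primitives and the exponential *)

Section primitive.
Variable R : realType.
Local Notation C := (R[i]).
Local Notation i := ('i%C : C).
Implicit Types (f g k : C -> C) (p z a b u v w : C) (N m n : nat) (e B r M d : R).

(** A discrete fundamental theorem. The increment of [f] telescopes over the pieces; on each,
    [taylor2] at the midpoint in both directions with step [1 / (2 N)] leaves an error
    [2 * B / (d ^+ 2 * N ^+ 2)], and there are [N] pieces. *)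
Lemma midpoint_sum_derivative f d B N : 0 < d ->
  (forall z, cm z <= 1 + d -> chol f z) -> (forall z, cm z <= 1 + d -> cm (f z) <= B) ->
  (0 < N)%N -> N%:R^-1 <= d ->
  cm (midpoint_sum (cD f) 0 1 N - (f 1 - f 0)) <= 8 * B / d ^+ 2 / N%:R.
Proof.
move=> d0 hol fB N0 Nd.
have Nr : 0 < N%:R :> R by rewrite ltr0n.
have N0' : N%:R != 0 :> C by rewrite pnatr_eq0 -lt0n.
have B0 : 0 <= B by apply: le_trans (cm_ge0 (f 0)) (fB _ _); rewrite cm0; lra.
pose t (j : nat) : R := (j%:R + 2^-1) / N%:R.
pose x (j : nat) : C := j%:R / N%:R.
pose h : C := ((2^-1 / N%:R : R)%:C)%C.
have ch : cm h = 2^-1 / N%:R by rewrite cm_real ger0_norm// divr_ge0.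
have iN0 : 0 < (N%:R^-1 : R) by rewrite invr_gt0.
have hd : cm h <= d by rewrite ch; lra.
have tE (j : nat) : (((t j)%:C)%C : C) = (j%:R + 2^-1) / N%:R.
  by rewrite /t rmorphM rmorphD !fmorphV !rmorph_nat.
have hE : h = 2^-1 / N%:R by rewrite /h rmorphM !fmorphV !rmorph_nat.
have xE (j : nat) : x j = ((t j)%:C)%C - h.
  by rewrite tE hE /x; field.
have xSE (j : nat) : x j.+1 = ((t j)%:C)%C + h.
  by rewrite tE hE /x -addn1 natrD; field.
have -> : f 1 - f 0 = \sum_(j < N) (f (x j.+1) - f (x j)).
  rewrite -(big_mkord xpredT (fun j => f (x j.+1) - f (x j))) telescope_sumr//.
  by rewrite /x mul0r divff.
rewrite /midpoint_sum -sumrB; apply: le_trans (cm_sum _ _) _.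
have -> : 8 * B / d ^+ 2 / N%:R = \sum_(j < N) (8 * B / d ^+ 2 / N%:R / N%:R).
  by rewrite sumr_const card_ord -[RHS]mulr_natr divfK// gt_eqF.
apply: ler_sum => j _.
have tj0 : 0 <= t j by rewrite divr_ge0// addr_ge0.
have tj1 : t j <= 1.
  rewrite /t ler_pdivrMr// mul1r.
  have : j.+1%:R <= N%:R :> R by rewrite ler_nat.
  by rewrite -addn1 natrD; lra.
pose T : C := ((t j)%:C)%C.
have inD z : cm z <= d -> cm (T + z) <= 1 + d.
  by move=> zd; apply: le_trans (cmD _ _) _; rewrite cm_real ger0_norm//; lra.
pose g z := f (T + z).
have ghol z : cm z <= d -> chol g z.
  by move=> zd; apply: chol_translate; apply: hol; exact: inD.
have gB z : cm z <= d -> cm (g z) <= B by move=> zd; apply: fB; exact: inD.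
have h1 := taylor2 d0 ghol gB hd.
have h2 : cm (- h) <= d by rewrite cmN.
have {}h2 := taylor2 d0 ghol gB h2.
have gD : cD g 0 = cD f T.
  have := @cD_translate R f T 0; rewrite addr0; apply.
  by apply: hol; rewrite cm_real ger0_norm//; lra.
rewrite gD cmN in h1 h2.
have -> : 0 + (j%:R + 2^-1) / N%:R * 1 = T by rewrite add0r mulr1 -tE.
rewrite xSE xE -/T.
have e1 : cD f T * (1 / N%:R) = cD f T * (2 * h) by rewrite hE; congr (_ * _); field.
have rg (y1 y2 y3 y4 h' : C) : y1 * (2 * h') - (y2 - y3) =
   (y3 - y4 - y1 * (- h')) - (y2 - y4 - y1 * h') by ring.
rewrite e1 (rg _ _ _ (g 0)).
apply: le_trans (cmB _ _) _; apply: le_trans (lerD h2 h1) _.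
rewrite ch.
have -> : 4 * B / d ^+ 2 * (2^-1 / N%:R) ^+ 2 + 4 * B / d ^+ 2 * (2^-1 / N%:R) ^+ 2 =
   (2 * B / d ^+ 2 / N%:R / N%:R) by field; rewrite !gt_eqF.
rewrite !ler_wpM2r ?invr_ge0 ?sqr_ge0 ?ler0n//; lra.
Qed.

Lemma mean_value_inequality g r e : r < 1 -> 0 <= e -> (forall z, cm z < 1 -> chol g z) ->
  (forall z, cm z <= r -> cm (cD g z) <= e) ->
  forall z, cm z <= r -> cm (g z - g 0) <= e.
Proof.
move=> r1 e0 hol gD z zr.
have r0 : 0 <= r by apply: le_trans (cm_ge0 z) zr.
(* Makes [(1 + d) * r < 1], so the slice [g (s * z)] is holomorphic slightly beyond the unit disc of
   [s], as [midpoint_sum_derivative] demands. *)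
pose d : R := (1 - r) / 2.
have d0 : 0 < d by rewrite divr_gt0// subr_gt0.
have sr (s : C) : cm s <= 1 + d -> cm (s * z) < 1.
  move=> sd; rewrite cmM; have := cm_ge0 z; have := cm_ge0 s.
  have : (1 + d) * r < 1 by rewrite /d; nra.
  nra.
clearbody d.
pose f s := g (s * z).
have fD (s : C) : cm s <= 1 + d -> cderiv f s (cD g (s * z) * z).
  move=> sd; apply: (cderiv_comp (f := fun s => s * z)); last first.
    by apply: cDP; apply: hol; exact: sr.
  by apply: cderiv_eq (cderivM (cderiv_id s) (cderiv_cst z s)) _; rewrite mul1r mulr0 addr0.
have fhol (s : C) : cm s <= 1 + d -> chol f s by move=> /fD; exists (cD g (s * z) * z).
have d1 : 0 <= 1 + d by lra.
have [B B0 fB] : exists2 B : R, 0 < B & forall s : C, cm s <= 1 + d -> cm (f s) <= B.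
  have [|B B0 HB] := @disc_bounded R f 0 (1 + d) d1.
    by move=> s; rewrite subr0; exact: fhol.
  by exists B => // s sr'; apply: HB; rewrite subr0.
apply/ler_addgt0Pr => e' e'0.
pose N := (Num.bound (8 * B / d ^+ 2 / e') + Num.bound d^-1 + 1)%N.
have N0 : (0 < N)%N by rewrite /N addn1.
have Nr : 0 < N%:R :> R by rewrite ltr0n.
have N1 : 8 * B / d ^+ 2 / e' <= N%:R.
  have h0 : 0 <= 8 * B / d ^+ 2 / e' by apply: ltW; rewrite !divr_gt0 ?mulr_gt0 ?exprn_gt0.
  apply: le_trans (ltW (archi_boundP h0)) _.
  by rewrite ler_nat /N -addnA leq_addr.
have N2 : N%:R^-1 <= d.
  rewrite invf_ple ?posrE//.
  have h0 : 0 <= d^-1 by rewrite invr_ge0 ltW.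
  apply: le_trans (ltW (archi_boundP h0)) _.
  by rewrite ler_nat /N addnAC leq_addl.
have := midpoint_sum_derivative d0 fhol fB N0 N2.
have f1 : f 1 = g z by rewrite /f mul1r.
have f0 : f 0 = g 0 by rewrite /f mul0r.
rewrite f1 f0 => H1.
have H2 : cm (midpoint_sum (cD f) 0 1 N) <= cm (1 : C) * e.
  apply: cm_midpoint_sum => // t /andP[t0 t1].
  rewrite add0r mulr1.
  have ct : cm ((t%:C)%C : C) = t by rewrite cm_real ger0_norm.
  have td : cm ((t%:C)%C : C) <= 1 + d by rewrite ct; lra.
  rewrite (cD_eq (fD _ td)) cmM.
  have tz : cm ((t%:C)%C * z) <= r by rewrite cmM ct; have := cm_ge0 z; nra.
  have := gD _ tz; have := cm_ge0 (cD g ((t%:C)%C * z)); have := cm_ge0 z; nra.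
rewrite cm1 mul1r in H2.
have -> : g z - g 0 = midpoint_sum (cD f) 0 1 N - (midpoint_sum (cD f) 0 1 N - (g z - g 0)).
  by rewrite opprB [RHS]addrC subrK.
apply: le_trans (cmB _ _) _; apply: lerD => //; apply: le_trans H1 _.
by rewrite ler_pdivrMr// [e' * _]mulrC -ler_pdivrMr.
Qed.

Definition riemann_primitive k N z := midpoint_sum k 0 z N.

(** The derivative of [z * k (T * z)] in [z] equals that of [s * k (s * z)] in [s] at [s = T]. The
    differentiated sum is therefore again a midpoint sum of a derivative, approximating
    [1 * k z - 0]. *)
Lemma riemann_primitiveD k N z : (forall w, cm w < 1 -> chol k w) -> cm z < 1 ->
  cderiv (riemann_primitive k N) z (midpoint_sum (cD (fun s => s * k (s * z))) 0 1 N).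
Proof.
move=> hol z1.
have [->|N0] := posnP N.
  have -> : riemann_primitive k 0 = (fun=> 0).
    by apply/funext => w; rewrite /riemann_primitive /midpoint_sum big_ord0.
  by rewrite /midpoint_sum big_ord0; exact: cderiv_cst.
have N0' : N%:R != 0 :> C by rewrite pnatr_eq0 -lt0n.
rewrite /riemann_primitive /midpoint_sum.
have term (j : nat) : (j < N)%N ->
    cderiv (fun z => k (0 + (j%:R + 2^-1) / N%:R * z) * (z / N%:R)) z
     (cD (fun s => s * k (s * z)) (0 + (j%:R + 2^-1) / N%:R * 1) * (1 / N%:R)).
  move=> jN; rewrite mulr1 add0r; set T := (j%:R + 2^-1) / N%:R.
  have Tz : cm (T * z) < 1.
    have TE : T = (((j%:R + 2^-1) / N%:R : R)%:C)%C.
      by rewrite rmorphM rmorphD !fmorphV !rmorph_nat.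
    have Nr : 0 < N%:R :> R by rewrite ltr0n.
    rewrite TE cmM cm_real ger0_norm ?divr_ge0 ?addr_ge0//.
    apply: le_lt_trans z1; rewrite ler_piMl ?cm_ge0// ler_pdivrMr// mul1r.
    have : j.+1%:R <= N%:R :> R by rewrite ler_nat.
    by rewrite -addn1 natrD; lra.
  have kD := cDP (hol _ Tz).
  have lin (a w : C) : cderiv (fun s => a * s) w a.
    by apply: cderiv_eq (cderivM (cderiv_cst a w) (cderiv_id w)) _; rewrite mul0r add0r mulr1.
  have lin' (a w : C) : cderiv (fun s => s * a) w a.
    by apply: cderiv_eq (cderivM (cderiv_id w) (cderiv_cst a w)) _; rewrite mulr0 addr0 mul1r.
  have -> : cD (fun s => s * k (s * z)) T = 1 * k (T * z) + T * (cD k (T * z) * z).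
    apply: cD_eq; apply: cderivM (cderiv_id T) _.
    exact: (cderiv_comp (f := fun s => s * z) (lin' z T) kD).
  have -> : (fun z => k (0 + T * z) * (z / N%:R)) = (fun z => k (T * z) * (z / N%:R)).
    by apply/funext => w; rewrite add0r.
  apply: cderiv_eq (cderivM (cderiv_comp (f := fun s => T * s) (lin T z) kD) (lin' N%:R^-1 z)) _.
  move: (cD k (T * z)) (k (T * z)) => x1 x2; field.
  exact: N0'.
have sumD (F : nat -> C -> C) (D : nat -> C) (m : nat) : (forall j, (j < m)%N -> cderiv (F j) z (D j)) ->
    cderiv (fun z => \sum_(j < m) F j z) z (\sum_(j < m) D j).
  elim: m => [|m IH] H.
    rewrite big_ord0; have -> : (fun z => \sum_(j < 0) F j z) = (fun=> 0).
      by apply/funext => w; rewrite big_ord0.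
    exact: cderiv_cst.
  rewrite big_ord_recr /=.
  have -> : (fun z => \sum_(j < m.+1) F j z) = (fun z => \sum_(j < m) F j z + F m z).
    by apply/funext => w; rewrite big_ord_recr.
  by apply: cderivD; [apply: IH => j jM; apply: H; exact: ltnW|exact: H].
exact: (sumD (fun j z => k (0 + (j%:R + 2^-1) / N%:R * z) * (z / N%:R))
  (fun j => cD (fun s => s * k (s * z)) (0 + (j%:R + 2^-1) / N%:R * 1) * (1 / N%:R)) N term).
Qed.

Lemma riemann_primitive_rate k r : 0 <= r -> r < 1 -> (forall w, cm w < 1 -> chol k w) ->
  exists2 c : R, 0 < c & exists N0, forall N, (N0 < N)%N -> forall z, cm z <= r ->
    cm (cD (riemann_primitive k N) z - k z) <= c / N%:R.
Proof.
move=> r0 r1 hol.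
pose d : R := (1 - r) / 2.
have d0 : 0 < d by rewrite divr_gt0// subr_gt0.
have dr : (1 + d) * r < 1 by rewrite /d; nra.
clearbody d.
have rr0 : 0 <= (1 + d) * r by rewrite mulr_ge0//; lra.
have [B B0 kB] : exists2 B : R, 0 < B & forall s : C, cm s <= (1 + d) * r -> cm (k s) <= B.
  have [|B B0 HB] := @disc_bounded R k 0 ((1 + d) * r) rr0.
    by move=> s; rewrite subr0 => sr; apply: hol; lra.
  by exists B => // s sr'; apply: HB; rewrite subr0.
pose B2 : R := (1 + d) * B.
have B20 : 0 < B2 by rewrite mulr_gt0//; lra.
exists (8 * B2 / d ^+ 2).
  by apply: divr_gt0; [exact: mulr_gt0|exact: exprn_gt0].
have h0 : 0 <= d^-1 by rewrite invr_ge0 ltW.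
exists (Num.bound d^-1) => N N0 z zr.
have Npos : (0 < N)%N by apply: leq_ltn_trans N0.
have Nr : 0 < N%:R :> R by rewrite ltr0n.
have Nd : N%:R^-1 <= d.
  rewrite invf_ple ?posrE//; apply: le_trans (ltW (archi_boundP h0)) _.
  by rewrite ler_nat ltnW.
have sr (s : C) : cm s <= 1 + d -> cm (s * z) <= (1 + d) * r.
  by move=> sd; rewrite cmM; apply: ler_pM; rewrite ?cm_ge0.
pose f (s : C) := s * k (s * z).
have fhol (s : C) : cm s <= 1 + d -> chol f s.
  move=> sd; apply: cholM (chol_id _) _.
  apply: (chol_comp (f := fun s => s * z)).
    exact: cholM (chol_id _) (chol_cst _ _).
  by apply: hol; apply: le_lt_trans (sr _ sd) dr.
have fB (s : C) : cm s <= 1 + d -> cm (f s) <= B2.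
  by move=> sd; rewrite cmM; apply: ler_pM; rewrite ?cm_ge0//; apply: kB; exact: sr.
have z1 : cm z < 1 by apply: le_lt_trans zr r1.
have := midpoint_sum_derivative d0 fhol fB Npos Nd.
rewrite (cD_eq (riemann_primitiveD N hol z1)).
have f1 : f 1 = k z by rewrite /f !mul1r.
have f0 : f 0 = 0 by rewrite /f mul0r.
by rewrite f1 f0 subr0.
Qed.

Lemma riemann_primitive0 k N : riemann_primitive k N 0 = 0.
Proof.
by rewrite /riemann_primitive /midpoint_sum big1// => j _; rewrite mul0r mulr0.
Qed.

(** Both sums vanish at 0 and their derivatives are within [c / N%:R] and [c / M%:R] of [k], so the
    mean value inequality compares the sums themselves. *)
Lemma riemann_primitive_cauchy k r : 0 <= r -> r < 1 -> (forall w, cm w < 1 -> chol k w) ->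
  exists2 c : R, 0 < c & exists N0, forall N M : nat, (N0 < N)%N -> (N0 < M)%N ->
    forall z, cm z <= r ->
    cm (riemann_primitive k N z - riemann_primitive k M z) <= c / N%:R + c / M%:R.
Proof.
move=> r0 r1 hol; have [c c0 [N0 H]] := riemann_primitive_rate r0 r1 hol.
exists c => //; exists N0 => N M HN HM z zr.
have Nr : 0 < N%:R :> R by rewrite ltr0n (leq_ltn_trans _ HN).
have Mr : 0 < M%:R :> R by rewrite ltr0n (leq_ltn_trans _ HM).
pose g w := riemann_primitive k N w - riemann_primitive k M w.
have rhol n w : cm w < 1 -> chol (riemann_primitive k n) w.
  by move=> w1; eexists; exact: riemann_primitiveD.
have g0 : g 0 = 0 by rewrite /g !riemann_primitive0 subr0.
have -> : riemann_primitive k N z - riemann_primitive k M z = g z - g 0 by rewrite g0 subr0.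
apply: (mean_value_inequality (g := g) r1 _ _ _ zr).
- by apply: addr_ge0; apply: ltW; exact: divr_gt0.
- by move=> w w1; apply: cholB; exact: rhol.
- move=> w wr; have w1 : cm w < 1 by lra.
  rewrite (cD_eq (cderivB (cDP (rhol N _ w1)) (cDP (rhol M _ w1)))).
  have -> : cD (riemann_primitive k N) w - cD (riemann_primitive k M) w =
    (cD (riemann_primitive k N) w - k w) - (cD (riemann_primitive k M) w - k w).
    by rewrite opprB addrA subrK.
  by apply: le_trans (cmB _ _) _; apply: lerD; exact: H.
Qed.

(** Radial Riemann sums converge uniformly on smaller discs, and their derivatives converge to [k].
    [uniform_limit_cderiv], recentred at each [p], identifies the derivative of the limit without
    comparing paths. *)
Lemma primitive_exists k : (forall w, cm w < 1 -> chol k w) ->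
  exists F, forall z, cm z < 1 -> cderiv F z (k z).
Proof.
move=> hol.
pose P N z := riemann_primitive k N z.
have small (c e : R) : 0 < c -> 0 < e -> exists N0, forall N, (N0 < N)%N -> c / N%:R <= e.
  move=> c0 e0; exists (Num.bound (c / e)) => N HN.
  have Nr : 0 < N%:R :> R by rewrite ltr0n (leq_ltn_trans _ HN).
  rewrite ler_pdivrMr// [e * _]mulrC -ler_pdivrMr//.
  have h0 : 0 <= c / e by apply: ltW; exact: divr_gt0.
  by apply: le_trans (ltW (archi_boundP h0)) _; rewrite ler_nat ltnW.
have ucauchy r : 0 <= r -> r < 1 -> forall e, 0 < e -> exists N0, forall N (M : nat),
    (N0 < N)%N -> (N0 < M)%N -> forall z, cm z <= r -> cm (P N z - P M z) <= e.
  move=> r0 r1 e e0; have [c c0 [N0 H]] := riemann_primitive_cauchy r0 r1 hol.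
  have e20 : 0 < e / 2 by rewrite divr_gt0.
  have [N1 H1] := small _ _ c0 e20.
  exists (N0 + N1)%N => N M HN HM z zr.
  have N01 : (N0 <= N0 + N1)%N by exact: leq_addr.
  have N11 : (N1 <= N0 + N1)%N by exact: leq_addl.
  have := H N M (leq_ltn_trans N01 HN) (leq_ltn_trans N01 HM) z zr.
  have := H1 N (leq_ltn_trans N11 HN); have := H1 M (leq_ltn_trans N11 HM).
  by rewrite -/(P N z) -/(P M z); move: (c / N%:R) (c / M%:R) => x y; lra.
have /choice[F HF] : forall z, exists l, cm z < 1 -> ccvg (fun N => P N z) l.
  move=> z; have [z1|z1] := ltP (cm z) 1; last by exists 0 => h; lra.
  have [|l Hl] := @complex_cauchy_cvg R (fun N => P N z).
    move=> e e0; have [N0 H] := ucauchy _ (cm_ge0 z) z1 e e0.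
    by exists N0.+1 => n Nn; exact: (H n N0.+1 Nn (ltnSn N0) z (lexx _)).
  by exists l.
have unif r : 0 <= r -> r < 1 -> forall e, 0 < e -> exists N0, forall N, (N0 <= N)%N ->
    forall z, cm z <= r -> cm (P N z - F z) <= e.
  move=> r0 r1 e e0; have e20 : 0 < e / 2 by rewrite divr_gt0.
  have [N0 H] := ucauchy r r0 r1 _ e20.
  exists N0.+1 => N HN z zr; have z1 : cm z < 1 by lra.
  have [N1 H1] := HF z z1 _ e20.
  have a1 : (N0 < (N0 + N1).+1)%N by rewrite ltnS leq_addr.
  have a2 : (N1 <= (N0 + N1).+1)%N by rewrite -addnS; apply: leq_trans (leq_addr N0.+1 _) _; rewrite addnC addSnnS.
  have := H N (N0 + N1).+1 HN a1 z zr; have := H1 _ a2.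
  have -> : P N z - F z = (P N z - P (N0 + N1).+1 z) + (P (N0 + N1).+1 z - F z) by rewrite addrA subrK.
  by move=> h1 h2; apply: le_trans (cmD _ _) _; lra.
exists F => p p1.
pose r : R := (1 - cm p) / 2; pose rho : R := (1 + cm p) / 2.
have r0 : 0 < r by rewrite divr_gt0// subr_gt0.
have rho1 : rho < 1 by rewrite /rho; lra.
have rho0 : 0 <= rho by rewrite /rho; have := cm_ge0 p; lra.
have inD w : cm w <= r -> cm (p + w) <= rho.
  by move=> wr; apply: le_trans (cmD _ _) _; rewrite /rho; rewrite /r in wr; lra.
have prho : cm p <= rho by rewrite /rho; lra.
clearbody r rho.
have [B B0 kB] : exists2 B : R, 0 < B & forall s : C, cm s <= rho -> cm (k s) <= B.
  have [|B B0 HB] := @disc_bounded R k 0 rho rho0.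
    by move=> s; rewrite subr0 => sr; apply: hol; lra.
  by exists B => // s sr'; apply: HB; rewrite subr0.
have Phol n w : cm w < 1 -> chol (P n) w.
  by move=> w1; eexists; exact: riemann_primitiveD.
have PB n w : cm w <= rho -> cm (P n w) <= B.
  move=> wr; have [->|n0] := posnP n.
    by rewrite /P /riemann_primitive /midpoint_sum big_ord0 cm0 ltW.
  apply: (@le_trans _ _ (cm w * B)).
    apply: cm_midpoint_sum => // t /andP[t0 t1].
    rewrite add0r; apply: kB; rewrite cmM cm_real ger0_norm//.
    by apply: le_trans wr; rewrite ler_piMl ?cm_ge0.
  by rewrite ler_piMl ?(ltW B0)//; lra.
have [|||a Ha Hq] := @uniform_limit_cderiv R (fun n w => P n (p + w)) (fun w => F (p + w)) r B r0.
- move=> n w wr; apply: chol_translate; apply: Phol.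
  by apply: le_lt_trans (inD _ wr) rho1.
- by move=> n w wr; apply: PB; exact: inD.
- move=> e e0; have [N0 H] := unif _ rho0 rho1 e e0.
  by exists N0 => n Nn w wr; apply: H => //; exact: inD.
have aE : a = k p.
  apply: (ccvg_unique Ha) => e e0.
  have [c c0 [N0 H]] := riemann_primitive_rate rho0 rho1 hol.
  have [N1 H1] := small _ _ c0 e0.
  exists (N0 + N1).+1 => n Nn.
  have a1 : (N0 < n)%N by apply: leq_ltn_trans Nn; rewrite leq_addr.
  have a2 : (N1 < n)%N by apply: leq_ltn_trans Nn; rewrite leq_addl.
  apply: le_trans (H1 _ a2).
  have := H n a1 p prho.
  have -> : cD (fun w => P n (p + w)) 0 = cD (riemann_primitive k n) p; last by [].
  have := @cD_translate R (P n) p 0; rewrite addr0; apply.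
  exact: Phol.
have D0 : cderiv (fun w => F (p + w)) (- p + p) (k p).
  rewrite addNr; apply: (cderiv_from_bound (B := 4 * B / r ^+ 2) r0) => w w0 wr.
  by rewrite -aE; apply: Hq; exact: ltW.
have -> : F = (fun x => F (p + (- p + x))).
  by apply/funext => x; rewrite addrA subrr add0r.
exact: (cderiv_translate (f := fun w => F (p + w)) D0).
Qed.

End primitive.

Section complex_exponential.
Variable R : realType.
Local Notation C := (R[i]).
Local Notation i := ('i%C : C).
Implicit Types (f g k : C -> C) (p z a b u v w : C).

Definition cexp z : C :=
  ((expR (complex.Re z) * cos (complex.Im z)) +i* (expR (complex.Re z) * sin (complex.Im z)))%C.

Lemma cexp0 : cexp 0 = 1.
Proof. by rewrite /cexp /= expR0 cos0 sin0 mulr1 mulr0. Qed.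

Lemma cexpD z w : cexp (z + w) = cexp z * cexp w.
Proof.
case: z w => [a b] [c d]; rewrite /cexp /= expRD cosD sinD.
by apply/eqP; rewrite eq_complex /=; apply/andP; split; apply/eqP; ring.
Qed.

Lemma cexp_neq0 z : cexp z != 0.
Proof.
apply/eqP => z0; have := cexpD z (- z).
by rewrite subrr cexp0 z0 mul0r => /eqP; rewrite oner_eq0.
Qed.

Lemma cderiv_cexp0 : cderiv cexp 0 1.
Proof.
apply/cderivP => e e0.
(* The real and imaginary parts of the remainder cost [1 + 3] and [2 + 3] multiples of [e1 * cm h];
   [e1 <= 1] serves to bound [expR x] by 3. *)
pose e1 : R := Num.min (e / 9) 1.
have e10 : 0 < e1 by rewrite lt_min ltr01 andbT divr_gt0.
have e1e : e1 <= e / 9 by rewrite ge_min lexx.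
have e18 : 9 * e1 <= e by lra.
have e11 : e1 <= 1 by rewrite ge_min lexx orbT.
clearbody e1; clear e1e.
have [d1 d10 H1] := is_derive_eps (is_derive_expR (0 : R)) e10.
have [d2 d20 H2] := is_derive_eps (is_derive_cos (0 : R)) e10.
have [d3 d30 H3] := is_derive_eps (is_derive_sin (0 : R)) e10.
pose d : R := Num.min (Num.min d1 d2) (Num.min d3 e1).
have d0 : 0 < d by rewrite !lt_min d10 d20 d30.
exists d => // -[x y] hd.
have xd : `|x| < d := le_lt_trans (ler_Re_cm (x +i* y)%C) hd.
have yd : `|y| < d := le_lt_trans (ler_Im_cm (x +i* y)%C) hd.
move: xd yd; rewrite !lt_min => /andP[/andP[x1 x2] /andP[x3 x4]] /andP[/andP[y1 y2] /andP[y3 y4]].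
have h1 := H1 x x1; have h2 := H2 y y2; have h3 := H3 y y3.
rewrite add0r expR0 mul1r in h1.
rewrite add0r cos0 sin0 oppr0 mul0r subr0 in h2.
rewrite add0r cos0 sin0 mul1r subr0 in h3.
set h := (x +i* y)%C; rewrite add0r cexp0 mul1r.
have xh : `|x| <= cm h := ler_Re_cm h.
have yh : `|y| <= cm h := ler_Im_cm h.
apply: le_trans (ler_cm_ReIm _) _; rewrite /= oppr0 addr0.
move: (expR x) (cos y) (sin y) h1 h2 h3 => E c s h1 h2 h3.
have -> : E * c - 1 - x = (E - 1 - x) + E * (c - 1) by ring.
have -> : E * s - y = (E - 1) * y + E * (s - y) by ring.
have E1 : `|E - 1| <= 2 * e1.
  have -> : E - 1 = (E - 1 - x) + x by ring.
  apply: le_trans (ler_normD _ _) _.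
  have := normr_ge0 x; nra.
have E2 : `|E| <= 3.
  have -> : E = (E - 1) + 1 by ring.
  by apply: le_trans (ler_normD _ _) _; rewrite normr1; lra.
apply: le_trans (lerD (ler_normD _ _) (ler_normD _ _)) _.
rewrite !normrM.
have b1 : `|E| * `|c - 1| <= 3 * (e1 * `|y|) by apply: ler_pM.
have b2 : `|E - 1| * `|y| <= 2 * e1 * `|y| by rewrite ler_wpM2r.
have b3 : `|E| * `|s - y| <= 3 * (e1 * `|y|) by apply: ler_pM.
have b4 : e1 * `|x| <= e1 * cm h by rewrite ler_wpM2l// ltW.
have b5 : e1 * `|y| <= e1 * cm h by rewrite ler_wpM2l// ltW.
have b6 : 9 * e1 * cm h <= e * cm h by rewrite ler_wpM2r ?cm_ge0.
rewrite -[X in _ <= _ * X]/(cm h); lra.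
Qed.

Lemma cderiv_cexp z : cderiv cexp z (cexp z).
Proof.
have -> : cexp = (fun x => cexp z * cexp (- z + x)).
  by apply/funext => x; rewrite -cexpD addrA subrr add0r.
have h : cderiv cexp (- z + z) 1 by rewrite addNr; exact: cderiv_cexp0.
apply: cderiv_eq (cderivM (cderiv_cst (cexp z) z) (cderiv_translate h)) _.
by rewrite mul0r add0r mulr1 addNr cexp0 mulr1.
Qed.

Lemma linear_ode k : (forall w, cm w < 1 -> chol k w) ->
  exists gam, [/\ forall z, cm z < 1 -> cderiv gam z (k z * gam z),
    gam 0 = 1 & forall z, gam z != 0].
Proof.
move=> /primitive_exists[F HF].
exists (fun z => cexp (F z - F 0)); split => [z z1||z].
- rewrite mulrC; apply: (cderiv_comp (f := fun z => F z - F 0)); last exact: cderiv_cexp.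
  by apply: cderiv_eq (cderivB (HF z z1) (cderiv_cst _ _)) _; rewrite subr0.
- by rewrite subrr cexp0.
- exact: cexp_neq0.
Qed.

End complex_exponential.

(** * The upper bound *)

Section upper_bound.
Variables (R : realType) (n : nat).
Local Notation C := (R[i]).
Local Notation K := (R[i] : numFieldType).
Local Notation V := ('rV[K]_n).
Implicit Types (g : V -> K) (v w x y z u h : V).

Lemma chol_diffP (f : C -> C) (z : C) : differentiable (f : K -> K) (z : K) <-> chol f z.
Proof.
split=> [/derivable1_diffP fz|[a [fz _]]]; last exact/derivable1_diffP.
by exists (cD f z); apply: DeriveDef.
Qed.

Lemma deriv_at1 (f : C -> C) (z : C) : deriv_at 1 (f : K -> K) (z : K) = cD f z.
Proof. exact: derive1E. Qed.

Lemma deriv_at2 (f : C -> C) (z : C) : deriv_at 2 (f : K -> K) (z : K) = cD (cD f) z.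
Proof.
have E : derive1 (f : K -> K) = cD f by apply/funext => w; exact: derive1E.
by rewrite /deriv_at derive1nS derive1n1 E; exact: derive1E.
Qed.

Lemma normr_lt1 y : `|y| < 1 -> nv y < 1.
Proof. by rewrite normr_nv => h; rewrite -ltcR. Qed.

Lemma holomorphic_directional (f : V -> K) v :
  (forall y, nv y < 1 -> differentiable f y) ->
  forall y, nv y < 1 -> differentiable (fun x => 'd f x v : K) y.
Proof.
move=> holf y y1; have r0 : 0 < 1 - nv y by rewrite subr_gt0.
apply: (differentiable_directional v r0) => h hh; apply: holf.
by apply: le_lt_trans (nvD _ _) _; lra.
Qed.

Lemma slice_cderiv g u (t : C) : (forall y, nv y < 1 -> differentiable g y) ->
  nv (t *: u) < 1 -> cderiv (fun s : C => g (s *: u)) t ('d g (t *: u : V) u).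
Proof.
move=> holg tu.
have -> : (fun s : C => g (s *: u)) = (fun s : C => g (0 + s *: u)).
  by apply/funext => s; rewrite add0r.
by rewrite -[t *: u]add0r; apply: cderiv_line; rewrite add0r; exact: holg.
Qed.

Lemma sqr_coef_diff_coord g z j : (forall y, nv y < 1 -> differentiable g y) ->
  sqr_coef_diff (scaled_id g) z 0 j =
  z 0 j ^+ 2 * (('d (fun y => 'd g y z : K) 0 z / 2) ^+ 2 - ('d g 0 z) ^+ 2) :> C.
Proof.
move=> holg; apply: sqr_coef_diffE => y /normr_lt1 y1; first exact: holg.
  exact: holomorphic_directional.
apply: holomorphic_directional => // w w1; exact: holomorphic_directional.
Qed.

Lemma unit_vector_coord z : nv z = 1 -> exists k, cm (z 0 k) = 1.
Proof.
move=> z1; have z0 : mx_norm z != 0.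
  have : nv z != 0 by rewrite z1 oner_eq0.
  by rewrite nv_eq0; apply: contra => /eqP/mx_norm_eq0->.
have [[i j] /= E] := mx_norm_neq0 z0; exists j.
rewrite -z1; apply: complexI => /=; rewrite -normr_nv -(ord1 i) -normr_cm; exact: esym E.
Qed.

(* (DG(z))^-1 G(z) is the multiple g / (g + Dg(z) z) of z. *)
Lemma inv_deriv_applyE g z : differentiable g z ->
  'J (scaled_id g) z \in unitmx -> z != 0 ->
  g z + 'd g z z != 0 /\
  inv_deriv_apply (scaled_id g) z = (g z / (g z + 'd g z z)) *: z.
Proof.
move=> dg Ju z0.
have E : z *m 'J (scaled_id g) z = (g z + 'd g z z) *: z.
  rewrite mul_jacobian.
  apply: etrans (congr1 (fun f => f z) (diff_val (is_diff_def := is_diff_scaled_id dg))) _.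
  by rewrite addrC scalerDl.
have s0 : g z + 'd g z z != 0.
  apply/eqP => s0; move: E; rewrite s0 scale0r => /(congr1 (mulmx^~ (invmx ('J (scaled_id g) z)))).
  by rewrite mulmxK// mul0mx => z00; move: z0; rewrite z00 eqxx.
split=> //; rewrite /inv_deriv_apply /scaled_id -scalemxAl -scalerA; congr (_ *: _).
apply: (scalerI s0); rewrite scalerA mulfV// scale1r scalemxAl -E.
by rewrite mulmxK.
Qed.

End upper_bound.

Section main_estimate.
Variables (R : realType) (n : nat).
Local Notation C := (R[i]).
Local Notation K := (R[i] : numFieldType).
Local Notation V := ('rV[K]_n).
Implicit Types (g : V -> K) (v w x y z u h : V).

Lemma unit_slice_coefficients (Phi h : C -> C) g u :
  (forall z : C, cm z < 1 -> chol Phi z) -> Phi 0 = 1 ->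
  (forall z : C, cm z < 1 -> chol h (Phi z)) -> (forall z : C, cm z < 1 -> h (Phi z) = z) ->
  admissible (Phi : K -> K) g -> nv u = 1 ->
  exists c1 c2 : C, [/\ cm c1 <= 1, cm c2 <= 1 - cm c1 ^+ 2,
    'd g 0 u = cD Phi 0 * c1 &
    'd (fun y => 'd g y u : K) 0 u =
      cD Phi 0 * c2 + (cD (cD Phi) 0 / 2 + cD Phi 0 ^+ 2) * c1 ^+ 2].
Proof.
move=> Phol Phi0 hhol hP [gh g0 [Junit [_ _ _ gM]]] u1.
have holg y : nv y < 1 -> differentiable g y by move=> /unit_polydiscP; exact: gh.
have small (t : C) : cm t < 1 -> nv (t *: u) < 1 by rewrite nvZ u1 mulr1.
have [k uk] := unit_vector_coord u1.
pose gam (t : C) : C := g (t *: u).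
have gamD (t : C) : cm t < 1 -> cderiv gam t ('d g (t *: u : V) u).
  by move=> t1; apply: slice_cderiv holg (small _ t1).
have gam0 : gam 0 = 1 by rewrite /gam scale0r.
have u0 : u != 0 by rewrite -nv_eq0 u1 oner_eq0.
(* Coordinate [k] attains the norm of [t *: u], so the condition of [class_M] applies to it. The
   coordinate of p there is a multiple of [gam t], hence its nonvanishing forces [gam t != 0]. *)
have key (t : C) : t != 0 -> cm t < 1 -> gam t != 0 /\
    exists2 w, cm w < 1 & 1 + t * cD gam t / gam t = Phi w.
  move=> t0 t1; have tu1 := small _ t1.
  have tu0 : t *: u != 0 by rewrite scaler_eq0 negb_or t0.
  have tup : unit_polydisc (t *: u) by apply/unit_polydiscP.
  have [s0 pE] := inv_deriv_applyE (holg _ tu1) (Junit _ tup) tu0.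
  have normk : `|(t *: u) 0 k| = `|t *: u|.
    by rewrite normr_cm normr_nv nvZ u1 mxE cmM uk.
  have dE : 'd g (t *: u : V) (t *: u) = t * cD gam t :> C.
    by rewrite (cD_eq (gamD _ t1)); exact: diff_scale.
  have [] := gM _ _ tup tu0 normk.
  rewrite pE mxE -/(gam t) in s0 *.
  move: ('d g (t *: u : V) (t *: u)) dE s0 => D -> s0.
  move: (gam t) (t * cD gam t) ((t *: u) 0 k) s0 => a b c s0 pk0.
  have a0 : a != 0 by apply: contraNneq pk0 => ->; rewrite !mul0r.
  have c0 : c != 0 by apply: contraNneq pk0 => ->; rewrite mulr0.
  move=> [w w1 wE]; split=> //; exists w; first by rewrite -ltcR -normr_cm.
  by rewrite wE; field; rewrite c0 a0 s0.
have gamN0 (t : C) : cm t < 1 -> gam t != 0.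
  move=> t1; have [->|t0] := eqVneq t 0; first by rewrite gam0 oner_eq0.
  by have [] := key t t0 t1.
have sub (t : C) : cm t < 1 -> exists2 w, cm w < 1 & 1 + t * cD gam t / gam t = Phi w.
  move=> t1; have [->|t0] := eqVneq t 0.
    by exists 0; rewrite ?cm0// !mul0r addr0 Phi0.
  by have [] := key t t0 t1.
have ghol (t : C) : cm t < 1 -> chol gam t by move=> /gamD; exists ('d g (t *: u : V) u).
have [c1 [c2 [h1 h2 h3 h4]]] :=
  subordination_coefficients Phol Phi0 hhol hP ghol gam0 gamN0 sub.
have z01 : cm (0 : C) < 1 by rewrite cm0.
exists c1, c2; split; [exact: h1|exact: h2| |].
  have D0 := gamD 0 z01; rewrite scale0r in D0.
  by rewrite -h3; exact: esym (cD_eq D0).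
rewrite -h4; apply: esym; apply: cD_eq.
have D := slice_cderiv (t := 0) (holomorphic_directional u holg) (small 0 z01).
rewrite scale0r in D.
apply: cderiv_near ltr01 _ D => t; rewrite subr0 => t1.
exact: esym (cD_eq (gamD t t1)).
Qed.

End main_estimate.

Section bound.
Variables (R : realType) (n : nat).
Local Notation C := (R[i]).
Local Notation K := (R[i] : numFieldType).
Local Notation V := ('rV[K]_n).

Definition coef_bound (b d m : R) : R :=
  b ^+ 2 * m ^+ 6 / 4 * (2^-1 * (d / b) + b) ^+ 2 + (b * m ^+ 2) ^+ 2.

(** This form separates the contributions: [m ^+ 2] bounds a squared coordinate, and the bracket
    adds the squares of the bounds for the quadratic and the linear Taylor term of [g]. *)
Lemma coef_boundE (b d m : R) : b != 0 -> coef_bound b d m =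
  m ^+ 2 * ((m ^+ 2 * (d / 2 + b ^+ 2) / 2) ^+ 2 + (m * b) ^+ 2).
Proof. by move=> b0; rewrite /coef_bound; field. Qed.

Lemma coef_combination_bound (b D m : R) (c1 c2 a1 a2 x : C) :
  0 < b -> 0 <= m -> b <= `|D| -> cm c1 <= 1 -> cm c2 <= 1 - cm c1 ^+ 2 ->
  a1 = (m%:C)%C * ((b%:C)%C * c1) ->
  a2 = (m%:C)%C ^+ 2 * ((b%:C)%C * c2 + (D%:C)%C * c1 ^+ 2) -> cm x <= m ->
  cm (x ^+ 2 * ((a2 / 2) ^+ 2 - a1 ^+ 2)) <=
    m ^+ 2 * ((m ^+ 2 * D / 2) ^+ 2 + (m * b) ^+ 2).
Proof.
move=> b0 m0 bD h1 h2 -> -> xm.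
have n1 : cm ((m%:C)%C * ((b%:C)%C * c1)) <= m * b.
  rewrite !cmM !cm_real (ger0_norm m0) (gtr0_norm b0).
  by rewrite ler_wpM2l// ler_piMr// ltW.
have n2 : cm ((m%:C)%C ^+ 2 * ((b%:C)%C * c2 + (D%:C)%C * c1 ^+ 2)) <= m ^+ 2 * `|D|.
  rewrite cmM cmX cm_real (ger0_norm m0) ler_wpM2l ?sqr_ge0//.
  apply: le_trans (cmD _ _) _; rewrite !cmM !cm_real (gtr0_norm b0).
  (* With x the square of [cm c1], the sum is at most [b * (1 - x) + |D| * x], a convex combination,
     and [b <= |D|]. *)
  have := cm_ge0 c1; have := cm_ge0 c2; nra.
move: (_ * (_ * c1)) (_ ^+ 2 * _) n1 n2 => a1' a2' n1 n2.
rewrite cmM cmX; apply: ler_pM; rewrite ?sqr_ge0 ?cm_ge0//.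
  by rewrite lerXn2r ?nnegrE ?cm_ge0.
apply: le_trans (cmB _ _) _; rewrite !cmX cmM cmV cmn; apply: lerD.
  have E : `|m ^+ 2 * D / 2| = m ^+ 2 * `|D| / 2.
    by rewrite normrM (normrM (m ^+ 2)) (ger0_norm (sqr_ge0 m)) (ger0_norm (_ : 0 <= 2^-1)).
  rewrite -[leRHS]real_normK ?num_real// E.
  rewrite lerXn2r ?nnegrE ?divr_ge0 ?mulr_ge0 ?sqr_ge0 ?cm_ge0//.
  by rewrite ler_wpM2r// invr_ge0.
by rewrite lerXn2r ?nnegrE ?cm_ge0 ?mulr_ge0// ltW.
Qed.

Lemma sqr_coef_diff_bound (Phi h : C -> C) (g : V -> K) (b d : R) :
  (forall z : C, cm z < 1 -> chol Phi z) -> Phi 0 = 1 ->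
  (forall z : C, cm z < 1 -> chol h (Phi z)) -> (forall z : C, cm z < 1 -> h (Phi z) = z) ->
  0 < b -> cD Phi 0 = (b%:C)%C -> cD (cD Phi) 0 = (d%:C)%C ->
  b <= `|d / 2 + b ^+ 2| -> admissible (Phi : K -> K) g ->
  forall z : V, nv z < 1 -> nv (sqr_coef_diff (scaled_id g) z) <= coef_bound b d (nv z).
Proof.
move=> Phol Phi0 hhol hP b0 bE dE bd adm z z1.
have holg y : nv y < 1 -> differentiable g y.
  by case: adm => gh _ _ /unit_polydiscP; exact: gh.
have b0' : b != 0 by rewrite gt_eqF.
rewrite coef_boundE//; set m := nv z.
have m0 : 0 <= m by exact: nv_ge0.
pose D := d / 2 + b ^+ 2.
apply: nv_le => [|j].
  by rewrite mulr_ge0 ?sqr_ge0// addr_ge0 ?sqr_ge0.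
rewrite sqr_coef_diff_coord//.
have [z0|z0] := eqVneq z 0.
  rewrite z0 mxE expr0n mul0r cm0.
  by rewrite mulr_ge0 ?sqr_ge0// addr_ge0 ?sqr_ge0.
have mgt0 : 0 < m by rewrite lt_def m0 andbT nv_eq0.
(* Coefficients are estimated on the unit vector and carried back by homogeneity of degrees 1 and
   2. *)
pose u : V := ((m%:C)%C : K)^-1 *: z.
have mC : (m%:C)%C != 0 :> C by rewrite -cm_eq0 cm_real gtr0_norm// gt_eqF.
have zE : z = ((m%:C)%C : K) *: u by rewrite /u scalerA mulfV// scale1r.
have u1 : nv u = 1 by rewrite /u nvZ cmV cm_real gtr0_norm// mulVf// gt_eqF.
have [c1 [c2 [h1 h2 h3 h4]]] := unit_slice_coefficients Phol Phi0 hhol hP adm u1.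
rewrite bE dE in h3 h4.
have holD : differentiable (fun y => 'd g y u : K) (0 : V).
  by apply: holomorphic_directional => //; rewrite nv0.
have E1 : 'd g 0 z = (m%:C)%C * ((b%:C)%C * c1) :> C.
  by rewrite -h3 zE; exact: diff_scale.
have E2 : 'd (fun y => 'd g y z : K) 0 z =
    (m%:C)%C ^+ 2 * ((b%:C)%C * c2 + (D%:C)%C * c1 ^+ 2) :> C.
  have -> : (D%:C)%C = (d%:C)%C / 2 + (b%:C)%C ^+ 2 :> C.
    by rewrite rmorphD rmorphXn rmorphM fmorphV rmorph_nat.
  by rewrite -h4 zE; exact: diff2_scale.
exact: coef_combination_bound b0 m0 bd h1 h2 E1 E2 (cm_coord z j).
Qed.

End bound.

(** * Sharpness *)

Section extremal.
Variables (R : realType) (n : nat).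
Local Notation C := (R[i]).
Local Notation K := (R[i] : numFieldType).
Local Notation V := ('rV[K]_n).
Local Notation i := ('i%C : C).
Implicit Types (z v : V).

Lemma disc_dquot_holomorphic (f : C -> C) (a : C) : (forall z : C, cm z < 1 -> chol f z) ->
  cderiv f 0 a -> forall z : C, cm z < 1 -> chol (dquot f a) z.
Proof.
move=> hol fa z z1; have r0 : 0 < (1 + cm z) / 2 by have := cm_ge0 z; lra.
by apply: (dquot_holomorphic r0 _ fa); [move=> w wz; apply: hol; lra|lra].
Qed.

Lemma unitmx_of_injective (J : 'M[K]_n) :
  (forall v : V, v *m J = 0 -> v = 0) -> J \in unitmx.
Proof. by move=> H; rewrite -row_free_unit; exact: inj_row_free. Qed.

(* g(z) = gamma(z_j) with z gamma'/gamma = Phi(i z) - 1, so that the Schwarz function is i z. *)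
Theorem extremal_function (Phi : C -> C) (b d : R) (j : 'I_n) :
  (forall z : C, cm z < 1 -> chol Phi z) -> Phi 0 = 1 ->
  (forall z : C, cm z < 1 -> Phi z != 0) ->
  0 < b -> cD Phi 0 = (b%:C)%C -> cD (cD Phi) 0 = (d%:C)%C ->
  exists2 g : V -> K, admissible (Phi : K -> K) g &
    exists z : V, [/\ nv z < 1, z != 0 &
      coef_bound b d (nv z) <= nv (sqr_coef_diff (scaled_id g) z)].
Proof.
move=> Phol Phi0 PhiN0 b0 bE dE.
have z01 : cm (0 : C) < 1 by rewrite cm0.
have ci (t : C) : cm t < 1 -> cm (i * t) < 1 by rewrite cmM cmi mul1r.
pose f (t : C) := Phi (i * t).
have fD (t : C) : cm t < 1 -> cderiv f t (cD Phi (i * t) * i).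
  move=> t1; apply: (cderiv_comp (f := fun t => i * t)); last by apply: cDP; apply: Phol; exact: ci.
  by apply: cderiv_eq (cderivM (cderiv_cst i t) (cderiv_id t)) _; rewrite mul0r add0r mulr1.
have fhol (t : C) : cm t < 1 -> chol f t by move=> /fD; exists (cD Phi (i * t) * i).
have f0 : f 0 = 1 by rewrite /f mulr0.
have f0D : cderiv f 0 ((b%:C)%C * i).
  by apply: cderiv_eq (fD 0 z01) _; rewrite mulr0 bE.
pose k := dquot f ((b%:C)%C * i).
have khol (t : C) : cm t < 1 -> chol k t by exact: disc_dquot_holomorphic fhol f0D t.
have k0 : k 0 = (b%:C)%C * i by rewrite /k /dquot eqxx.
have fk (t : C) : f t = 1 + t * k t by rewrite -f0; exact: dquotE.
have fN0 (t : C) : cm t < 1 -> f t != 0 by move=> t1; apply: PhiN0; exact: ci.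
(* Since [f t = Phi (i * t)], its second derivative at 0 is [i ^+ 2 * d = - d], which is twice the
   derivative of [k]. *)
have kD : cderiv k 0 (- ((d / 2)%:C)%C).
  have [l Hl] := khol 0 z01.
  have half0 : 0 < 1 / 2 :> R by lra.
  have fhol2 (t : C) : cm t <= 1 / 2 -> chol f t by move=> t1; apply: fhol; lra.
  have h1 := cderiv_cD0 half0 fhol2 f0D Hl.
  have D1 : cderiv (cD Phi) (i * 0) (d%:C)%C.
    rewrite mulr0 -dE; apply: cDP; apply: (chol_cD (p := 0) ltr01); last by rewrite subr0.
    by move=> t; rewrite subr0; exact: Phol.
  have D2 : cderiv (fun t => i * t) 0 i.
    by apply: cderiv_eq (cderivM (cderiv_cst i 0) (cderiv_id 0)) _; rewrite mul0r add0r mulr1.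
  have D3 := cderivM (cderiv_comp (f := fun t => i * t) D2 D1) (cderiv_cst i 0).
  have h2 : cderiv (cD f) 0 ((d%:C)%C * i * i + cD Phi (i * 0) * 0).
    apply: cderiv_near ltr01 _ D3 => t; rewrite subr0 => t1.
    exact: esym (cD_eq (fD t t1)).
  have E := cderiv_unique h1 h2.
  have lE : l = - ((d / 2)%:C)%C.
    have two0 : 2 != 0 :> C by rewrite pnatr_eq0.
    apply: (mulfI two0); rewrite E mulr0 addr0 -mulrA ii.
    by rewrite rmorphM fmorphV rmorph_nat; field.
  by rewrite -lE.
have [gam [gamD gam0 gamN0]] := linear_ode khol.
clearbody k.
pose g (z : V) : K := gam (z 0 j).
have coord1 (z : V) : nv z < 1 -> cm (z 0 j) < 1 by apply: le_lt_trans; exact: cm_coord.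
have gdiff (z : V) : nv z < 1 -> is_diff z g (fun v => k (z 0 j) * gam (z 0 j) * v 0 j).
  by move=> /coord1/gamD h; exact: is_diff_coord_comp h.
have holg (z : V) : nv z < 1 -> differentiable g z by move=> /gdiff[].
have gE (z v : V) : nv z < 1 -> 'd g z v = k (z 0 j) * gam (z 0 j) * v 0 j :> C.
  by move=> /gdiff H; exact: (congr1 (fun F => F v) (diff_val (is_diff_def := H))).
have sE (z : V) : nv z < 1 -> g z + 'd g z z = gam (z 0 j) * f (z 0 j) :> C.
  move=> z1; have aux (x1 x2 x3 : C) : x1 + x2 * x1 * x3 = x1 * (1 + x3 * x2) by ring.
  by rewrite (gE z z z1) (fk (z 0 j)); exact: aux.
have sN0 (z : V) : nv z < 1 -> g z + 'd g z z != 0.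
  move=> z1; rewrite sE//; apply: mulf_neq0; first exact: gamN0.
  by apply: fN0; exact: coord1.
have Junit (z : V) : nv z < 1 -> 'J (scaled_id g) z \in unitmx.
  move=> z1; apply: unitmx_of_injective => v.
  rewrite mul_jacobian.
  have E := congr1 (fun F => F v) (diff_val (is_diff_def := is_diff_scaled_id (holg _ z1))).
  move=> /(etrans (esym E)) /= {}E.
  have gz0 : g z != 0 by exact: gamN0.
  (* A kernel vector is a multiple of [z]. Applying ['d g z] to this relation leaves
     ['d g z v * (g z + 'd g z z) = 0], whose second factor is nonzero. *)
  have vE : v = (- ('d g z v / g z)) *: z.
    apply: (scalerI gz0); rewrite scalerA mulrN mulrCA divff// mulr1 scaleNr.
    by apply/eqP; rewrite -addr_eq0 addrC; apply/eqP.
  have dv : 'd g z v * (g z + 'd g z z) = 0.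
    have aux (x y w : K) : w != 0 -> x = - (x / w) * y -> x * (w + y) = 0.
      move=> w0 xE; have xw : x * w = - (x * y) by rewrite {1}xE; field.
      by rewrite mulrDr xw addNr.
    by apply: aux gz0 _; rewrite {1}vE; exact: diff_scale.
  move: dv => /eqP; rewrite mulf_eq0 (negbTE (sN0 _ z1)) orbF => /eqP dv.
  by rewrite vE dv mul0r oppr0 scale0r.
pose q (z : V) : K := (f (z 0 j))^-1.
have holq (z : V) : nv z < 1 -> differentiable q z.
  move=> /coord1 z1; have [a Ha] := cholV (fN0 _ z1) (fhol _ z1).
  by have [] := is_diff_coord_comp (f := fun t : K => (f t)^-1 : K) Ha.
have pE (z : V) : nv z < 1 -> inv_deriv_apply (scaled_id g) z = q z *: z.
  move=> z1; have [->|z0] := eqVneq z 0.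
    by rewrite /inv_deriv_apply /scaled_id !scaler0 mul0mx.
  have [_ ->] := inv_deriv_applyE (holg _ z1) (Junit _ z1) z0.
  congr (_ *: _); rewrite sE// /g /q invfM mulrA divff ?mul1r//; exact: gamN0.
have pdiff (z : V) : nv z < 1 ->
    is_diff z (inv_deriv_apply (scaled_id g)) (fun v => 'd q z v *: z + q z *: v).
  move=> z1; have d0 : 0 < ((1 - nv z)%:C)%C :> K by rewrite ltcR subr_gt0.
  have near (h : V) : `|h| < ((1 - nv z)%:C)%C ->
      q (z + h) *: (z + h) = inv_deriv_apply (scaled_id g) (z + h).
    rewrite normr_nv ltcR => hz; apply: esym; apply: pE.
    by apply: le_lt_trans (nvD _ _) _; lra.
  exact: (is_diff_near d0 near (is_diff_scaled_id (holq _ z1))).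
have nv01 : nv (0 : V) < 1 by rewrite nv0.
have adm : admissible (Phi : K -> K) g.
  split; [by move=> z /unit_polydiscP; exact: holg|by rewrite /g mxE|split].
    by move=> z /unit_polydiscP; exact: Junit.
  split.
  - by move=> z /unit_polydiscP/pdiff[].
  - by rewrite pE// scaler0.
  - move=> v; have H := pdiff 0 nv01.
    rewrite (congr1 (fun F => F v) (diff_val (is_diff_def := H))) /=.
    by rewrite scaler0 add0r /q mxE f0 invr1 scale1r.
  - move=> z l /unit_polydiscP z1 z0 zl; rewrite pE// mxE.
    have zl0 : z 0 l != 0 by rewrite -normr_eq0 zl normr_eq0.
    have fz0 := fN0 _ (coord1 _ z1).
    split; first by rewrite mulf_neq0// invr_eq0.
    (* The quotient is [Phi (i * z 0 j)] for every [l], so one witness serves whichever coordinate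
       is largest. *)
    exists (i * z 0 j); last by rewrite -/(f _) /q; field; rewrite fz0.
    by rewrite /unit_disk /= normr_cm ltcR; apply: ci; exact: coord1.
exists g => //.
pose e : V := delta_mx 0 j.
(* Any real multiple of [e] strictly between 0 and 1 would do; coordinate [j] carries the whole
   norm. *)
pose z : V := ((2^-1 : R)%:C)%C *: e.
have zj : z 0 j = ((2^-1 : R)%:C)%C by rewrite !mxE !eqxx mulr1.
have h2 : `|2^-1 : R| = 2^-1 by rewrite ger0_norm.
have nz : nv z = 2^-1.
  apply/eqP; rewrite eq_le; apply/andP; split.
    rewrite nvZ cm_real h2 ler_piMr//; exact: nv_delta.
  by have := cm_coord z j; rewrite zj cm_real h2.
have nz1 : nv z < 1 by rewrite nz; lra.
exists z; split; [exact: nz1|by rewrite -nv_eq0 nz invr_eq0 pnatr_eq0|].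
apply: le_trans (cm_coord _ j); rewrite sqr_coef_diff_coord//.
have A1 : 'd g 0 z = (b%:C)%C * i * ((2^-1 : R)%:C)%C :> C.
  by rewrite gE// zj mxE gam0 k0 mulr1.
pose m (t : C) := k t * gam t * ((2^-1 : R)%:C)%C.
have mD := cderivM (cderivM kD (gamD 0 z01)) (cderiv_cst ((2^-1 : R)%:C)%C 0).
have A2 : 'd (fun y => 'd g y z : K) 0 z = (- ((d / 2)%:C)%C * gam 0 +
    k 0 * (k 0 * gam 0)) * ((2^-1 : R)%:C)%C ^+ 2 :> C.
  have mD0 : cderiv m ((0 : V) 0 j) ((- ((d / 2)%:C)%C * gam 0 +
    k 0 * (k 0 * gam 0)) * ((2^-1 : R)%:C)%C).
    by rewrite mxE; apply: cderiv_eq mD _; rewrite mulr0 addr0.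
  have H1 : is_diff (0 : V) (fun y : V => m (y 0 j) : K) (fun v : V =>
      (- ((d / 2)%:C)%C * gam 0 + k 0 * (k 0 * gam 0)) * ((2^-1 : R)%:C)%C * v 0 j : K).
    exact: is_diff_coord_comp mD0.
  have d0 : 0 < ((1 - nv (0 : V))%:C)%C :> K by rewrite ltcR subr_gt0.
  have near (h : V) : `|h| < ((1 - nv (0 : V))%:C)%C ->
      m ((0 + h) 0 j) = 'd g (0 + h) z :> C.
    rewrite add0r normr_nv ltcR nv0 subr0 => hz; rewrite gE// zj.
    reflexivity.
  have H : is_diff (0 : V) (fun y : V => 'd g y z : K) (fun v : V =>
      (- ((d / 2)%:C)%C * gam 0 + k 0 * (k 0 * gam 0)) * ((2^-1 : R)%:C)%C * v 0 j : K).
    exact: (@is_diff_near _ _ _ (fun y : V => m (y 0 j) : K) (fun y : V => 'd g y z : K) 0 _ _ d0 near H1).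
  apply: etrans (congr1 (fun F => F z) (diff_val (is_diff_def := H))) _.
  have aux (x y : C) : x * y * y = x * y ^+ 2 by ring.
  by rewrite zj; exact: aux.
rewrite gam0 !mulr1 k0 in A2.
have E (x1 x2 x : C) : x1 = (- ((d / 2)%:C)%C + (b%:C)%C * i * ((b%:C)%C * i)) * ((2^-1 : R)%:C)%C ^+ 2 ->
    x2 = (b%:C)%C * i * ((2^-1 : R)%:C)%C -> x = ((2^-1 : R)%:C)%C ->
    coef_bound b d 2^-1 <= cm (x ^+ 2 * ((x1 / 2) ^+ 2 - x2 ^+ 2)).
  move=> -> -> ->; rewrite coef_boundE ?gt_eqF//.
  have iE : i ^+ 2 = -1 by rewrite expr2 ii.
  have -> : (b%:C)%C * i * ((b%:C)%C * i) = - (b%:C)%C ^+ 2.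
    by rewrite mulrACA ii mulrN1 expr2.
  have -> : ((b%:C)%C * i * ((2^-1 : R)%:C)%C) ^+ 2 = - ((b%:C)%C * ((2^-1 : R)%:C)%C) ^+ 2.
    by rewrite mulrAC exprMn iE mulrN1.
  (* The factors [i] have turned the difference of squares into a sum of real squares, so the
     coordinate is exactly the real number [c]. *)
  set c := (X in X <= _).
  have -> : ((2^-1 : R)%:C)%C ^+ 2 *
     (((- ((d / 2)%:C)%C + - (b%:C)%C ^+ 2) * ((2^-1 : R)%:C)%C ^+ 2 / 2) ^+ 2 -
     - ((b%:C)%C * ((2^-1 : R)%:C)%C) ^+ 2) = (c%:C)%C.
    rewrite /c !(rmorphM, rmorphD, rmorphXn) /= !fmorphV !rmorph_nat.
    by move: (b%:C)%C (d%:C)%C => x' y'; field.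
  by rewrite cm_real; exact: ler_norm.
rewrite nz; exact: E A2 A1 zj.
Qed.

End extremal.

Unset Implicit Arguments.

Theorem theorem2p6 (R : realType) (n : nat) (Phi : R[i] -> R[i])
    (hn : (0 < n)%N)
    (Phi_bihol : biholomorphic_onto_image (@unit_disk R[i]) Phi)
    (Phi0 : Phi 0 = 1)
    (Phi_Re : forall z : R[i], unit_disk z -> 0 < 'Re (Phi z))
    (dPhi_gt0 : 0 < deriv_at 1 Phi 0)
    (ddPhi_real : deriv_at 2 Phi 0 \is Num.real)
    (dPhi_bound : 2 * deriv_at 1 Phi 0 <= `|deriv_at 2 Phi 0 + 2 * (deriv_at 1 Phi 0) ^+ 2|) :
  let bound (z : 'rV[R[i]]_n) : R[i] :=
    (deriv_at 1 Phi 0) ^+ 2 * `|z| ^+ 6 / 4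
      * (2^-1 * (deriv_at 2 Phi 0 / deriv_at 1 Phi 0) + deriv_at 1 Phi 0) ^+ 2
    + (deriv_at 1 Phi 0 * `|z| ^+ 2) ^+ 2 in
  (forall g : 'rV[R[i]]_n -> R[i], admissible Phi g ->
     forall z, unit_polydisc z ->
       `|sqr_coef_diff (scaled_id g) z| <= bound z) /\
  (exists2 g : 'rV[R[i]]_n -> R[i], admissible Phi g &
     exists z : 'rV[R[i]]_n, [/\ unit_polydisc z, z != 0 &
       `|sqr_coef_diff (scaled_id g) z| = bound z]).
Proof.
have [Phi_hol _ [h h_hol hK]] := Phi_bihol.
have inD (z : R[i]) : cm z < 1 -> unit_disk z.
  by move=> z1; rewrite /unit_disk /= normr_cm ltcR.
have Phol (z : R[i]) : cm z < 1 -> chol Phi z.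
  by move=> /inD/Phi_hol/chol_diffP.
have hhol (z : R[i]) : cm z < 1 -> chol h (Phi z).
  by move=> /inD z1; apply/chol_diffP; apply: h_hol; exists z.
have hP (z : R[i]) : cm z < 1 -> h (Phi z) = z by move=> /inD; exact: hK.
(* Needed for the extremal map, in which p(z) is z divided by [Phi (i * z 0 j)]. *)
have PhiN0 (z : R[i]) : cm z < 1 -> Phi z != 0.
  move=> /inD/Phi_Re; apply: contraTneq => ->; rewrite -complexRe /=.
  by rewrite ltxx.
pose b := complex.Re (deriv_at 1 Phi 0).
pose d := complex.Re (deriv_at 2 Phi 0).
have bC : deriv_at 1 Phi 0 = (b%:C)%C := esym (RRe_real (gtr0_real dPhi_gt0)).
have dC : deriv_at 2 Phi 0 = (d%:C)%C := esym (RRe_real ddPhi_real).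
have bE : cD Phi 0 = (b%:C)%C := etrans (esym (deriv_at1 Phi 0)) bC.
have dE : cD (cD Phi) 0 = (d%:C)%C := etrans (esym (deriv_at2 Phi 0)) dC.
clearbody b d.
move: (deriv_at 1 Phi 0) (deriv_at 2 Phi 0) bC dC dPhi_gt0 ddPhi_real dPhi_bound.
move=> _ _ -> -> dPhi_gt0 _ dPhi_bound.
have b0 : 0 < b by rewrite -ltcR.
have bd : b <= `|d / 2 + b ^+ 2|.
  have two : 2 = ((2 : R)%:C)%C :> R[i] by rewrite rmorph_nat.
  move: dPhi_bound; rewrite two -!(rmorphM, rmorphXn, rmorphD) normr_cm cm_real lecR.
  have -> : d + 2 * b ^+ 2 = 2 * (d / 2 + b ^+ 2) by field.
  by rewrite normrM ger0_norm// ler_pM2l.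
move=> bound.
have boundE z : bound z = ((coef_bound b d (nv z))%:C)%C.
  rewrite /bound /coef_bound normr_nv.
  by rewrite !(rmorphM, rmorphD, rmorphXn) /= !fmorphV !rmorph_nat.
have upper g : admissible Phi g -> forall z, unit_polydisc z ->
    `|sqr_coef_diff (scaled_id g) z| <= bound z.
  move=> adm z /unit_polydiscP z1; rewrite boundE normr_nv lecR.
  exact: sqr_coef_diff_bound Phol Phi0 hhol hP b0 bE dE bd adm z z1.
split; first exact: upper.
(* [Ordinal hn] is the first coordinate. The extremal function is only shown to reach at least the
   bound; equality then follows from [upper]. *)
have [g adm [z [z1 z0 le1]]] := extremal_function (Ordinal hn) Phol Phi0 PhiN0 b0 bE dE.
exists g => //; exists z; split => //; first exact/unit_polydiscP.
apply/eqP; rewrite eq_le upper//=; last exact/unit_polydiscP.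
by rewrite boundE normr_nv lecR.
Qed.
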